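(* Let $1<p<N$, let $R,\mu>0$, let $B=B(0,R)\subset\mathbb R^N$, and let $u\in W^{1,p}_0(B)$ be a possibly sign-changing radial weak solution to the equation $$-\Delta_p u=\mu|u|^{p^*-2}u\quad\text{in } B.$$ Then $u\equiv 0$.
   Context: Functions are real-valued. $\Delta_p u=\operatorname{div}(|\nabla u|^{p-2}\nabla u)$ and $p^*=Np/(N-p)$ for $1<p<N$. $B(0,R)$ is the open ball of $\mathbb R^N$ of radius $R$ centred at the origin. Weak solution means $\int_B|\nabla u|^{p-2}\nabla u\cdot\nabla h\,dx=\mu\int_B|u|^{p^*-2}u\,h\,dx$ for all $h\in W_0^{1,p}(B)$. *)

(* Defs.v *)
From HB Require Import structures.
From mathcomp Require Import all_boot all_order all_algebra.
From mathcomp Require Import all_classical all_reals all_analysis.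

Set Implicit Arguments.
Unset Strict Implicit.
Unset Printing Implicit Defensive.

Import Order.TTheory GRing.Theory Num.Theory.
Import numFieldNormedType.Exports.

Local Open Scope classical_set_scope.
Local Open Scope ring_scope.

(* Row vectors carry the product sigma-algebra generated by the coordinates
   (the Borel sigma-algebra), as the library does for [n.-tuple T]. *)
Section measurable_rV.
Context (R : realType) (n : nat).

Let coords : 'I_n -> 'rV[R]_n -> R := fun i x => x ord0 i.

Let rV_set0 : g_sigma_preimage coords set0.
Proof. exact: sigma_algebra0. Qed.

Let rV_setC A : g_sigma_preimage coords A -> g_sigma_preimage coords (~` A).
Proof. exact: sigma_algebraC. Qed.

Let rV_bigcup (F : (set 'rV[R]_n)^nat) :
  (forall i, g_sigma_preimage coords (F i)) ->
  g_sigma_preimage coords (\bigcup_i (F i)).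
Proof. exact: sigma_algebra_bigcup. Qed.

HB.instance Definition _ := @isMeasurable.Build default_measure_display
  'rV[R]_n (g_sigma_preimage coords) rV_set0 rV_setC rV_bigcup.

End measurable_rV.

Lemma measurable_coord (R : realType) (n : nat) (i : 'I_n) :
  measurable_fun [set: 'rV[R]_n] (fun x => x ord0 i).
Proof.
move=> _ Y mY; rewrite setTI; apply: sub_sigma_algebra => /=.
rewrite -bigcup_seq/=; exists i => /=; first by rewrite mem_index_enum.
by exists Y => //; rewrite setTI.
Qed.

Lemma measurable_fun_rV d (T : measurableType d) (R : realType) (n : nat)
    (f : T -> 'rV[R]_n) :
  (forall i, measurable_fun setT (fun t => f t ord0 i)) ->
  measurable_fun setT f.
Proof.
move=> mf; apply: (@measurability _ _ _ _ _ _
  (\big[setU/set0]_(i < n) preimage_set_system setT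
    (fun x : 'rV[R]_n => x ord0 i) measurable)) => // _ [B + <-].
rewrite -bigcup_seq => -[i _ [C mC <-]].
by rewrite setTI -comp_preimage; exact: mf.
Qed.

Section lebesgue_rV.
Context {R : realType}.

Definition cons_rV n (p : measurableTypeR R * 'rV[R]_n) : 'rV[R]_n.+1 :=
  row_mx (p.1 : R)%:M p.2 : 'rV[R]_(1 + n).

Definition uncons_rV n (x : 'rV[R]_n.+1) : measurableTypeR R * 'rV[R]_n :=
  (x ord0 ord0, @rsubmx R 1 1 n x).

Lemma cons_rV0 n (p : measurableTypeR R * 'rV[R]_n) : cons_rV p ord0 ord0 = p.1.
Proof.
rewrite (_ : (ord0 : 'I_n.+1) = lshift n (ord0 : 'I_1)); last exact: val_inj.
by apply: etrans (row_mxEl _ _ _ _) _; rewrite mxE eqxx mulr1n.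
Qed.

Lemma cons_rVS n (p : measurableTypeR R * 'rV[R]_n) (i : 'I_n) :
  cons_rV p ord0 (lift ord0 i) = p.2 ord0 i.
Proof.
have -> : lift ord0 i = rshift 1 i by exact: val_inj.
exact: row_mxEr.
Qed.

Lemma cons_rVK n : cancel (@cons_rV n) (@uncons_rV n).
Proof. by move=> p; rewrite /uncons_rV cons_rV0 row_mxKr; case: p. Qed.

Lemma measurable_cons_rV n : measurable_fun setT (@cons_rV n).
Proof.
apply: measurable_fun_rV => i.
have [j ->|->] := unliftP ord0 i; last first.
  by under eq_fun do rewrite cons_rV0; exact: measurable_fst.
under eq_fun do rewrite cons_rVS.
by apply: (measurableT_comp (measurable_coord j)); exact: measurable_snd.
Qed.

Lemma measurable_uncons_rV n : measurable_fun setT (@uncons_rV n).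
Proof.
apply/measurable_fun_pairP; split; first exact: (measurable_coord ord0).
apply: measurable_fun_rV => i.
rewrite (_ : (fun _ => _) = fun x : 'rV[R]_n.+1 => x ord0 (lift ord0 i)).
  exact: measurable_coord.
by apply/funext => x; rewrite /= mxE; congr (x _ _); exact: val_inj.
Qed.

Definition lebesgue_cons n (mu : {sigma_finite_measure set 'rV[R]_n -> \bar R}) :
    set 'rV[R]_n.+1 -> \bar R :=
  pushforward (lebesgue_measure \x mu)%E (@cons_rV n).

HB.instance Definition _ n mu :=
  Measure.copy (@lebesgue_cons n mu)
    (measure_function_pushforward__canonical__measure_function_Measure
      (lebesgue_measure \x mu)%E (@measurable_cons_rV n)).

Lemma lebesgue_cons_sigma_finite n
    (mu : {sigma_finite_measure set 'rV[R]_n -> \bar R}) :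
  sigma_finite setT (lebesgue_cons mu).
Proof.
have /sigma_finiteP[F [TF ndF Foo]] := sigma_finiteT (@lebesgue_measure R).
have /sigma_finiteP[G [TG ndG Goo]] := sigma_finiteT mu.
exists (fun k => @uncons_rV n @^-1` (F k `*` G k)).
  rewrite -preimage_bigcup -[LHS](preimage_setT (@uncons_rV n)); congr (_ @^-1` _).
  rewrite -setXTT TF TG predeqE => -[x y]; split.
    move=> [/= [k _ Fkx] [l _ Gly]]; exists (maxn k l) => //; split.
    - by move: x Fkx; exact/subsetPset/ndF/leq_maxl.
    - by move: y Gly; exact/subsetPset/ndG/leq_maxr.
  by move=> [k _ []/= ? ?]; split; exists k.
move=> k; have [? ?] := Foo k; have [? ?] := Goo k; split.
  by rewrite -[_ @^-1` _]setTI; apply: measurable_uncons_rV => //; exact: measurableX.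
rewrite /lebesgue_cons /pushforward -comp_preimage.
rewrite (_ : _ \o _ = id); last by apply/funext => p; exact: cons_rVK.
by rewrite preimage_id product_measure1E// lte_mul_pinfty// ge0_fin_numE.
Qed.

HB.instance Definition _ n mu :=
  Measure_isSigmaFinite.Build _ _ _ (@lebesgue_cons n mu)
    (@lebesgue_cons_sigma_finite n mu).

(* Lebesgue measure on R^n as the n-fold product of [lebesgue_measure]. *)
Fixpoint lebesgue_rV (n : nat) : {sigma_finite_measure set 'rV[R]_n -> \bar R} :=
  match n with
  | 0 => \d_(0 : 'rV[R]_0)
  | n.+1 => @lebesgue_cons n (lebesgue_rV n)
  end.

Lemma measurable_rV_box n (A : 'I_n -> set R) : (forall i, measurable (A i)) ->
  measurable [set x : 'rV[R]_n | forall i, A i (x ord0 i)].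
Proof.
move=> mA; rewrite (_ : [set _ | _] =
    \bigcap_(i in [set: 'I_n]) ((fun x : 'rV[R]_n => x ord0 i) @^-1` A i)).
  apply: fin_bigcap_measurable => [|i _]; first exact: finite_finset.
  by rewrite -[_ @^-1` _]setTI; exact: measurable_coord.
by apply/seteqP; split => [x Ax i _|x Ax i]; exact: Ax.
Qed.

Lemma lebesgue_rV_box n (A : 'I_n -> set R) : (forall i, measurable (A i)) ->
  lebesgue_rV n [set x : 'rV[R]_n | forall i, A i (x ord0 i)] =
  (\prod_(i < n) lebesgue_measure (A i))%E.
Proof.
elim: n A => [|n IH] A mA.
  by rewrite big_ord0 /= diracE mem_set// => -[].
rewrite big_ord_recl -(IH (fun i => A (lift ord0 i)))//.
have mS := measurable_rV_box (fun i => mA (lift ord0 i)).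
rewrite -product_measure1E//=; last exact: (mA ord0).
rewrite /lebesgue_cons /pushforward.
congr ((lebesgue_measure \x lebesgue_rV n)%E _).
apply/seteqP; split => [p Ap|p [A0 AS] i] /=.
  split => [|i]; [have := Ap ord0|have := Ap (lift ord0 i)].
    by rewrite cons_rV0.
  by rewrite cons_rVS.
have [j ->|->] := unliftP ord0 i; first by rewrite cons_rVS; exact: AS.
by rewrite cons_rV0.
Qed.

End lebesgue_rV.

Section euclidean.
Context {R : realType} {n : nat}.
Implicit Types x y : 'rV[R]_n.

Definition dotp x y : R := \sum_(i < n) x ord0 i * y ord0 i.

(* The norm [`|x|] of the library on row vectors is the sup norm. *)
Definition enorm x : R := Num.sqrt (dotp x x).

Definition eball (r : R) : set 'rV[R]_n := [set x | enorm x < r].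

Definition partial (i : 'I_n) (f : 'rV[R]_n -> R) : 'rV[R]_n -> R :=
  fun x => 'D_(delta_mx ord0 i) f x.

(* C^oo: the partial derivatives of all orders are differentiable. *)
Definition smooth (f : 'rV[R]_n -> R) :=
  forall (s : seq 'I_n) x, differentiable (foldr partial f s) x.

(* C_c^oo(D), its elements being extended by 0 outside D. *)
Definition test_fun (D : set 'rV[R]_n) (f : 'rV[R]_n -> R) :=
  [/\ smooth f, compact (closure [set x | f x != 0]) &
      closure [set x | f x != 0] `<=` D].

End euclidean.

Section sobolev.
Context {R : realType} {n : nat}.
Local Notation mu := (@lebesgue_rV R n).
Implicit Types (D : set 'rV[R]_n) (p : R) (u : 'rV[R]_n -> R)
  (G : 'rV[R]_n -> 'rV[R]_n).

(* Functions are Borel representatives; only their values on D matter. *)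
Definition Lp D p u := (u \_ D) \in Lfun mu p%:E.

Definition Lp_cvg D p (v : (('rV[R]_n) -> R)^nat) u :=
  ('N[mu]_p%:E [EFin \o ((v k \- u)%R \_ D)])%E @[k --> \oo] --> 0%E.

Definition weak_gradient D u G := forall phi, test_fun D phi -> forall i,
  \int[mu]_(x in D) (u x * partial i phi x) =
  - \int[mu]_(x in D) (G x ord0 i * phi x).

(* u belongs to W^{1,p}(D), with weak gradient G *)
Definition W1p D p u G :=
  [/\ Lp D p u, forall i, Lp D p (fun x => G x ord0 i) & weak_gradient D u G].

(* u belongs to W_0^{1,p}(D), the closure of C_c^oo(D) in W^{1,p}(D), with weak
   gradient G; the latter is determined by u almost everywhere on D. *)
Definition W1p0 D p u G := W1p D p u G /\
  exists phi : ('rV[R]_n -> R)^nat,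
    [/\ forall k, test_fun D (phi k), Lp_cvg D p phi u &
        forall i, Lp_cvg D p (fun k => partial i (phi k))
                             (fun x => G x ord0 i)].

Definition radial D u :=
  exists g : R -> R, {ae mu, forall x, D x -> u x = g (enorm x)}.

(* p^* *)
Definition critical_exponent p : R := n%:R * p / (n%:R - p).

(* u, with weak gradient G, is a weak solution in W_0^{1,p}(D) of
   - Delta_p u = lambda |u|^(p^* - 2) u. *)
Definition weak_solution D p lambda u G :=
  W1p0 D p u G /\
  forall h H, W1p0 D p h H ->
    \int[mu]_(x in D) (enorm (G x) `^ (p - 2) * dotp (G x) (H x)) =
    lambda *
      \int[mu]_(x in D) (`|u x| `^ (critical_exponent p - 2) * u x * h x).

End sobolev.

(* Main.v *)
From HB Require Import structures.
Require Import Defs.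
From mathcomp Require Import all_boot all_order all_algebra.
From mathcomp Require Import all_classical all_reals all_analysis.
From mathcomp Require Import measurable_realfun.
From mathcomp Require Import perm.
From mathcomp Require Import ring lra.
Import HBNNSimple.
Set Implicit Arguments.
Unset Strict Implicit.
Unset Printing Implicit Defensive.
Import Order.TTheory GRing.Theory Num.Theory.
Import numFieldNormedType.Exports.
Local Open Scope classical_set_scope.
Local Open Scope ring_scope.

(** Throughout, [q] is the critical exponent, [N] the dimension, and functions
    of the squared radius [s = dotp x x] are used instead of functions of the
    radius, because [dotp x x] is a polynomial in the coordinates.

    Reduction to one variable. A function of [W_0^{1,p}] is, on almost every
    line parallel to an axis, the primitive of its partial derivative
    ([W1p0_slice]). When it is radial, the lines at different distances from
    the origin all see the same function, so it is [z (dotp x x)] for a single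
    [z], continuous on the positive half-line and zero from [r ^+ 2] on
    ([radial_profile]), and its gradient is [2 x z' (dotp x x)]
    ([radial_gradient]). Testing the equation with [rho (dotp x x)] and
    integrating over spheres ([ge0_integral_radial]) leaves a weak equation on
    an interval ([radial_weak_equation]). There a du Bois-Reymond argument
    ([weak_derivative_ae]) shows that the flux is almost everywhere a C^1
    function; since [t |-> |t|^(p-2) t] is invertible, [z] is C^1 as well and
    the equation holds pointwise for [0 < s < r ^+ 2] ([interior_regularity]).

    The ordinary differential equation. With [v t = z (t ^+ 2)] and
    [y = |v'|^(p-2) v'] one has [y' = - mu |v|^(q-2) v - (N - 1) y / t] on
    [(0, r)], and all that is known at the ends is that [t^(N-1) |v'|^p] is
    integrable and that [v] tends to 0 at [r]. Because [q] is critical, the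
    Pohozaev quantity
    [P = t^N ((p-1)/p |v'|^p + mu/q |v|^q) + (N-p)/p t^(N-1) y v]
    is constant ([pohozaev_cst]).

    It vanishes ([pohozaev_eq0]). Put [A = t^N |v'|^p] and
    [Z = t^(N-p) |v|^p]. By Young's inequality [|P|] is controlled by [A + Z],
    so [P <> 0] would give [m <= A + Z] for some [m > 0]; also
    [k Z - C A <= t Z'] with [k = (N - p) / 2], and [A / t] is integrable.
    Hence [Z], corrected by a bounded primitive of [A / t], loses at least
    [k m] per unit of [- ln t] as [t] decreases to 0, which contradicts
    [0 <= Z]. This is where the finite energy is used: near the
    origin, singular solutions with [P <> 0] do exist.

    Then [v = 0] ([emden_fowler_eq0]). With [P = 0] and [v] tending to 0 at
    [r], the energy [E = (p-1)/p |v'|^p + mu/q |v|^q] tends to 0 at [r] too: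
    the boundary regularity of [v'] comes for free. As
    [E' = - (N - 1) |v'|^p / t], the product of [E] by a large power of [t] is
    nondecreasing, so that [E <= 0] on [(0, r)]. *)

(** * Invariance of Lebesgue measure and the volume of balls *)

(** Boxes generate the sigma-algebra and are stable
    under intersection. This is the source of the scaling and permutation
    invariance of [lebesgue_rV], which is built one coordinate at a time and
    so has neither by definition. *)
Lemma lebesgue_rV_unique (R : realType) (n : nat)
    (m : {measure set 'rV[R]_n -> \bar R}) :
  (forall A : 'I_n -> set R, (forall i, measurable (A i)) ->
    m [set x : 'rV[R]_n | forall i, A i (x ord0 i)] =
    (\prod_(i < n) lebesgue_measure (A i))%E) ->
  forall A, measurable A -> m A = lebesgue_rV n A.
Proof.
move=> mbox.
pose G : set (set 'rV[R]_n) := [set B | exists A : 'I_n -> set R,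
  (forall i, measurable (A i)) /\ B = [set x : 'rV[R]_n | forall i, A i (x ord0 i)]].
pose g (k : nat) := [set x : 'rV[R]_n | forall i, `]- k%:R, k%:R]%classic (x ord0 i)].
apply: (@measure_unique _ _ _ G g).
- apply/seteqP; split.
    apply: smallest_sub; first exact: smallest_sigma_algebra.
    move=> B; rewrite -bigcup_seq => -[i _ [C mC <-]].
    apply: sub_sigma_algebra.
    exists (fun j => if j == i then C else setT); split.
      by move=> j; case: ifP.
    apply/seteqP; split => x /=.
      by move=> [_ Cx] j; case: eqP => [->|].
    by move=> /(_ i); rewrite eqxx.
  apply: smallest_sub; first exact: sigma_algebra_measurable.
  by move=> B [A [mA ->]]; exact: measurable_rV_box.
- move=> B1 B2 [A1 [mA1 ->]] [A2 [mA2 ->]].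
  exists (fun i => A1 i `&` A2 i); split; first by move=> i; exact: measurableI.
  apply/seteqP; split => x /=.
    by move=> [h1 h2] i; split; [exact: h1|exact: h2].
  by move=> h; split => i; have [] := h i.
- by move=> k; exists (fun=> `]- k%:R, k%:R]%classic).
- apply/seteqP; split => // x _.
  exists (Num.trunc `|x|).+1 => // i; rewrite /= in_itv/=.
  have xi : `|x ord0 i| < (Num.trunc `|x|).+1%:R.
    apply: le_lt_trans (truncnS_gt _).
    rewrite [leRHS]mx_normrE; apply: (le_trans _ (le_bigmax _ _ (ord0, i))) => //=.
  by move: xi; rewrite ltr_norml => /andP[-> /ltW].
- by move=> B [A [mA ->]]; exact: etrans (mbox _ mA) (esym (lebesgue_rV_box mA)).
- move=> k; rewrite [m _](mbox (fun=> `]- k%:R, k%:R]%classic))//=.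
  rewrite (eq_bigr (fun=> (k%:R + k%:R)%:E)); last first.
    move=> i _; rewrite lebesgue_measure_itv/= lte_fin.
    case: ltP => [h|]; first by rewrite -EFinB opprK.
    move=> h; have k0 : k%:R = 0 :> R.
      apply/eqP; rewrite eq_le ler0n andbT (le_trans h)// oppr_le0; exact: ler0n.
    by rewrite k0 addr0.
  by rewrite prodEFin ltry.
Qed.

(** The sigma-algebra is the product one, while
    [open] refers to the sup norm: the two agree because an open set is a
    countable union of boxes with rational centres and radii [1 / (k + 1)]. *)
Lemma rV_open_measurable (R : realType) (n : nat) (O : set 'rV[R]_n) :
  open O -> measurable O.
Proof.
move=> oO.
pose B (q : 'rV[rat]_n * nat) : set 'rV[R]_n :=
  [set x | forall i, `|ratr (q.1 ord0 i) - x ord0 i| < q.2.+1%:R^-1].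
pose F q := if `[< B q `<=` O >] then B q else set0.
rewrite (_ : O = \bigcup_q F q).
  apply: countable_bigcupT_measurable; first exact: countableP.
  move=> q; rewrite /F; case: asboolP => // _.
  apply: (@measurable_rV_box R n (fun i => [set y | `|ratr (q.1 ord0 i) - y| < q.2.+1%:R^-1])).
  move=> i; rewrite (_ : [set _ | _] = ball (ratr (q.1 ord0 i) : R) q.2.+1%:R^-1)//.
  exact: measurable_ball.
apply/seteqP; split => x.
  move=> Ox; have /nbhs_ballP[e /= e0 eO] := open_nbhs_nbhs (conj oO Ox).
  have [k ke] : exists k : nat, k.+1%:R^-1 + k.+1%:R^-1 < e.
    have e20 : 0 < e / 2 by rewrite divr_gt0.
    have := near_infty_natSinv_lt (PosNum e20).
    by case=> k _ /(_ k (leqnn k)) /= h; exists k; rewrite [ltRHS](splitr e) ltrD.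
  have [q hq] : exists q : 'rV[rat]_n, forall i, `|ratr (q ord0 i) - x ord0 i| < k.+1%:R^-1.
    have /choice[q hq] : forall i : 'I_n, exists q : rat, `|ratr q - x ord0 i| < k.+1%:R^-1.
      move=> i.
      have /(rat_in_itvoo)[q] : x ord0 i - k.+1%:R^-1 < x ord0 i + k.+1%:R^-1.
        by rewrite ltrBlDr -addrA ltrDl addr_gt0.
      by rewrite in_itv/= => h; exists q; rewrite ltr_distl.
    by exists (\row_j q j) => i; rewrite mxE.
  exists (q, k) => //.
  have h : B (q, k) `<=` O.
    move=> y /= yq; apply: eO.
    rewrite -ball_normE /ball_/=.
    rewrite (le_lt_trans _ ke)//.
    rewrite [leLHS]mx_normrE; apply/bigmax_leP; split; first by rewrite addr_ge0.
    move=> [i j] _ /=; rewrite (ord1 i) !mxE.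
    rewrite -(subrK (ratr (q ord0 j)) (x ord0 j)) -addrA (le_trans (ler_normD _ _))// lerD//.
      by rewrite distrC ltW.
    exact: ltW.
  by rewrite /F; case: asboolP.
by move=> [q _]; rewrite /F; case: asboolP => // h /h.
Qed.

Lemma rV_continuous_measurable (R : realType) (n : nat) (f : 'rV[R]_n -> R) :
  continuous f -> measurable_fun setT f.
Proof.
move=> cf; apply: (measurability _ (RGenOpens.measurableE R)) => //.
move=> _ [_ [a [b ->] <-]]; rewrite setTI.
by apply: rV_open_measurable; apply: open_comp => // x _; exact: cf.
Qed.

Lemma lebesgue_scale (R : realType) (c : R) (A : set R) : 0 < c -> measurable A ->
  lebesgue_measure [set x | A (c * x)] = (c^-1%:E * lebesgue_measure A)%E.
Proof.
move=> c0 mA.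
have mc : measurable_fun [set: measurableTypeR R] (fun x : measurableTypeR R => c * x : measurableTypeR R).
  exact: mulrl_measurable.
pose m := mscale (NngNum (ltW c0)) (measure_function_pushforward__canonical__measure_function_Measure (@lebesgue_measure R) mc).
have h : forall X, ocitv X -> lebesgue_measure X = m X.
  move=> _ [[a b] _ <-] /=.
  rewrite /m /mscale/= /pushforward.
  rewrite (_ : _ @^-1` _ = `]c^-1 * a, c^-1 * b]%classic); last first.
    by apply/seteqP; split => x /=; rewrite !in_itv/= ![c^-1 * _]mulrC ltr_pdivrMr// ler_pdivlMr// [x * c]mulrC.
  rewrite !lebesgue_measure_itv/= !lte_fin ltr_pM2l ?invr_gt0//.
  case: ifP => _; last by rewrite mule0.
  by rewrite -EFinM -!EFinB -mulrBr mulVKf// gt_eqF.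
have := lebesgue_measure_unique h mA => ->.
rewrite /m /mscale/= /pushforward muleA -EFinM mulVf ?mul1e//.
by rewrite gt_eqF.
Qed.

Lemma rV_scale_measurable (R : realType) (n : nat) (c : R) :
  measurable_fun setT (fun x : 'rV[R]_n => c *: x).
Proof.
apply: measurable_fun_rV => i; under eq_fun do rewrite mxE.
by apply: measurable_funM => //; exact: measurable_coord.
Qed.

Lemma lebesgue_rV_scale (R : realType) (n : nat) (c : R) (A : set 'rV[R]_n) :
  0 < c -> measurable A ->
  lebesgue_rV n [set x | A (c *: x)] = ((c ^- n)%:E * lebesgue_rV n A)%E.
Proof.
move=> c0 mA.
have cn0 : 0 < c ^+ n by rewrite exprn_gt0.
pose m := mscale (NngNum (ltW cn0)) (measure_function_pushforward__canonical__measure_function_Measure (lebesgue_rV n) (@rV_scale_measurable R n c)).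
have h : m A = lebesgue_rV n A.
  apply: lebesgue_rV_unique => // B mB.
  transitivity ((c ^+ n)%:E * lebesgue_rV n
      [set x : 'rV[R]_n | forall i, [set y | B i (c * y)%R] (x ord0 i)])%E.
    congr (_ * lebesgue_rV n _)%E.
    by apply/seteqP; split => x /= h i; have := h i; rewrite mxE.
  have mBc i : measurable [set y | B i (c * y)].
    rewrite -[X in measurable X]setTI.
    by apply: (mulrl_measurable c) => //; exact: mB.
  rewrite [X in (_ * X)%E](lebesgue_rV_box mBc).
  rewrite (eq_bigr (fun i => c^-1%:E * lebesgue_measure (B i))%E); last first.
    by move=> i _; rewrite lebesgue_scale.
  rewrite big_split/= prodEFin prodr_const card_ord muleA -EFinM -exprMn divff ?expr1n ?mul1e//.
  by rewrite gt_eqF.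
rewrite -h /m /mscale/= /pushforward muleA -EFinM mulVf ?mul1e//.
by rewrite gt_eqF.
Qed.

Lemma rV_perm_measurable (R : realType) (n : nat) (s : {perm 'I_n}) :
  measurable_fun setT (@col_perm R 1 n s).
Proof.
apply: measurable_fun_rV => i; under eq_fun do rewrite mxE.
exact: measurable_coord.
Qed.

Lemma lebesgue_rV_perm (R : realType) (n : nat) (s : {perm 'I_n}) (A : set 'rV[R]_n) :
  measurable A ->
  pushforward (lebesgue_rV n) (@col_perm R 1 n s) A = lebesgue_rV n A.
Proof.
apply: (@lebesgue_rV_unique _ _ (measure_function_pushforward__canonical__measure_function_Measure (lebesgue_rV n) (@rV_perm_measurable R n s))) => B mB.
transitivity (lebesgue_rV n [set x : 'rV[R]_n | forall i, (B \o (s^-1)%g) i (x ord0 i)]).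
  congr (lebesgue_rV n _); apply/seteqP; split => x /= h i.
    by have := h ((s^-1)%g i); rewrite mxE permKV.
  by have := h (s i); rewrite mxE permK.
rewrite [LHS](@lebesgue_rV_box R n (B \o (s^-1)%g)); last by move=> i; exact: mB.
rewrite [RHS](reindex_inj (@perm_inj _ (s^-1)%g)).
by [].
Qed.

Lemma dotp_ge0 (R : realType) n (x : 'rV[R]_n) : 0 <= dotp x x.
Proof. by apply: sumr_ge0 => i _; rewrite -expr2 sqr_ge0. Qed.

Lemma dotpZ (R : realType) n (c : R) (x : 'rV[R]_n) :
  dotp (c *: x) (c *: x) = c ^+ 2 * dotp x x.
Proof.
rewrite /dotp mulr_sumr; apply: eq_bigr => i _; rewrite !mxE expr2; ring.
Qed.

Lemma dotp_coord_le (R : realType) n (x : 'rV[R]_n) i :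
  x ord0 i ^+ 2 <= dotp x x.
Proof.
rewrite /dotp (bigD1 i)//= -expr2 lerDl.
by apply: sumr_ge0 => j _; rewrite -expr2 sqr_ge0.
Qed.

Lemma dotp_measurable (R : realType) n :
  measurable_fun setT (fun x : 'rV[R]_n => dotp x x).
Proof.
rewrite /dotp (_ : (fun _ => _) = (fun x : 'rV[R]_n => \sum_(i < n) (x ord0 i) ^+ 2)).
  apply: measurable_sum => i; apply: measurable_funX; exact: measurable_coord.
by apply/funext => x; apply: eq_bigr => i _; rewrite expr2.
Qed.

Definition unit_volume (R : realType) (n : nat) : R :=
  fine (lebesgue_rV n [set x : 'rV[R]_n | dotp x x <= 1]).

Lemma measurable_dotp_le (R : realType) n (s : R) :
  measurable [set x : 'rV[R]_n | dotp x x <= s].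
Proof.
rewrite (_ : [set _ | _] = (fun x => dotp x x) @^-1` `]-oo, s]%classic).
  by rewrite -[X in measurable X]setTI; apply: dotp_measurable.
by apply/seteqP; split => x /=; rewrite in_itv.
Qed.

Lemma lebesgue_rV_dotp_le (R : realType) n (s : R) : 0 < s ->
  lebesgue_rV n [set x : 'rV[R]_n | dotp x x <= s] =
  ((Num.sqrt s ^+ n)%:E * lebesgue_rV n [set x : 'rV[R]_n | (dotp x x <= 1)%R])%E.
Proof.
move=> s0; have rs0 : 0 < (Num.sqrt s)^-1 by rewrite invr_gt0 sqrtr_gt0.
have := @lebesgue_rV_scale R n _ _ rs0 (@measurable_dotp_le R n 1).
rewrite exprVn invrK => <-; congr (lebesgue_rV n _).
apply/seteqP; split => x /=; rewrite dotpZ exprVn sqr_sqrtr ?(ltW s0)//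
  mulrC ler_pdivrMr// mul1r//.
Qed.

Lemma lebesgue_rV_unit_fin (R : realType) n :
  lebesgue_rV n [set x : 'rV[R]_n | dotp x x <= 1] \is a fin_num.
Proof.
rewrite ge0_fin_numE//.
apply: (@le_lt_trans _ _ (lebesgue_rV n [set x : 'rV[R]_n | forall i : 'I_n, `[-1, 1]%classic (x ord0 i)])).
  apply: le_measure; rewrite ?inE.
  - exact: measurable_dotp_le.
  - by apply: (@measurable_rV_box R n (fun=> `[-1, 1]%classic)).
  - move=> x /= h i; rewrite in_itv/= -ler_norml -(@ler_pXn2r _ 2)// ?nnegrE//.
    by rewrite expr1n real_normK ?num_real// (le_trans (dotp_coord_le _ _)).
rewrite (@lebesgue_rV_box R n (fun=> `[-1, 1]%classic))//.
rewrite (eq_bigr (fun=> (1 - -1)%:E)) ?prodEFin ?ltry// => i _.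
by rewrite lebesgue_measure_itv/= lte_fin ifT// gtrN.
Qed.

Lemma unit_volume_gt0 (R : realType) n : 0 < unit_volume R n.
Proof.
apply: fine_gt0; rewrite ltey_eq lebesgue_rV_unit_fin andbT.
(* a cube of side 1 / (n + 1) is contained in the unit ball *)
pose d : R := n.+1%:R^-1.
apply: (@lt_le_trans _ _ (lebesgue_rV n [set x : 'rV[R]_n | forall i : 'I_n, `[0, d]%classic (x ord0 i)])).
  rewrite (@lebesgue_rV_box R n (fun=> `[0, d]%classic))//.
  rewrite (eq_bigr (fun=> d%:E)) ?prodEFin ?lte_fin ?prodr_gt0// => i _; first by rewrite invr_gt0.
  by rewrite lebesgue_measure_itv/= lte_fin ifT ?sube0 // invr_gt0.
apply: le_measure; rewrite ?inE.
- by apply: (@measurable_rV_box R n (fun=> `[0, d]%classic)).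
- exact: measurable_dotp_le.
- move=> x /= h; rewrite /dotp.
  apply: (@le_trans _ _ (\sum_(i < n) d)).
    apply: ler_sum => i _; have := h i; rewrite in_itv/= => /andP[h1 h2].
    rewrite (le_trans (ler_pM _ _ h2 h2))// ger_pMr ?invr_gt0// invf_le1//.
    by rewrite ler1n.
  by rewrite sumr_const card_ord -[_ *+ _]mulr_natr ler_pdivrMl// mulr1 ler_nat.
Qed.

Lemma unit_volumeE (R : realType) n :
  lebesgue_rV n [set x : 'rV[R]_n | dotp x x <= 1] = (unit_volume R n)%:E.
Proof. by rewrite fineK// lebesgue_rV_unit_fin. Qed.

(** Homogeneity gives the formula for [0 < a]; the
    case [a = 0] follows by letting the radius tend to 0. *)
Lemma lebesgue_rV_ball (R : realType) n (a : R) : (0 < n)%N -> 0 <= a ->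
  lebesgue_rV n [set x : 'rV[R]_n | dotp x x <= a] =
  (unit_volume R n * a `^ (n%:R / 2))%:E.
Proof.
move=> n0.
have pos b : 0 < b -> lebesgue_rV n [set x : 'rV[R]_n | dotp x x <= b] =
    (unit_volume R n * b `^ (n%:R / 2))%:E.
  move=> b0; rewrite lebesgue_rV_dotp_le// unit_volumeE -EFinM mulrC.
  by rewrite -powR12_sqrt ?(ltW b0)// -powR_mulrn ?powR_ge0// -powRrM [_^-1 * _]mulrC.
rewrite le_eqVlt => /predU1P[<-|]; last exact: pos.
rewrite powR0 ?mulr0; last by rewrite mulf_neq0// pnatr_eq0 -lt0n.
apply/eqP; rewrite eq_le measure_ge0 andbT; apply/lee_addgt0Pr => e e0.
rewrite add0e.
have ev0 : 0 < (e / unit_volume R n) `^ (n%:R / 2)^-1 by rewrite powR_gt0// divr_gt0// unit_volume_gt0.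
apply: (@le_trans _ _ (lebesgue_rV n [set x : 'rV[R]_n | dotp x x <= (e / unit_volume R n) `^ (n%:R / 2)^-1])).
  apply: le_measure; rewrite ?inE; try exact: measurable_dotp_le.
  by move=> x /= /le_trans; apply; exact: ltW.
rewrite pos// -powRrM mulVf ?powRr1 ?divr_ge0 ?(ltW e0) ?(ltW (unit_volume_gt0 _ _))//.
  by rewrite mulrC divfK// gt_eqF// unit_volume_gt0.
by rewrite mulf_neq0// pnatr_eq0 -lt0n.
Qed.

Lemma lebesgue_rV_annulus (R : realType) n (s t : R) : (0 < n)%N -> 0 <= s <= t ->
  lebesgue_rV n [set x : 'rV[R]_n | s < dotp x x <= t] =
  (unit_volume R n * (t `^ (n%:R / 2) - s `^ (n%:R / 2)))%:E.
Proof.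
move=> n0 /andP[s0 st].
have ball (a : R) : 0 <= a -> lebesgue_rV n [set x : 'rV[R]_n | dotp x x <= a] =
    (unit_volume R n * a `^ (n%:R / 2))%:E by exact: lebesgue_rV_ball.
rewrite (_ : [set _ | _] = [set x | dotp x x <= t] `\` [set x | dotp x x <= s]); last first.
  apply/seteqP; split => x /=; first by move=> /andP[h ->]; split => //; apply/negP; rewrite -ltNge.
  by move=> [-> /negP]; rewrite -ltNge => ->.
rewrite measureD; try exact: measurable_dotp_le; last first.
  by rewrite [X in (X < _)%E](ball t (le_trans s0 st)) ltry.
rewrite (_ : _ `&` _ = [set x | dotp x x <= s]); last first.
  by apply/seteqP; split => x /=; [move=> []//|move=> h; split => //; exact: le_trans st].
rewrite [X in (X - _)%E](ball t (le_trans s0 st)) [X in (_ - X)%E](ball s s0).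
by rewrite -EFinB mulrBr.
Qed.

(** * Integration of radial functions *)

(** For [a = 0] the convention [0 `^ 0 = 1]
    makes the function constant. *)
Lemma powabs_continuous (R : realType) (a : R) : 0 <= a ->
  continuous (fun x : R => `|x| `^ a).
Proof.
rewrite le_eqVlt => /predU1P[<- x|a0 x].
  rewrite (_ : (fun _ => _) = cst 1); first exact: cst_continuous.
  by apply/funext => y; rewrite powRr0.
have [->|x0] := eqVneq x 0.
  apply/cvgrPdist_lt => e e0.
  have ea : 0 < e `^ a^-1 by rewrite powR_gt0.
  near=> y; rewrite normr0 powR0 ?gt_eqF// sub0r normrN ger0_norm ?powR_ge0//.
  have ye : `|y| < e `^ a^-1.
    by near: y; exists (e `^ a^-1) => //= z /=; rewrite sub0r normrN.
  rewrite -[ltRHS](powRr1 (ltW e0)) -[in ltRHS](mulVf (lt0r_neq0 a0)) powRrM.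
  by rewrite gt0_ltr_powR// nnegrE// ltW.
have := is_derive1_powR a (_ : 0 < `|x|); rewrite normr_gt0 => /(_ x0) d.
apply: (@continuous_comp _ _ _ (fun y : R => `|y|) (@powR R ^~ a)).
  exact: norm_continuous.
apply: differentiable_continuous; apply/derivable1_diffP; exact: ex_derive.
Unshelve. all: by end_near. Qed.

Lemma is_derive_powabs_pos (R : realType) (a x : R) : 0 < x ->
  is_derive x 1 (fun x : R => `|x| `^ a) (a * x `^ (a - 1)).
Proof.
move=> x0; have d := is_derive1_powR a x0.
apply: near_eq_is_derive d.
near=> y; rewrite gtr0_norm//; near: y; exact: lt_nbhsr.
Unshelve. all: by end_near. Qed.

(** The hypothesis [1 < a] gives differentiability at
    0, where the difference quotient has absolute value [|h| `^ (a - 1)]. *)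
Lemma is_derive_powabs (R : realType) (a x : R) : 1 < a ->
  is_derive x 1 (fun x : R => `|x| `^ a) (a * (`|x| `^ (a - 2) * x)).
Proof.
move=> a1.
have [x0|x0|->] := ltgtP x 0.
- have Nx0 : 0 < - x by rewrite oppr_gt0.
  have d := is_derive_powabs_pos a Nx0.
  have := @is_derive1_comp R (fun x : R => `|x| `^ a) (-%R) x _ _ d (is_deriveN (is_derive_id x 1)).
  rewrite (_ : _ \o _ = (fun x : R => `|x| `^ a)); last first.
    by apply/funext => y /=; rewrite normrN.
  rewrite (_ : a * (- x) `^ (a - 1) * - 1 = a * (`|x| `^ (a - 2) * x))//.
  rewrite (ltr0_norm x0) mulrN1 -mulrN; congr (a * _).
  rewrite -[X in _ = _ * X](opprK x) mulrN; congr (- _).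
  rewrite -[X in _ = _ * X](powRr1 (ltW Nx0)) -powRD; last by rewrite (gt_eqF Nx0) implybT.
  by rewrite (_ : a - 2 + 1 = a - 1) //; ring.
- have d := is_derive_powabs_pos a x0.
  rewrite (gtr0_norm x0) -[X in _ * (_ * X)](powRr1 (ltW x0)) -powRD; last by rewrite (gt_eqF x0) implybT.
  by rewrite (_ : a - 2 + 1 = a - 1) //; ring.
- rewrite mulr0 mulr0.
  have a1' : 0 < a - 1 by rewrite subr_gt0.
  have cv : h^-1 *: (`|h *: (1:R) + (0 : R)| `^ a - `|0 : R| `^ a) @[h --> (0:R)^'] --> (0:R).
    apply/cvgrPdist_lt => e e0.
    have := @powabs_continuous R (a - 1) (ltW a1') 0.
    move=> /cvgrPdist_lt/(_ e e0); rewrite normr0 powR0 ?gt_eqF//.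
    move=> H; near=> h.
    rewrite powR0 ?gt_eqF ?(lt_trans _ a1)// subr0 addr0 sub0r normrN.
    have h0 : h != 0 by near: h; exact: nbhs_dnbhs_neq.
    rewrite /GRing.scale/= mulr1 normrM normfV (ger0_norm (powR_ge0 _ _)).
    rewrite -[X in X^-1]powRr1// -powRN -powRD; last by rewrite normr_eq0 h0 implybT.
    rewrite addrC.
    have : `|0 - `|h| `^ (a - 1)| < e by near: h; exact: cvg_within H.
    by rewrite sub0r normrN (ger0_norm (powR_ge0 _ _)).
  apply: DeriveDef; first by apply/cvg_ex; exists 0.
  exact: cvg_lim cv.
Unshelve. all: by end_near. Qed.

Lemma ge0_integral_density (R : realType)
    (nu : {measure set (measurableTypeR R) -> \bar R})
    (h : measurableTypeR R -> R) (D : set (measurableTypeR R)) : measurable D ->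
  measurable_fun D h -> (forall x, D x -> 0 <= h x) ->
  (forall A, measurable A -> nu A = (\int[lebesgue_measure]_(x in A `&` D) (h x)%:E)%E) ->
  forall f : measurableTypeR R -> \bar R, measurable_fun setT f -> (forall x, 0 <= f x)%E ->
  (\int[nu]_x f x = \int[lebesgue_measure]_(x in D) (f x * (h x)%:E))%E.
Proof.
move=> mD mh h0 nuE f mf f0.
pose f_ := nnsfun_approx measurableT mf.
have fcvg x : ((f_ n x)%:E @[n --> \oo] --> f x)%E.
  by apply: cvg_nnsfun_approx => // *; exact: f0.
transitivity (limn (fun n => \int[nu]_x (f_ n x)%:E)%E).
  rewrite -monotone_convergence//.
  - by apply: eq_integral => y _; apply/esym/cvg_lim => //; exact: fcvg.
  - by move=> n; exact/measurable_EFinP/measurable_funP.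
  - by move=> n y _; rewrite lee_fin.
  - by move=> y _ m n mn; rewrite lee_fin; exact/lefP/nd_nnsfun_approx.
transitivity (limn (fun n => \int[lebesgue_measure]_(x in D) ((f_ n x)%:E * (h x)%:E))%E).
  congr (limn _); apply/funext => n.
  have mk k : measurable (f_ n @^-1` [set k]) by exact: measurable_sfunP.
  transitivity (\sum_(k \in range (f_ n)) (k%:E * nu (f_ n @^-1` [set k])))%E.
    under eq_integral do rewrite fimfunE -fsumEFin//.
    rewrite ge0_integral_fsum//; last 2 first.
    - by move=> y; exact/measurable_EFinP/measurable_funM.
    - by move=> y x _; rewrite nnfun_muleindic_ge0.
    apply: eq_fsbigr => r _; rewrite integralZl_indic_nnsfun// integral_indic//= setIT//.
  transitivity (\int[lebesgue_measure]_(x in D) \sum_(k \in range (f_ n))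
      ((k * \1_(f_ n @^-1` [set k]) x)%:E * (h x)%:E))%E; last first.
    apply: eq_integral => x _; rewrite [in RHS]fimfunE -fsumEFin// ge0_mule_fsuml//.
    by move=> k; rewrite nnfun_muleindic_ge0.
  rewrite ge0_integral_fsum//; last 2 first.
  - move=> k; apply: emeasurable_funM; last exact/measurable_EFinP.
    apply/measurable_EFinP; apply: measurable_funTS; apply: measurable_funM => //.
  - move=> k x Dx; rewrite mule_ge0 ?nnfun_muleindic_ge0// lee_fin h0//.
  apply: eq_fsbigr => r rr.
  rewrite (eq_integral (fun x => r%:E * ((\1_(f_ n @^-1` [set r]) x)%:E * (h x)%:E))%E); last first.
    by move=> x _; rewrite EFinM muleA.
  have r0 : 0 <= r by move: rr; rewrite inE => -[y _ <-].
  rewrite ge0_integralZl//; last 2 first.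
  - apply: emeasurable_funM; last exact/measurable_EFinP.
    by apply/measurable_EFinP; apply: measurable_funTS.
  - by move=> x Dx; rewrite mule_ge0// lee_fin// h0.
  congr (_ * _)%E; rewrite nuE// setIC integral_mkcondr.
  apply: eq_integral => x _; rewrite patchE indicE /=.
  case: ifPn => xr; first by rewrite mul1e.
  by rewrite mul0e.
rewrite -monotone_convergence//.
- apply: eq_integral => y /[!inE] Dy; apply/cvg_lim => //.
  by apply: cvgeZr => //; exact: fcvg.
- move=> n; apply: emeasurable_funM; last exact/measurable_EFinP.
  by apply/measurable_EFinP; apply: measurable_funTS; exact/measurable_funP.
- by move=> n y Dy; rewrite -EFinM lee_fin mulr_ge0// h0.
- move=> y Dy m n mn; rewrite -!EFinM lee_fin ler_wpM2r ?h0//.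
  exact/lefP/nd_nnsfun_approx.
Qed.

Section density_measure.
Context (R : realType) (h : measurableTypeR R -> R) (D : set (measurableTypeR R)) (mD : measurable D)
  (mh : measurable_fun D h) (h0 : forall x, D x -> 0 <= h x).

Definition density_measure (A : set (measurableTypeR R)) :=
  (\int[lebesgue_measure]_(x in A `&` D) (h x)%:E)%E.

Let d0 : density_measure set0 = 0%E.
Proof. by rewrite /density_measure set0I integral_set0. Qed.

Let d_ge0 A : (0 <= density_measure A)%E.
Proof. by apply: integral_ge0 => x [_ Dx]; rewrite lee_fin h0. Qed.

Let d_sigma_additive : semi_sigma_additive density_measure.
Proof.
move=> F mF tF mUF; rewrite /density_measure setI_bigcupl ge0_integral_bigcup//=.
- apply: is_cvg_ereal_nneg_natsum_cond => n _ _.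
  by apply: integral_ge0 => x [_ Dx]; rewrite lee_fin h0.
- by move=> k; exact: measurableI.
- apply/measurable_EFinP; apply: measurable_funS mh => //.
  by apply: bigcup_sub => k _ x [].
- by move=> x [k _ [_ Dx]]; rewrite lee_fin h0.
- by apply/trivIsetP => i j _ _ ij; rewrite setIACA setIid; move/trivIsetP: tF => ->//; rewrite set0I.
Qed.

HB.instance Definition _ := isMeasure.Build _ _ _ density_measure
  d0 d_ge0 d_sigma_additive.

Definition density_measure_of : {measure set (measurableTypeR R) -> \bar R} :=
  density_measure.

End density_measure.

(** By the fundamental theorem of calculus the density
    gives the same mass to intervals, and measures are determined by intervals.
    Used twice: for the law of [dotp x x], and to see that [s |-> sqrt (s - a)]
    pulls null sets back to null sets. *)
Lemma power_density (R : realType) (nu : {measure set (measurableTypeR R) -> \bar R}) (c k : R) :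
  0 <= c -> 1 <= k -> nu `]-oo, 0%R]%classic = 0%E ->
  (forall s t, 0 <= s <= t -> nu `]s, t]%classic = (c * (t `^ k - s `^ k))%:E) ->
  forall A, measurable A -> nu A =
    (\int[lebesgue_measure]_(x in A `&` `]0%R, +oo[) (c * k * x `^ (k - 1))%:E)%E.
Proof.
move=> c0 k1 nu0 nuE.
pose h := fun x : R => c * k * x `^ (k - 1).
have mh : measurable_fun (`]0%R, +oo[%classic : set (measurableTypeR R)) h.
  by apply: measurable_funTS; apply: measurable_funM => //; exact: measurable_powR.
have h0 x : `]0%R, +oo[%classic x -> 0 <= h x.
  by move=> _; rewrite mulr_ge0 ?powR_ge0// mulr_ge0// (le_trans _ k1).
pose m := density_measure h `]0%R, +oo[%classic.
have mE s t : 0 <= s <= t -> density_measure h `]0%R, +oo[%classic `]s, t]%classic = (c * (t `^ k - s `^ k))%:E.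
  move=> /andP[s0]; rewrite le_eqVlt => /predU1P[<-|st].
    by rewrite /density_measure set_itvoc0 set0I integral_set0 subrr mulr0.
  rewrite /density_measure (_ : _ `&` _ = `]s, t]%classic); last first.
    apply/seteqP; split => x /=; rewrite !in_itv/=; first by case.
    by move=> /andP[sx xt]; rewrite sx xt andbT (le_lt_trans s0 sx).
  rewrite integral_itv_obnd_cbnd; last first.
    by apply: measurable_funTS; apply/measurable_EFinP; apply: measurable_funM => //; exact: measurable_powR.
  rewrite (eq_integral (fun x : measurableTypeR R => (c * k * `|x : R| `^ (k - 1))%:E)); last first.
    move=> x; rewrite inE/= in_itv/= => /andP[sx _].
    by rewrite ger0_norm// (le_trans s0).
  have k0 : 0 < k by rewrite (lt_le_trans _ k1).
  rewrite (@continuous_FTC2 _ _ (fun x => c * `|x| `^ k))//.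
  - by rewrite -EFinB mulrBr !ger0_norm// (le_trans s0 (ltW st)).
  - apply: continuous_subspaceT => x; apply: cvgMr.
    by apply: powabs_continuous; rewrite subr_ge0.
  - split.
    + move=> x; rewrite in_itv/= => /andP[sx _].
      have /(is_derive_powabs_pos k) h1 : 0 < x by exact: le_lt_trans sx.
      exact: ex_derive.
    + by apply: cvg_at_right_filter; apply: cvgMr; apply: powabs_continuous; exact: ltW.
    + by apply: cvg_at_left_filter; apply: cvgMr; apply: powabs_continuous; exact: ltW.
  - move=> x; rewrite in_itv/= => /andP[sx _].
    have x0 : 0 < x by exact: le_lt_trans sx.
    have h1 := is_derive_powabs_pos k x0.
    rewrite derive1E derive_val (gtr0_norm x0).
    by rewrite /GRing.scale/= mulrA.
move=> A mA.
have nuD a b : nu `]a, b]%classic = density_measure h `]0%R, +oo[%classic `]a, b]%classic.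
  have [ab|ba] := ltP a b; last by rewrite set_itv_ge ?measure0 /density_measure ?set0I ?integral_set0// bnd_simp -leNgt.
  have [b0|b0] := leP b 0.
    rewrite /density_measure (_ : _ `&` _ = set0) ?integral_set0; last first.
      by apply/seteqP; split => x //= []; rewrite !in_itv/= => /andP[_ xb]; rewrite andbT ltNge (le_trans xb).
    apply/eqP; rewrite eq_le measure_ge0 andbT -nu0; apply: le_measure; rewrite ?inE//.
    by move=> x/=; rewrite !in_itv/= => /andP[_ xb]; exact: le_trans b0.
  have [a0|a0] := leP 0 a; first by rewrite nuE ?mE ?a0 ?ltW.
  have -> : density_measure h `]0%R, +oo[%classic `]a, b]%classic =
     density_measure h `]0%R, +oo[%classic `]0, b]%classic.
    rewrite /density_measure; congr (integral _ _ _).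
    apply/seteqP; split => x /=; rewrite !in_itv/= => -[]; rewrite ?andbT.
      by move=> /andP[ax ->] ->.
    by move=> /andP[x0 ->] _; rewrite (lt_trans a0 x0).
  rewrite (_ : `]a, b]%classic = `]a, 0]%classic `|` `]0, b]%classic); last first.
    by rewrite -itv_bndbnd_setU// bnd_simp// ltW.
  have nua : nu `]a, 0%R]%classic = 0%E.
    apply/eqP; rewrite eq_le measure_ge0 andbT -nu0; apply: le_measure; rewrite ?inE//.
    by move=> x/=; rewrite !in_itv/= => /andP[_ xb].
  rewrite measureU//; last first.
    apply/seteqP; split => x //= -[]; rewrite !in_itv/= => /andP[_ x0] /andP[+ _].
    by rewrite ltNge x0.
  have b00 : 0 <= (0 : R) <= b by rewrite lexx ltW.
  transitivity (0 + nu `]0%R, b]%classic)%E; first by congr (_ + _)%E.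
  by rewrite add0e nuE// mE.
pose md := density_measure_of (measurable_itv _ : measurable (`]0%R, +oo[%classic : set (measurableTypeR R))) mh h0.
change (nu A = md A); move: A mA.
pose g (j : nat) : set (measurableTypeR R) := `](- j%:R)%R, j%:R]%classic.
apply: (@measure_unique _ _ _ (@ocitv R : set (set (measurableTypeR R))) g) => //.
- exact: ocitvI.
- by move=> j; exact: is_ocitv.
- apply/seteqP; split => // x _; exists (Num.trunc `|x : R|).+1 => //=.
  rewrite /g/= in_itv/=; have := truncnS_gt `|x : R|.
  by rewrite ltr_norml => /andP[-> /ltW].
- by move=> _ [[a b] _ <-]/=; exact: nuD.
- move=> j; rewrite /g (_ : nu _ = nu (`](- j%:R)%R, 0%R]%classic `|` `]0%R, j%:R]%classic)).
    apply: (@le_lt_trans _ _ (0 + nu `]0%R, j%:R]%classic)); last first.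
      by rewrite add0e nuE ?lexx ?ler0n ?ltry.
    rewrite (le_trans (measureU2 _ _ _))// leeD2r// -nu0; apply: le_measure; rewrite ?inE//.
    by move=> x/=; rewrite !in_itv/= => /andP[_ xb].
  by congr (nu _); rewrite -itv_bndbnd_setU// bnd_simp// oppr_le0 ler0n.
Qed.

Lemma dotp_measurableR (R : realType) n :
  measurable_fun setT (fun x : 'rV[R]_n => dotp x x : measurableTypeR R).
Proof. exact: dotp_measurable. Qed.

(** The law of the squared radius, which replaces the
    surface measure of spheres in polar coordinates. *)
Definition sphere_measure (R : realType) (n : nat) : {measure set (measurableTypeR R) -> \bar R} :=
  measure_function_pushforward__canonical__measure_function_Measure (lebesgue_rV n) (@dotp_measurableR R n).

Lemma sphere_measureE (R : realType) (n : nat) (A : set (measurableTypeR R)) :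
  (1 < n)%N -> measurable A ->
  sphere_measure R n A = (\int[lebesgue_measure]_(x in A `&` `]0%R, +oo[)
    (unit_volume R n * (n%:R / 2) * x `^ (n%:R / 2 - 1))%:E)%E.
Proof.
move=> n1 mA; have n0 : (0 < n)%N by exact: ltnW.
apply: power_density => //.
- exact/ltW/unit_volume_gt0.
- by rewrite ler_pdivlMr// mul1r ler_nat.
- transitivity (lebesgue_rV n [set x : 'rV[R]_n | dotp x x <= 0]).
    by congr (lebesgue_rV n _); apply/seteqP; split => x /=; rewrite in_itv.
  by rewrite lebesgue_rV_ball// powR0 ?mulr0// mulf_neq0// pnatr_eq0 -lt0n.
- by move=> s t st; rewrite -lebesgue_rV_annulus.
Qed.

(** Polar coordinates for a function of the squared
    radius. The hypothesis [1 < n] makes the exponent [n / 2] at least 1, so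
    that [s `^ (n / 2)] has a density that is bounded near 0. *)
Lemma ge0_integral_radial (R : realType) (n : nat) (f : measurableTypeR R -> \bar R) :
  (1 < n)%N -> measurable_fun setT f -> (forall x, 0 <= f x)%E ->
  (\int[lebesgue_rV n]_x f (dotp x x) = \int[lebesgue_measure]_(x in `]0%R, +oo[)
    (f x * (unit_volume R n * (n%:R / 2) * x `^ (n%:R / 2 - 1))%:E))%E.
Proof.
move=> n1 mf f0.
rewrite -(@ge0_integral_density R (sphere_measure R n) _ `]0%R, +oo[%classic)//.
- rewrite [RHS]ge0_integral_pushforward//; exact: dotp_measurableR.
- by apply: measurable_funTS; apply: measurable_funM => //; exact: measurable_powR.
- move=> x _; rewrite mulr_ge0 ?powR_ge0// mulr_ge0//.
  exact/ltW/unit_volume_gt0.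
- by move=> A mA; rewrite sphere_measureE.
Qed.

Lemma sphere_measure_null (R : realType) (n : nat) (A : set (measurableTypeR R)) :
  (1 < n)%N -> measurable A -> lebesgue_measure A = 0%E ->
  lebesgue_rV n [set x | A (dotp x x)] = 0%E.
Proof.
move=> n1 mA A0.
rewrite -[LHS]/(sphere_measure R n A) sphere_measureE//.
apply: null_set_integral => //.
- exact: measurableI.
- by apply/measurable_EFinP; apply: measurable_funTS; apply: measurable_funM => //; exact: measurable_powR.
- apply/eqP; rewrite eq_le measure_ge0 andbT -A0; apply: le_measure; rewrite ?inE//.
  exact: measurableI.
Qed.

(** An almost everywhere statement on the parameter [t]
    of a line at squared distance [a] from the origin becomes one on the
    squared radius [s = t ^+ 2 + a]. *)
Lemma sqrt_subr_null (R : realType) (a : R) (T : set (measurableTypeR R)) :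
  measurable T -> lebesgue_measure T = 0%E ->
  lebesgue_measure [set s : measurableTypeR R | a < (s : R) /\ T (Num.sqrt ((s : R) - a))] = 0%E.
Proof.
move=> mT T0.
have mr : measurable_fun [set: measurableTypeR R] (fun s : measurableTypeR R => Num.sqrt ((s : R) - a) : measurableTypeR R).
  have h : measurable_fun [set: measurableTypeR R] (fun s : measurableTypeR R => Num.sqrt (s : R) : measurableTypeR R).
    by apply: continuous_measurable_fun; exact: sqrt_continuous.
  apply: (measurableT_comp h); exact: measurable_funB.
have ma : measurable (`]a, +oo[%classic : set (measurableTypeR R)) by [].
pose nu : {measure set (measurableTypeR R) -> \bar R} := measure_function_pushforward__canonical__measure_function_Measure
  (measure_function_mrestr__canonical__measure_function_Measure (@lebesgue_measure R) ma) mr.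
have nuE (A : set (measurableTypeR R)) : nu A = lebesgue_measure [set s : measurableTypeR R | a < (s : R) /\ A (Num.sqrt ((s : R) - a))].
  rewrite /nu/= /pushforward /mrestr; congr (lebesgue_measure _).
  by apply/seteqP; split => s /=; rewrite in_itv/= andbT => -[].
rewrite -nuE (@power_density R nu 1 2)//.
- apply: null_set_integral => //.
  + exact: measurableI.
  + by apply/measurable_EFinP; apply: measurable_funTS; apply: measurable_funM => //; exact: measurable_powR.
  + apply/eqP; rewrite eq_le measure_ge0 andbT -T0; apply: le_measure; rewrite ?inE//.
    exact: measurableI.
- by rewrite ler1n.
- rewrite nuE (_ : [set _ | _] = set0) ?measure0//; apply/seteqP; split => s //= [as_].
  by rewrite in_itv/= leNgt sqrtr_gt0 subr_gt0 as_.
- move=> s t /andP[s0 st]; rewrite nuE.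
  have t0 : 0 <= t by exact: le_trans st.
  rewrite (_ : [set _ | _] = `]s ^+ 2 + a, t ^+ 2 + a]%classic); last first.
    apply/seteqP; split => y /=; rewrite !in_itv/=.
      move=> [ay /andP[h1 h2]].
      rewrite -ltrBrDr -lerBlDr -[X in _ < X]sqr_sqrtr ?subr_ge0 ?(ltW ay)//.
      rewrite -[X in X <= _]sqr_sqrtr ?subr_ge0 ?(ltW ay)//.
      by rewrite ltr_pXn2r ?nnegrE ?sqrtr_ge0// h1 ler_pXn2r ?nnegrE ?sqrtr_ge0.
    move=> /andP[h1 h2].
    have ay : a < y by rewrite (le_lt_trans _ h1)// lerDr sqr_ge0.
    split => //; move: h1 h2; rewrite -ltrBrDr -lerBlDr -[X in _ < X -> _]sqr_sqrtr ?subr_ge0 ?(ltW ay)//.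
    rewrite -[X in _ -> X <= _ -> _]sqr_sqrtr ?subr_ge0 ?(ltW ay)//.
    by rewrite ltr_pXn2r ?nnegrE ?sqrtr_ge0// => ->; rewrite ler_pXn2r ?nnegrE ?sqrtr_ge0.
  rewrite lebesgue_measure_itv/= lte_fin ltrD2r mul1r !powR_mulrn//.
  case: ltP => [h|]; first by rewrite -EFinB; congr EFin; ring.
  rewrite ler_pXn2r ?nnegrE// => ts.
  by rewrite (_ : s = t) ?subrr//; apply/eqP; rewrite eq_le st ts.
Qed.

(** * Slices along the first coordinate *)

(** From convergence to 0 of the integrals one only
    keeps, at almost every point, arbitrarily small values along the sequence;
    this avoids the extraction of an almost everywhere convergent
    subsequence. *)
Lemma ae_eventually_small d (T : measurableType d) (R : realType)
    (mu : {measure set T -> \bar R}) (S : (T -> \bar R)^nat) :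
  (forall k, measurable_fun setT (S k)) -> (forall k x, (0 <= S k x)%E) ->
  (\int[mu]_x S k x @[k --> \oo] --> 0)%E ->
  {ae mu, forall x, forall e : R, 0 < e -> exists k, (S k x < e%:E)%E}.
Proof.
move=> mS S0 cS.
have small (e : R) : 0 < e -> {ae mu, forall x, exists k, (S k x < e%:E)%E}.
  move=> e0; exists (\bigcap_k [set x | (e%:E <= S k x)%E]); split.
  - apply: bigcap_measurable => // k _; rewrite -[X in measurable X]setTI.
    exact: emeasurable_fun_c_infty.
  - set E := \bigcap_k _.
    have mE : measurable E.
      apply: bigcap_measurable => // k _; rewrite -[X in measurable X]setTI.
      exact: emeasurable_fun_c_infty.
    (* Markov inequality *)
    have h k : (e%:E * mu E <= \int[mu]_x S k x)%E.
      rewrite -integral_cst//; apply: (@le_trans _ _ (\int[mu]_(x in E) S k x)%E).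
        apply: ge0_le_integral => //.
        - by move=> x _; rewrite lee_fin ltW.
        - exact: measurable_funTS.
        - by move=> x; apply.
      exact: ge0_subset_integral.
    have : (e%:E * mu E <= 0)%E.
      by rewrite -(cvg_lim _ cS)//; apply: lime_ge => //; [apply/cvg_ex; exists 0%E|near=> k].
    rewrite pmule_rle0 ?lte_fin// => mE0.
    by apply/eqP; rewrite eq_le mE0 measure_ge0.
  - by move=> x /= /forallNP h k _; have /negP := h k; rewrite -leNgt.
have H : {ae mu, forall x, forall m, exists k, (S k x < (m.+1%:R^-1)%:E)%E}.
  by apply: ae_foralln => m; apply: small; rewrite invr_gt0.
apply: filterS H => x hx e e0.
have [m] := near_infty_natSinv_lt (PosNum e0) => _ /(_ m (leqnn m)) /= me.
by have [k hk] := hx m; exists k; rewrite (lt_trans hk)// lte_fin.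
Unshelve. all: by end_near. Qed.

Lemma ge0_integral_rVS (R : realType) (n : nat) (f : 'rV[R]_n.+1 -> \bar R) :
  measurable_fun setT f -> (forall x, 0 <= f x)%E ->
  (\int[lebesgue_rV n.+1]_x f x =
   \int[lebesgue_rV n]_y \int[lebesgue_measure]_t f (cons_rV (t, y)))%E.
Proof.
move=> mf f0; rewrite [LHS]ge0_integral_pushforward//; last exact: measurable_cons_rV.
rewrite preimage_setT (@fubini_tonelli2 _ _ _ _ _ lebesgue_measure (lebesgue_rV n))//.
  apply: measurableT_comp => //; exact: measurable_cons_rV.
by move=> x; exact: f0.
Qed.

Lemma measurable_integral_slice (R : realType) (n : nat) (f : 'rV[R]_n.+1 -> \bar R) :
  measurable_fun setT f -> (forall x, 0 <= f x)%E ->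
  measurable_fun setT (fun y => \int[lebesgue_measure]_t f (cons_rV (t, y)))%E.
Proof.
move=> mf f0.
apply: (@measurable_fun_fubini_tonelli_G _ _ _ _ _ lebesgue_measure (fun p => f (cons_rV p))).
  apply: measurableT_comp => //; exact: measurable_cons_rV.
by move=> x; exact: f0.
Qed.

Lemma measurable_slice (R : realType) (n : nat) d (T : measurableType d) (f : 'rV[R]_n.+1 -> T) y :
  measurable_fun setT f ->
  measurable_fun setT (fun t : measurableTypeR R => f (cons_rV (t, y))).
Proof.
move=> mf; apply: measurableT_comp => //.
apply: (measurableT_comp (@measurable_cons_rV R n)).
exact: pair2_measurable.
Qed.

Lemma ge0_integral_eq0_ae d (T : measurableType d) (R : realType)
    (mu : {measure set T -> \bar R}) (f : T -> \bar R) :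
  measurable_fun setT f -> (forall x, (0 <= f x)%E) ->
  (\int[mu]_x f x = 0)%E <-> {ae mu, forall x, f x = 0%E}.
Proof.
move=> mf f0.
have -> : (\int[mu]_x f x = \int[mu]_x `|f x|)%E.
  by apply: eq_integral => x _; rewrite gee0_abs.
split.
  by move=> /(ae_eq_integral_abs _ measurableT mf); apply: filterS => x; exact.
by move=> h; apply/(ae_eq_integral_abs _ measurableT mf); apply: filterS h.
Qed.

Lemma measurable_cons_preimage (R : realType) (n : nat) (N : set 'rV[R]_n.+1) y : measurable N ->
  measurable [set t : measurableTypeR R | N (cons_rV (t, y))].
Proof.
move=> mN; rewrite -[X in measurable X]setTI.
by apply: (measurable_slice y (@measurable_id _ _ setT)).
Qed.

Lemma ae_slice (R : realType) (n : nat) (P : 'rV[R]_n.+1 -> Prop) :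
  {ae lebesgue_rV n.+1, forall x, P x} ->
  {ae lebesgue_rV n, forall y, {ae lebesgue_measure, forall t : measurableTypeR R, P (cons_rV (t, y))}}.
Proof.
move=> [N [mN N0 PN]].
have mI : measurable_fun setT (fun x => (\1_N x : R)%:E) by exact/measurable_EFinP.
have I0 x : (0 <= (\1_N x : R)%:E)%E by rewrite lee_fin.
have : (\int[lebesgue_rV n.+1]_x (\1_N x)%:E = 0)%E by rewrite integral_indic// setIT.
rewrite ge0_integral_rVS//.
move/ge0_integral_eq0_ae => h.
have {}h := h (measurable_integral_slice mI I0) (fun y => integral_ge0 _ (fun t _ => I0 _)).
apply: filterS h => y hy.
exists [set t | N (cons_rV (t, y))]; split.
- exact: measurable_cons_preimage.
- move: hy; rewrite integral_indic ?setIT//; exact: measurable_cons_preimage.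
- by move=> t /= Pt; apply: PN.
Qed.

(** A converse of [ae_slice]. The measurability of [P]
    cannot be dropped: null slices do not make an arbitrary set null. *)
Lemma ae_of_slice (R : realType) (n : nat) (P : 'rV[R]_n.+1 -> Prop) :
  measurable [set x | P x] ->
  {ae lebesgue_rV n, forall y, {ae lebesgue_measure, forall t : measurableTypeR R, P (cons_rV (t, y))}} ->
  {ae lebesgue_rV n.+1, forall x, P x}.
Proof.
move=> mP h; set N := ~` [set x | P x].
have mN : measurable N by exact: measurableC.
exists N; split => //.
have mI : measurable_fun setT (fun x => (\1_N x : R)%:E) by exact/measurable_EFinP.
have I0 x : (0 <= (\1_N x : R)%:E)%E by rewrite lee_fin.
have <- : (\int[lebesgue_rV n.+1]_x (\1_N x)%:E = lebesgue_rV n.+1 N)%E by rewrite integral_indic// setIT.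
rewrite ge0_integral_rVS//.
apply/ge0_integral_eq0_ae.
- exact: (measurable_integral_slice mI I0).
- by move=> y; apply: integral_ge0 => t _; exact: I0.
apply: filterS h => y hy.
have mNy := measurable_cons_preimage y mN.
rewrite integral_indic ?setIT//.
exact: measure_negligible hy.
Qed.

(** Absolute continuity of the integral,
    applied to the small interval between the two end points. *)
Lemma continuous_indefinite_integral (R : realType) (f : R -> R) :
  (@lebesgue_measure R).-integrable setT (EFin \o f) ->
  continuous (fun t => \int[lebesgue_measure]_(s in `]-oo, t]) f s).
Proof.
move=> intf t.
have incr a b : a <= b ->
   `|\int[lebesgue_measure]_(s in `]-oo, b]) f s - \int[lebesgue_measure]_(s in `]-oo, a]) f s|
    <= \int[lebesgue_measure]_(s in `]a, b]) `|f s|.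
  move=> ab; rewrite Rintegral_itvB//; last first.
    by apply: integrableS intf.
  apply: le_normr_Rintegral => //.
  by apply: integrableS intf.
apply/cvgrPdist_lt => e e0.
have [d [d0 dE]] := integral_normr_continuous intf e0.
have small a b : a <= b -> `|a - b| < d -> (lebesgue_measure `]a, b]%classic < d%:E)%E.
  move=> ab abd; rewrite lebesgue_measure_itv/= lte_fin.
  case: ifPn => _; last by rewrite lte_fin.
  by rewrite -EFinB lte_fin -(@ger0_norm _ (b - a)) ?subr_ge0// distrC.
near=> s.
have ds : `|t - s| < d by near: s; apply: cvgr_dist_lt.
have [ts|st] := leP t s.
  rewrite distrC; apply: le_lt_trans (incr _ _ ts) _; apply: dE => //.
  exact: small.
apply: le_lt_trans (incr _ _ (ltW st)) _; apply: dE => //.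
by apply: small; [exact: ltW|rewrite distrC].
Unshelve. all: by end_near. Qed.

(** * Absolute continuity on lines *)

(** What a test function and its partial derivative
    become on a line parallel to an axis. *)
Definition compact_primitive (R : realType) (F f : R -> R) :=
  [/\ forall t : R, is_derive t 1 F (f t), continuous f &
      exists M, forall t : R, M <= `|t| -> F t = 0 /\ f t = 0].

Lemma compact_primitive_integrable (R : realType) (F f : R -> R) :
  compact_primitive F f -> (@lebesgue_measure R).-integrable setT (EFin \o f).
Proof.
move=> [dF cf [M FM]].
have -> : EFin \o f = (EFin \o f) \_ `[- M, M].
  apply/funext => t; rewrite patchE; case: ifPn => //.
  rewrite notin_setE/= in_itv/= -ler_norml => /negP; rewrite -ltNge => /ltW /FM[_ /= ->//].
rewrite -integrable_mkcond//; apply: continuous_compact_integrable => //.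
  exact: segment_compact.
exact: continuous_subspaceT.
Qed.

Lemma compact_primitiveE (R : realType) (F f : R -> R) t :
  compact_primitive F f -> F t = \int[lebesgue_measure]_(s in `]-oo, t]) f s.
Proof.
move=> cp; have intf := compact_primitive_integrable cp; move: cp => [dF cf [M FM]].
pose m := - (`|M| + `|t| + 1).
have mt : m < t.
  rewrite /m ltrNl; have := ler_norm (- t); rewrite normrN => h.
  by rewrite (le_lt_trans h)// -addrA ltr_wpDl// ltrDl.
have mM s : s <= m -> M <= `|s|.
  move=> sm; rewrite (le_trans (ler_norm M))//.
  have : - s <= `|s| by rewrite -normrN ler_norm.
  apply: le_trans; rewrite lerNr (le_trans sm)// lerN2 -addrA lerDl.
  by rewrite addr_ge0.
rewrite /Rintegral.
have -> : (\int[lebesgue_measure]_(s in `]-oo, t]) (f s)%:E =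
    \int[lebesgue_measure]_(s in `[m, t]) (f s)%:E)%E.
  rewrite [LHS]integral_mkcond [RHS]integral_mkcond; apply: eq_integral => s _.
  rewrite !patchE; case: ifPn; case: ifPn => //; rewrite !(notin_setE, inE)/= !in_itv/=.
    by move=> /negP; rewrite negb_and -!ltNge => /orP[/ltW /mM/FM[_ ->]//|ts]; rewrite leNgt ts.
  by move=> /andP[_ ->].
rewrite (@continuous_FTC2 _ _ F)//=.
- by have [-> _] := FM _ (mM m (lexx _)); rewrite subr0.
- exact: continuous_subspaceT.
- have cF : continuous F.
    by move=> s; apply: differentiable_continuous; apply/derivable1_diffP; have := dF s => ?; exact: ex_derive.
  split; [by move=> s _; have := dF s => ?; exact: ex_derive| |].
  + by apply: cvg_at_right_filter; exact: cF.
  + by apply: cvg_at_left_filter; exact: cF.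
- by move=> s _; rewrite derive1E; have := dF s => ?; exact: derive_val.
Qed.

(** The identity between a function and the integral of its
    derivative passes to the limit: if [phi k] is close to [U] and [dphi k] to
    [g] in L^1, then [U t] differs from the primitive of [g] by at most
    [|phi k t - U t|] plus a small constant, whose integral over any bounded
    interval is small. *)
Lemma slice_limit1 (R : realType) (U g : R -> R) (phi dphi : nat -> R -> R) :
  measurable_fun [set: measurableTypeR R] U ->
  measurable_fun [set: measurableTypeR R] g ->
  (forall k, compact_primitive (phi k) (dphi k)) ->
  (forall e : R, 0 < e -> exists k,
    (\int[lebesgue_measure]_t `|(phi k t - U t)%:E| +
     \int[lebesgue_measure]_t `|(dphi k t - g t)%:E| < e%:E)%E) ->
  (@lebesgue_measure R).-integrable setT (EFin \o g) /\
  {ae lebesgue_measure, forall t : measurableTypeR R, U t = \int[lebesgue_measure]_(s in `]-oo, (t : R)]) g s}.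
Proof.
move=> mU mg cp small.
have idphi k := compact_primitive_integrable (cp k).
have mdphi k : measurable_fun [set: measurableTypeR R] (dphi k).
  by apply/measurable_EFinP; exact: measurable_int (idphi k).
have mphi k : measurable_fun [set: measurableTypeR R] (phi k).
  apply: continuous_measurable_fun => s.
  have [dF _ _] := cp k.
  by apply: differentiable_continuous; apply/derivable1_diffP; have := dF s => ?; exact: ex_derive.
have msub k : measurable_fun [set: measurableTypeR R] (fun t => (dphi k t - g t)%:E).
  by apply/measurable_EFinP; exact: measurable_funB.
have mUsub k : measurable_fun [set: measurableTypeR R] (fun t => (phi k t - U t)%:E).
  by apply/measurable_EFinP; exact: measurable_funB.
have ige0 k : (0 <= \int[lebesgue_measure]_t `|(phi k t - U t)%:E|)%E by exact: integral_ge0.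
have jge0 k : (0 <= \int[lebesgue_measure]_t `|(dphi k t - g t)%:E|)%E by exact: integral_ge0.
have isub k e : (\int[lebesgue_measure]_t `|(phi k t - U t)%:E| +
     \int[lebesgue_measure]_t `|(dphi k t - g t)%:E| < e%:E)%E ->
     (@lebesgue_measure R).-integrable setT (fun t => (dphi k t - g t)%:E).
  move=> h; apply/integrableP; split => //.
  by apply: le_lt_trans (lt_trans h (ltry e)); rewrite leeDr.
have intg : (@lebesgue_measure R).-integrable setT (EFin \o g).
  have [k hk] := small 1 ltr01.
  have -> : EFin \o g = ((EFin \o dphi k) \- (fun t => (dphi k t - g t)%:E))%E.
    by apply/funext => t /=; rewrite -EFinB opprB addrC subrK.
  by apply: integrableB => //; exact: isub hk.
split => //.
pose F t := \int[lebesgue_measure]_(s in `]-oo, t]) g s.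
have cF : continuous F by exact: continuous_indefinite_integral.
have mF : measurable_fun [set: measurableTypeR R] F by exact: continuous_measurable_fun.
have key k e t : (\int[lebesgue_measure]_t `|(phi k t - U t)%:E| +
     \int[lebesgue_measure]_t `|(dphi k t - g t)%:E| < e%:E)%E ->
  `|U t - F t| <= `|phi k t - U t| + e.
  move=> h.
  rewrite -(subrKA (phi k t)) (le_trans (ler_normD _ _))// distrC lerD2l.
  rewrite (compact_primitiveE t (cp k)) /F -RintegralB//; last 2 first.
    by apply: integrableS (idphi k).
    by apply: integrableS intg.
  apply: le_trans (le_normr_Rintegral _ _) _ => //.
    by apply: integrableS (isub _ _ h).
  rewrite -lee_fin /Rintegral fineK; last first.
    apply: integrable_fin_num => //; apply: integrableS (integrable_abse (isub _ _ h)) => //.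
  apply: (@le_trans _ _ (\int[lebesgue_measure]_t `|(dphi k t - g t)%:E|)%E).
    apply: ge0_subset_integral => //.
    by apply/measurable_EFinP; apply: measurableT_comp => //; exact: measurable_funB.
  by apply/ltW; apply: le_lt_trans h; rewrite leeDr.
have mUF : measurable_fun [set: measurableTypeR R] (fun t => `|U t - F t|%:E).
  by apply/measurable_EFinP; apply: measurableT_comp => //; exact: measurable_funB.
have ball_ae (m : nat) : {ae lebesgue_measure, forall t : measurableTypeR R,
     `[- m%:R, m%:R]%classic t -> U t = F t}.
  have : (\int[lebesgue_measure]_(t in `[(- m%:R)%R, m%:R]) `|U t - F t|%:E = 0)%E.
    apply/eqP; rewrite eq_le integral_ge0 ?andbT; last by move=> *; rewrite lee_fin.
    apply/lee_addgt0Pr => e e0; rewrite add0e.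
    have e'0 : 0 < e / (1 + (m%:R + m%:R)) by rewrite divr_gt0// ltr_wpDr// addr_ge0.
    have [k hk] := small _ e'0; set e' := e / _ in e'0 hk.
    apply: (@le_trans _ _ (\int[lebesgue_measure]_(t in `[(- m%:R)%R, m%:R]) (`|(phi k t - U t)%:E| + e'%:E))%E).
      apply: ge0_le_integral => //.
      - exact: measurable_funTS.
      - apply: emeasurable_funD => //; apply: measurable_funTS; exact: measurableT_comp.
      - by move=> t _; rewrite -EFinD lee_fin; exact: key.
    rewrite ge0_integralD//; last 2 first.
      by apply: measurable_funTS; exact: measurableT_comp.
      by move=> *; rewrite lee_fin ltW.
    rewrite integral_cst//.
    apply: (@le_trans _ _ (e'%:E + e'%:E * (m%:R + m%:R)%:E)%E); last first.
      by rewrite -EFinM -EFinD lee_fin -[X in X + _]mulr1 -mulrDr /e' divfK// gt_eqF// ltr_wpDr// addr_ge0.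
    apply: leeD.
      apply: (@le_trans _ _ (\int[lebesgue_measure]_t `|(phi k t - U t)%:E|)%E).
        by apply: ge0_subset_integral => //; exact: measurableT_comp.
      by apply/ltW; apply: le_lt_trans hk; rewrite leeDl.
    apply: lee_wpmul2l; first by rewrite lee_fin ltW.
    rewrite [X in (X <= _)%E]lebesgue_measure_itv/= lte_fin; case: ifPn => _; last by rewrite lee_fin addr_ge0.
    by rewrite -EFinB opprK.
  have -> : (\int[lebesgue_measure]_(t in `[(- m%:R)%R, m%:R]) `|U t - F t|%:E =
            \int[lebesgue_measure]_(t in `[(- m%:R)%R, m%:R]) `|(U t - F t)%:E|)%E by [].
  move=> /ae_eq_integral_abs H.
  have {}H := H _ _; apply: filterS (H _ _) => //.
    move=> t ht ht2; have /eqP := ht ht2; rewrite eqe subr_eq0 => /eqP//.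
  by apply: measurable_funTS; apply/measurable_EFinP; exact: measurable_funB.
have := ae_foralln ball_ae; apply: filterS => t ht.
apply: (ht (Num.trunc `|t : R|).+1); rewrite /= in_itv/=.
by have := truncnS_gt `|t : R|; rewrite ltr_norml => /andP[/ltW -> /ltW].
Qed.

(** By Fubini's theorem, L^1 convergence on the whole space
    gives, on almost every line, indices with both L^1 distances small. *)
Lemma slice_limit (R : realType) (n : nat) (U g : 'rV[R]_n.+1 -> R)
    (phi dphi : nat -> 'rV[R]_n.+1 -> R) :
  measurable_fun setT U -> measurable_fun setT g ->
  (forall k, measurable_fun setT (phi k)) -> (forall k, measurable_fun setT (dphi k)) ->
  (forall k y, compact_primitive (fun t => phi k (cons_rV (t, y)))
     (fun t => dphi k (cons_rV (t, y)))) ->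
  (\int[lebesgue_rV n.+1]_x `|(phi k x - U x)%:E| @[k --> \oo] --> 0)%E ->
  (\int[lebesgue_rV n.+1]_x `|(dphi k x - g x)%:E| @[k --> \oo] --> 0)%E ->
  {ae lebesgue_rV n, forall y,
    (@lebesgue_measure R).-integrable setT (fun t => (g (cons_rV (t, y)))%:E) /\
    {ae lebesgue_measure, forall t : measurableTypeR R,
      U (cons_rV (t, y)) = \int[lebesgue_measure]_(s in `]-oo, (t : R)]) g (cons_rV (s, y))}}.
Proof.
move=> mU mg mphi mdphi cp cU cg.
have m1 k : measurable_fun setT (fun x => `|(phi k x - U x)%:E|%E).
  by apply: measurableT_comp => //; apply/measurable_EFinP; exact: measurable_funB.
have m2 k : measurable_fun setT (fun x => `|(dphi k x - g x)%:E|%E).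
  by apply: measurableT_comp => //; apply/measurable_EFinP; exact: measurable_funB.
have H := @ae_eventually_small _ _ _ (lebesgue_rV n)
  (fun k y => \int[lebesgue_measure]_t `|(phi k (cons_rV (t, y)) - U (cons_rV (t, y)))%:E| +
     \int[lebesgue_measure]_t `|(dphi k (cons_rV (t, y)) - g (cons_rV (t, y)))%:E|)%E _ _ _.
apply: filterS (H _ _ _) => [y hy|k|k y|].
- apply: (@slice_limit1 R _ _ (fun k t => phi k (cons_rV (t, y))) (fun k t => dphi k (cons_rV (t, y)))) => //.
  + exact: measurable_slice.
  + exact: measurable_slice.
- apply: emeasurable_funD.
    exact: (measurable_integral_slice (m1 k) (fun x => abse_ge0 _)).
  exact: (measurable_integral_slice (m2 k) (fun x => abse_ge0 _)).
- by rewrite adde_ge0// integral_ge0.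
- under eq_fun => k.
    rewrite ge0_integralD//; last 4 first.
    + by move=> y _; rewrite integral_ge0.
    + exact: (measurable_integral_slice (m1 k) (fun x => abse_ge0 _)).
    + by move=> y _; rewrite integral_ge0.
    + exact: (measurable_integral_slice (m2 k) (fun x => abse_ge0 _)).
    rewrite -(ge0_integral_rVS (m1 k) (fun x => abse_ge0 _)).
    rewrite -(ge0_integral_rVS (m2 k) (fun x => abse_ge0 _)).
    over.
  have := cvgeD _ cU cg; rewrite adde0; exact.
Qed.

(** One derivative suffices for the slices and for the integration
    by parts, and the Leibniz rule of first order shows that the product of two
    such functions is again one. *)
Definition C1c (R : realType) n (f : 'rV[R]_n -> R) :=
  [/\ forall x, differentiable f x, forall i, continuous (partial i f) &
      compact (closure [set x | f x != 0])].

Lemma test_fun_C1c (R : realType) n (D : set 'rV[R]_n) f : test_fun D f -> C1c f.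
Proof.
move=> [sf cf _]; split => //; first by move=> x; exact: (sf [::]).
by move=> i x; apply: differentiable_continuous; exact: (sf [:: i]).
Qed.

Lemma C1cM (R : realType) n (f g : 'rV[R]_n -> R) : C1c f -> C1c g ->
  C1c (f * g).
Proof.
move=> [df cf kf] [dg cg kg]; split.
- by move=> x; apply: differentiableM.
- move=> i x.
  rewrite (_ : partial i _ = fun x => f x * partial i g x + g x * partial i f x).
    have c1 : {for x, continuous f} by exact: differentiable_continuous.
    have c2 : {for x, continuous g} by exact: differentiable_continuous.
    exact: (cvgD (cvgM c1 (cg i x)) (cvgM c2 (cf i x))).
  by apply/funext => y; rewrite /partial deriveM//; exact: diff_derivable.
- apply: (subclosed_compact _ kf); first exact: closed_closure.
  apply: closure_subset => x /=; apply: contra_neq => fx0.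
  by rewrite /GRing.mul/= fx0 mul0r.
Qed.

Lemma partial_notin_support (R : realType) n (f : 'rV[R]_n -> R) x i :
  ~ closure [set x | f x != 0] x -> partial i f x = 0.
Proof.
move=> h.
have h0 : \near x, f x = cst 0 x.
  have /open_nbhs_nbhs : open_nbhs x (~` closure [set x | f x != 0]).
    by split => //; apply: closed_openC; exact: closed_closure.
  apply: filterS => y hy; apply/eqP/negPn/negP => fy; apply: hy.
  exact: subset_closure.
by rewrite /partial (near_eq_derive _ h0) derive_cst.
Qed.

Lemma C1c_bounded (R : realType) n (f : 'rV[R]_n -> R) : C1c f ->
  exists M, forall x, M <= `|x| -> f x = 0 /\ forall i, partial i f x = 0.
Proof.
move=> [_ _ /compact_bounded /pinfty_ex_gt0[M M0 fM]].
have h x : M + 1 <= `|x| -> ~ closure [set x | f x != 0] x.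
  by move=> Mx /fM /=; apply/negP; rewrite -ltNge (lt_le_trans _ Mx)// ltrDl.
exists (M + 1) => x /h hx; split; last by move=> i; exact: partial_notin_support.
by apply/eqP/negPn/negP => fy; apply: hx; exact: subset_closure.
Qed.

Lemma col_permE (T : Type) m n (s : {perm 'I_n}) (x : 'M[T]_(m, n)) k j :
  col_perm s x k j = x k (s j).
Proof. by rewrite mxE. Qed.

(** The lines parallel to the [i]-th axis are obtained
    from those of the first coordinate by exchanging coordinates 0 and [i]. *)
Lemma col_perm_cons_rV (R : realType) n (i : 'I_n.+1) (t h : R) (y : 'rV[R]_n) :
  col_perm (tperm ord0 i) (cons_rV (t + h, y)) =
  h *: delta_mx ord0 i + col_perm (tperm ord0 i) (cons_rV (t, y)).
Proof.
have addZE (A B : 'rV[R]_n.+1) j : (h *: A + B) 0 j = h * A 0 j + B 0 j by rewrite !mxE.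
have dE j : (delta_mx ord0 i : 'rV[R]_n.+1) 0 j = (j == i)%:R by rewrite mxE eqxx.
apply/rowP => j; rewrite addZE dE !col_permE.
have [->|ji] := eqVneq j i; first by rewrite tpermR !cons_rV0 mulr1 addrC.
rewrite mulr0 add0r.
have [k ->|kE] := unliftP ord0 (tperm ord0 i j); first by rewrite !cons_rVS.
by move: ji; rewrite -(inj_eq (@perm_inj _ (tperm ord0 i))) tpermR kE eqxx.
Qed.

Lemma coord_le_norm (R : realType) n (x : 'rV[R]_n) i : `|x ord0 i| <= `|x|.
Proof. by rewrite [leRHS]mx_normrE; apply: (le_trans _ (le_bigmax _ _ (ord0, i))). Qed.

Lemma cons_rV_continuous (R : realType) n i (y : 'rV[R]_n) :
  continuous (fun t : R => col_perm (tperm ord0 i) (cons_rV (t, y))).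
Proof.
move=> t; rewrite (_ : (fun _ => _) = fun t : R => t *: delta_mx ord0 i + col_perm (tperm ord0 i) (cons_rV (0, y))).
  apply: cvgD; last exact: cvg_cst.
  by apply: cvgZr_tmp; exact: cvg_id.
by apply/funext => s; rewrite -col_perm_cons_rV add0r.
Qed.

Lemma C1c_slice (R : realType) n (f : 'rV[R]_n.+1 -> R) i y : C1c f ->
  compact_primitive (fun t => f (col_perm (tperm ord0 i) (cons_rV (t, y))))
    (fun t => partial i f (col_perm (tperm ord0 i) (cons_rV (t, y)))).
Proof.
move=> Cf; have [M fM] := C1c_bounded Cf; move: (Cf) => [df cf _]; split.
- move=> t; set x := col_perm (tperm ord0 i) (cons_rV (t, y)).
  have E : (fun h : R => h^-1 *: (f (col_perm (tperm ord0 i) (cons_rV (h *: (1 : R) + t, y))) - f x)) =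
     (fun h => h^-1 *: (f (h *: delta_mx ord0 i + x) - f x)).
    apply/funext => h; congr (_ *: (f _ - _)).
    by rewrite addrC col_perm_cons_rV /GRing.scale/= mulr1.
  have d := diff_derivable (df x) (v := delta_mx ord0 i).
  apply: DeriveDef; rewrite /derivable/= /derive /partial.
    by move: d; rewrite /derivable E.
  by rewrite E.
- move=> t; apply: continuous_comp; first exact: cons_rV_continuous.
  exact: cf.
- exists M => t Mt.
  have /fM[-> fi] : M <= `|col_perm (tperm ord0 i) (cons_rV (t, y))|.
    apply: (le_trans Mt); apply: le_trans (coord_le_norm _ i).
    by rewrite col_permE tpermR cons_rV0.
  by split => //; exact: fi.
Qed.

Lemma bounded_support_integrable (R : realType) n (f : 'rV[R]_n -> R) :
  continuous f -> (exists M, forall x, M <= `|x| -> f x = 0) ->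
  (lebesgue_rV n).-integrable setT (EFin \o f).
Proof.
move=> cf [M fM].
have mf : measurable_fun setT f by exact: rV_continuous_measurable.
have [C fC] : exists C, forall x, `|f x| <= C.
  have cB : compact [set x : 'rV[R]_n | forall i, `[- M, M]%classic (x ord0 i)].
    by apply: (@rV_compact _ _ (fun=> `[- M, M]%classic)) => _; exact: segment_compact.
  have /compact_bounded /pinfty_ex_gt0[C C0 fC] :
      compact (f @` [set x : 'rV[R]_n | forall i, `[- M, M]%classic (x ord0 i)]).
    by apply: continuous_compact => //; exact: continuous_subspaceT.
  exists C => x; have [xM|Mx] := leP `|x| M; last by rewrite fM ?normr0 ltW.
  apply: fC; exists x => // i.
  by rewrite /= in_itv/= -ler_norml; apply: le_trans xM; exact: coord_le_norm.
have C0 : 0 <= C by rewrite (le_trans _ (fC 0)).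
pose B := [set x : 'rV[R]_n | forall i, `[- M, M]%classic (x ord0 i)].
have mB : measurable B by apply: (@measurable_rV_box R n (fun=> `[- M, M]%classic)).
apply/integrableP; split; first exact/measurable_EFinP.
apply: (@le_lt_trans _ _ (\int[lebesgue_rV n]_x (C%:E * (\1_B x)%:E))%E).
  apply: ge0_le_integral => //.
  - by apply: measurableT_comp => //; exact/measurable_EFinP.
  - by apply/measurable_EFinP; apply: measurable_funM => //; exact: measurable_indic.
  - move=> x _; rewrite /= -EFinM lee_fin indicE.
    have [xB|xB] := boolP (x \in B); first by rewrite mulr1.
    rewrite mulr0 fM ?normr0// leNgt; apply/negP => xM; move: xB; rewrite notin_setE; apply.
    move=> i; rewrite /= in_itv/= -ler_norml; apply: le_trans (coord_le_norm _ _) _; exact: ltW.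
rewrite ge0_integralZl//; last by apply/measurable_EFinP; exact: measurable_indic.
rewrite integral_indic// setIT lte_mul_pinfty// /B.
have E := @lebesgue_rV_box R n (fun=> `[- M, M]%classic) (fun=> measurable_itv _).
rewrite [X in (X < _)%E]E.
rewrite (eq_bigr (fun=> (fine (lebesgue_measure `[- M, M]%classic))%:E)) ?prodEFin ?ltry// => i _.
by rewrite fineK// lebesgue_measure_itv/=; case: ifPn => //.
Qed.

Lemma integral_compact_primitive (R : realType) (F f : R -> R) :
  compact_primitive F f -> \int[lebesgue_measure]_t f t = 0.
Proof.
move=> cp; have [_ _ [M FM]] := cp.
have [F0 _] : F (Num.max M 0) = 0 /\ f (Num.max M 0) = 0.
  by apply: FM; rewrite ger0_norm ?le_max ?lexx ?orbT.
rewrite -F0 (compact_primitiveE _ cp) [LHS]Rintegral_mkcond [RHS]Rintegral_mkcond.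
apply: eq_Rintegral => t _; rewrite !patchE in_setT; case: ifPn => //.
rewrite notin_setE /= in_itv/= => /negP; rewrite -ltNge => ht.
have [_ ->//] : F t = 0 /\ f t = 0.
apply: FM; rewrite (le_trans _ (ler_norm t))// (le_trans _ (ltW ht))// le_max lexx//.
Qed.

Lemma C1c_partial_integrable (R : realType) n (f : 'rV[R]_n -> R) i : C1c f ->
  (lebesgue_rV n).-integrable setT (EFin \o partial i f).
Proof.
move=> Cf; have [_ cf _] := Cf; apply: bounded_support_integrable => //.
by have [M fM] := C1c_bounded Cf; exists M => x /fM[].
Qed.

Lemma col_permK_tperm (R : realType) n (i : 'I_n.+1) :
  involutive (@col_perm R 1 n.+1 (tperm ord0 i)).
Proof. by move=> x; apply/rowP => j; rewrite mxE mxE tpermK. Qed.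

Lemma integral_col_perm (R : realType) n (s : {perm 'I_n}) (f : 'rV[R]_n -> \bar R) :
  (lebesgue_rV n).-integrable setT (f \o col_perm s) ->
  measurable_fun setT f ->
  (\int[lebesgue_rV n]_x f (col_perm s x) = \int[lebesgue_rV n]_x f x)%E.
Proof.
move=> intf mf.
rewrite -[LHS](@integral_pushforward _ _ _ _ _ _ (@rV_perm_measurable R n s) (lebesgue_rV n) setT f)//.
apply: (@eq_measure_integral _ _ _ _ (lebesgue_rV n) (measure_function_pushforward__canonical__measure_function_Measure (lebesgue_rV n) (@rV_perm_measurable R n s))).
by move=> A mA _; exact: lebesgue_rV_perm.
Qed.

Lemma ge0_integral_col_perm (R : realType) n (s : {perm 'I_n}) (f : 'rV[R]_n -> \bar R) :
  measurable_fun setT f -> (forall x, 0 <= f x)%E ->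
  (\int[lebesgue_rV n]_x f (col_perm s x) = \int[lebesgue_rV n]_x f x)%E.
Proof.
move=> mf f0.
rewrite -[LHS](@ge0_integral_pushforward _ _ _ _ _ _ (@rV_perm_measurable R n s) (lebesgue_rV n) setT f)//.
apply: (@eq_measure_integral _ _ _ _ (lebesgue_rV n) (measure_function_pushforward__canonical__measure_function_Measure (lebesgue_rV n) (@rV_perm_measurable R n s))).
by move=> A mA _; exact: lebesgue_rV_perm.
Qed.

Lemma integrable_col_perm (R : realType) n (s : {perm 'I_n}) (f : 'rV[R]_n -> \bar R) :
  (lebesgue_rV n).-integrable setT f ->
  (lebesgue_rV n).-integrable setT (f \o col_perm s).
Proof.
move=> /integrableP[mf intf]; apply/integrableP; split.
  by apply: measurableT_comp => //; exact: rV_perm_measurable.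
rewrite (ge0_integral_col_perm s (f := fun x => `|f x|%E))//.
exact: measurableT_comp.
Qed.

(** The integral of [partial i f] along each line of
    direction [i] is zero. *)
Lemma integral_partial (R : realType) n (f : 'rV[R]_n.+1 -> R) i : C1c f ->
  \int[lebesgue_rV n.+1]_x partial i f x = 0.
Proof.
move=> Cf; have intf := C1c_partial_integrable i Cf.
have mf : measurable_fun setT (EFin \o partial i f) := measurable_int _ intf.
have intp := integrable_col_perm (tperm ord0 i) intf.
rewrite /Rintegral -(@integral_col_perm _ _ (tperm ord0 i) (EFin \o partial i f))//.
have mp := measurable_int _ intp.
have ip : (lebesgue_measure \x lebesgue_rV n)%E.-integrable setT
   ((EFin \o partial i f) \o (@col_perm R 1 n.+1 (tperm ord0 i)) \o (@cons_rV R n)).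
  apply/integrableP; split.
    by apply: measurableT_comp => //; exact: measurable_cons_rV.
  move/integrableP : intp => [_]; apply: le_lt_trans.
  rewrite [leRHS](@ge0_integral_pushforward _ _ _ _ _ _ (@measurable_cons_rV R n) (lebesgue_measure \x lebesgue_rV n)%E setT)//.
  exact: measurableT_comp.
rewrite [X in fine X](_ : _ = 0%E)//.
rewrite [LHS](@integral_pushforward _ _ _ _ _ _ (@measurable_cons_rV R n) (lebesgue_measure \x lebesgue_rV n)%E setT)//.
rewrite preimage_setT -integral21_prod_meas1//.
apply: integral0_eq => y _; rewrite /fubini_G.
have cp := C1c_slice i y Cf.
rewrite -[LHS]fineK; last first.
  by apply: integrable_fin_num => //; exact: (compact_primitive_integrable cp).
by have := integral_compact_primitive cp; rewrite /Rintegral => ->.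
Qed.

(** Integration by parts: the integral of
    [partial i (h * phi)] is zero. No boundary term appears because [h] and its
    partial derivatives vanish outside [D], whatever the boundary of [D]. *)
Lemma C1c_weak_gradient (R : realType) n (D : set 'rV[R]_n.+1) (h : 'rV[R]_n.+1 -> R) :
  C1c h -> (forall x, ~ D x -> h x = 0 /\ forall i, partial i h x = 0) ->
  weak_gradient D h (fun x => \row_i partial i h x).
Proof.
move=> Ch hD phi /test_fun_C1c Cphi i.
rewrite Rintegral_mkcond [X in - X]Rintegral_mkcond.
have [dh ch _] := Ch. have [dphi cphi _] := Cphi.
have E1 : (fun x => h x * partial i phi x) \_ D = fun x => h x * partial i phi x.
  by apply/funext => x; rewrite patchE; case: ifPn => //; rewrite notin_setE => /hD[-> _]; rewrite mul0r.
have E2 : (fun x => (\row_i partial i h x) ord0 i * phi x) \_ D = fun x => partial i h x * phi x.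
  apply/funext => x; rewrite patchE; case: ifPn; first by rewrite mxE.
  by rewrite notin_setE => /hD[_ ->]; rewrite mul0r.
rewrite [X in Rintegral _ _ X]E1 [X in - (Rintegral _ _ X)]E2.
apply/eqP; rewrite -addr_eq0; apply/eqP.
have bounded (f g : 'rV[R]_n.+1 -> R) : continuous f -> continuous g ->
    (exists M, forall x, M <= `|x| -> f x = 0) ->
    (lebesgue_rV n.+1).-integrable setT (fun x => (f x * g x)%:E).
  move=> cf cg [M fM]; apply: (bounded_support_integrable (f := fun x => f x * g x)).
    by move=> x; exact: (cvgM (cf x) (cg x)).
  by exists M => x /fM ->; rewrite mul0r.
rewrite -RintegralD//; last 2 first.
- apply: bounded => //; first by move=> x; exact: differentiable_continuous.
  by have [M fM] := C1c_bounded Ch; exists M => x /fM[].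
- apply: bounded => //; first by move=> x; exact: differentiable_continuous.
  by have [M fM] := C1c_bounded Ch; exists M => x /fM[_].
rewrite -(integral_partial i (C1cM Ch Cphi)).
apply: eq_Rintegral => x _.
rewrite [RHS]/partial deriveM; [|exact: diff_derivable|exact: diff_derivable].
by rewrite /GRing.scale/= -/(partial i phi x) -/(partial i h x) [phi x * _]mulrC.
Qed.

Lemma eballE (R : realType) n (r : R) : 0 < r ->
  eball r = [set x : 'rV[R]_n | dotp x x < r ^+ 2].
Proof.
move=> r0; apply/seteqP; split => x; rewrite /eball/= /enorm => h.
  by rewrite -[ltLHS]sqr_sqrtr ?dotp_ge0// ltr_pXn2r// nnegrE ?sqrtr_ge0// ltW.
rewrite -(@ltr_pXn2r _ 2) ?nnegrE ?sqrtr_ge0 ?(ltW r0)//.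
by rewrite sqr_sqrtr ?dotp_ge0.
Qed.

Lemma measurable_eball (R : realType) n (r : R) : 0 < r ->
  measurable (eball r : set 'rV[R]_n).
Proof.
move=> r0; rewrite eballE// (_ : [set _ | _] = (fun x => dotp x x) @^-1` `]-oo, r ^+ 2[%classic).
  by rewrite -[X in measurable X]setTI; apply: dotp_measurable.
by apply/seteqP; split => x /=; rewrite in_itv.
Qed.

Lemma eball_finite (R : realType) n (r : R) : 0 < r ->
  (lebesgue_rV n (eball r : set 'rV[R]_n) < +oo)%E.
Proof.
move=> r0.
apply: (@le_lt_trans _ _ (lebesgue_rV n [set x : 'rV[R]_n | dotp x x <= r ^+ 2])).
  apply: le_measure; rewrite ?inE; [exact: measurable_eball|exact: measurable_dotp_le|].
  by move=> x; rewrite eballE//= => /ltW.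
have h : 0 < r ^+ 2 by rewrite exprn_gt0.
by rewrite [X in (X < _)%E](lebesgue_rV_dotp_le n h) unit_volumeE ltry.
Qed.

(** Hoelder's inequality against the indicator function of the
    set [D] of finite measure. *)
Lemma Lp_cvg_L1 (R : realType) n (D : set 'rV[R]_n) p (v : nat -> 'rV[R]_n -> R) u :
  measurable D -> (lebesgue_rV n D < +oo)%E -> 1 < p ->
  (forall k, measurable_fun setT (v k)) -> measurable_fun setT (u \_ D) ->
  (forall k x, ~ D x -> v k x = 0) ->
  Lp_cvg D p v u ->
  (\int[lebesgue_rV n]_x `|(v k x - (u \_ D) x)%:E| @[k --> \oo] --> 0)%E.
Proof.
move=> mD Doo p1 mv mu vD cvu.
have p0 : 0 < p by exact: lt_trans p1.
pose q := p / (p - 1).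
have q0 : 0 < q by rewrite divr_gt0// subr_gt0.
have pq : p^-1 + q^-1 = 1.
  by rewrite /q invf_div mulrBl mul1r divff ?gt_eqF//; ring.
set C := ('N[lebesgue_rV n]_q%:E[EFin \o \1_D])%E.
have C0 : (0 <= C)%E by exact: Lnorm_ge0.
have Coo : C \is a fin_num.
  rewrite ge0_fin_numE// /C unlock poweR_lty//.
  rewrite (_ : integral _ _ _ = lebesgue_rV n D)//.
  transitivity (\int[lebesgue_rV n]_x (\1_D x)%:E)%E; last by rewrite integral_indic// setIT.
  apply: eq_integral => x _.
  rewrite /= indicE; case: (_ \in _); first by rewrite normr1 powR1.
  by rewrite normr0 powR0// gt_eqF.
have key k : (\int[lebesgue_rV n]_x `|(v k x - (u \_ D) x)%:E| <=
   'N[lebesgue_rV n]_p%:E [EFin \o ((v k \- u)%R \_ D)] * C)%E.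
  have mf : measurable_fun setT ((v k \- u)%R \_ D).
    rewrite (_ : _ \_ _ = fun x => v k x - (u \_ D) x); first exact: measurable_funB.
    apply/funext => x; rewrite !patchE; case: ifPn => //.
    by rewrite notin_setE => /vD ->; rewrite subr0.
  have m1 : measurable_fun setT (\1_D : 'rV[R]_n -> R) by exact: measurable_indic.
  have := hoelder (lebesgue_rV n) mf m1 p0 q0 pq.
  apply: le_trans; rewrite Lnorm1 le_eqVlt; apply/orP; left; apply/eqP.
  apply: eq_integral => x _; rewrite /= !patchE indicE; case: ifPn; first by rewrite mulr1.
  by rewrite notin_setE => /vD ->; rewrite subr0 mul0r.
apply: (@squeeze_cvge _ _ _ _ (cst 0%E) _ (fun k => 'N[lebesgue_rV n]_p%:E [EFin \o ((v k \- u)%R \_ D)] * C)%E).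
- by near=> k; rewrite key andbT integral_ge0.
- exact: cvg_cst.
- rewrite -[X in _ --> X](mul0e C); apply: cvgeZr => //; exact: cvu.
Unshelve. all: by end_near. Qed.

(** Absolute continuity on lines. The extension by 0 of [u] is
    the limit of test functions, which equal the integral of their partial
    derivative from minus infinity; both the functions and their derivatives
    converge in L^1, so [slice_limit] applies. *)
Lemma W1p0_slice (R : realType) n (r p : R) u G (i : 'I_n.+1) : 0 < r -> 1 < p ->
  W1p0 (eball r) p u G ->
  {ae lebesgue_rV n, forall y,
    (@lebesgue_measure R).-integrable setT
      (fun t => (((fun x => G x ord0 i) \_ (eball r)) (col_perm (tperm ord0 i) (cons_rV (t, y))))%:E) /\
    {ae lebesgue_measure, forall t : measurableTypeR R,
      (u \_ (eball r)) (col_perm (tperm ord0 i) (cons_rV (t, y))) =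
      \int[lebesgue_measure]_(s in `]-oo, (t : R)])
         ((fun x => G x ord0 i) \_ (eball r)) (col_perm (tperm ord0 i) (cons_rV (s, y)))}}.
Proof.
move=> r0 p1 [[Lu LG _] [phi [tphi cphi cdphi]]].
have mD := @measurable_eball R n.+1 r r0.
have Doo := @eball_finite R n.+1 r r0.
have mU : measurable_fun setT (u \_ (eball r)).
  by move: Lu; rewrite /Lp inE/= => /andP[]; rewrite inE.
have mg : measurable_fun setT ((fun x => G x ord0 i) \_ (eball r)).
  by have := LG i; rewrite /Lp inE/= => /andP[]; rewrite inE.
have mP := @rV_perm_measurable R n.+1 (tperm ord0 i).
have Cphi k := test_fun_C1c (tphi k).
have mphi k : measurable_fun setT (phi k).
  by apply: rV_continuous_measurable => x; apply: differentiable_continuous; have [+ _ _] := Cphi k; exact.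
have mdphi k : measurable_fun setT (partial i (phi k)).
  by apply: rV_continuous_measurable; have [_ + _] := Cphi k; exact.
have off k x : ~ eball r x -> ~ closure [set x | phi k x != 0] x.
  by move=> Dx h; apply: Dx; have [_ _] := tphi k; exact.
have off0 k x : ~ eball r x -> phi k x = 0.
  by move=> /(off k) h; apply/eqP/negPn/negP => fy; apply: h; exact: subset_closure.
have off1 k x : ~ eball r x -> partial i (phi k) x = 0.
  by move=> /(off k) h; exact: partial_notin_support.
have L1 := Lp_cvg_L1 mD Doo p1 mphi mU off0 cphi.
have L2 := Lp_cvg_L1 mD Doo p1 mdphi mg off1 (cdphi i).
apply: (@slice_limit R n (fun x => (u \_ (eball r)) (col_perm (tperm ord0 i) x))
   (fun x => ((fun x => G x ord0 i) \_ (eball r)) (col_perm (tperm ord0 i) x))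
   (fun k x => phi k (col_perm (tperm ord0 i) x))
   (fun k x => partial i (phi k) (col_perm (tperm ord0 i) x))).
- exact: measurableT_comp.
- exact: measurableT_comp.
- by move=> k; exact: measurableT_comp.
- by move=> k; exact: measurableT_comp.
- by move=> k y; exact: C1c_slice.
- under eq_fun => k.
    rewrite (@ge0_integral_col_perm _ _ (tperm ord0 i) (fun x => `|(phi k x - (u \_ (eball r)) x)%:E|%E))//; last first.
      by apply: measurableT_comp => //; apply/measurable_EFinP; exact: measurable_funB.
    over.
  exact: L1.
- under eq_fun => k.
    rewrite (@ge0_integral_col_perm _ _ (tperm ord0 i) (fun x => `|(partial i (phi k) x - ((fun x => G x ord0 i) \_ (eball r)) x)%:E|%E))//; last first.
      by apply: measurableT_comp => //; apply/measurable_EFinP; exact: measurable_funB.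
    over.
  exact: L2.
Qed.

(** * The radial profile and its gradient *)

(** A null set contains no interval. *)
Lemma null_dense_right (R : realType) (N : set (measurableTypeR R)) (x e : R) :
  measurable N -> lebesgue_measure N = 0%E -> 0 < e ->
  exists s : R, [/\ x < s, s < x + e & ~ N s].
Proof.
move=> mN N0 e0; apply: contrapT => /forallNP h.
have sub : `]x, x + e[%classic `<=` N.
  move=> s /=; rewrite in_itv/= => /andP[xs se]; apply: contrapT => Ns.
  by apply: (h s).
have : (lebesgue_measure (`]x, (x + e)%R[%classic : set (measurableTypeR R)) <= 0)%E.
  by rewrite -N0; apply: le_measure; rewrite ?inE.
rewrite lebesgue_measure_itv/= lte_fin ltrDl e0 -EFinB lee_fin.
by rewrite addrAC subrr add0r leNgt e0.
Qed.

(** Only the right of [x] is examined because the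
    squared radii seen by a line form an interval unbounded above. *)
Lemma continuous_ae_eq_right (R : realType) (f g : R -> R) (N : set (measurableTypeR R)) (x : R) :
  measurable N -> lebesgue_measure N = 0%E ->
  {for x, continuous f} -> {for x, continuous g} ->
  (forall s, x < s -> ~ N s -> f s = g s) -> f x = g x.
Proof.
move=> mN N0 cf cg fg; apply/eqP; rewrite -subr_eq0 -normr_le0 leNgt; apply/negP => d0.
have /cvgrPdist_lt/(_ _ d0) : {for x, continuous (fun s => f s - g s)} by exact: (cvgB cf cg).
move=> [e /= e0 he].
have [s [xs se Ns]] := null_dense_right x mN N0 e0.
suff : `|f x - g x - (f s - g s)| < `|f x - g x| by rewrite (fg s xs Ns) subrr subr0 ltxx.
apply: he.
by rewrite /ball_/= ltr0_norm ?subr_lt0// opprB ltrBlDl.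
Qed.

Lemma near_eq_continuous_at (R : realType) (f g : R -> R) (x : R) :
  (\near x, f x = g x) -> {for x, continuous f} -> {for x, continuous g}.
Proof.
move=> fg cf; rewrite /prop_for /continuous_at -(nbhs_singleton fg).
by apply: cvg_trans cf; apply: near_eq_cvg; apply: filterS fg => y ->.
Qed.

Lemma measurable_sqrt_subr (R : realType) (a : R) (T : set (measurableTypeR R)) :
  measurable T ->
  measurable [set s : measurableTypeR R | a < (s : R) /\ T (Num.sqrt ((s : R) - a))].
Proof.
move=> mT.
have mr : measurable_fun [set: measurableTypeR R] (fun s : measurableTypeR R => Num.sqrt ((s : R) - a) : measurableTypeR R).
  have h : measurable_fun [set: measurableTypeR R] (fun s : measurableTypeR R => Num.sqrt (s : R) : measurableTypeR R).
    by apply: continuous_measurable_fun; exact: sqrt_continuous.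
  apply: (measurableT_comp h); exact: measurable_funB.
rewrite (_ : [set _ | _] = `]a, +oo[%classic `&` (fun s : measurableTypeR R => Num.sqrt ((s : R) - a) : measurableTypeR R) @^-1` T).
  by apply: measurableI => //; rewrite -[X in measurable X]setTI; exact: mr.
by apply/seteqP; split => s /=; rewrite in_itv/= andbT.
Qed.

Lemma dotp_cons_rV (R : realType) n (t : R) (y : 'rV[R]_n) :
  dotp (cons_rV (t, y)) (cons_rV (t, y)) = t ^+ 2 + dotp y y.
Proof.
rewrite /dotp big_ord_recl cons_rV0 expr2; congr (_ + _).
by apply: eq_bigr => i _; rewrite cons_rVS.
Qed.

Lemma dotp_col_perm (R : realType) n (s : {perm 'I_n}) (x y : 'rV[R]_n) :
  dotp (col_perm s x) (col_perm s y) = dotp x y.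
Proof.
rewrite /dotp [RHS](reindex_inj (@perm_inj _ s)).
by apply: eq_bigr => i _; rewrite !col_permE.
Qed.

(** The law of the squared radius has a density
    ([sphere_measure_null]). *)
Lemma ae_dotp (R : realType) n (P : R -> Prop) : (1 < n)%N ->
  {ae lebesgue_measure, forall s : measurableTypeR R, 0 < (s : R) -> P s} ->
  {ae lebesgue_rV n, forall x : 'rV[R]_n, 0 < dotp x x -> P (dotp x x)}.
Proof.
move=> n1 [N [mN N0 PN]]; exists [set x | N (dotp x x)]; split.
- by rewrite -[X in measurable X]setTI; apply: dotp_measurableR.
- exact: sphere_measure_null.
- by move=> x /= Px; apply: PN.
Qed.

Lemma ae_dotp_gt0 (R : realType) n : (0 < n)%N ->
  {ae lebesgue_rV n, forall x : 'rV[R]_n, 0 < dotp x x}.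
Proof.
move=> n0; exists [set x | dotp x x <= 0]; split.
- exact: measurable_dotp_le.
- rewrite [LHS](lebesgue_rV_ball n0 (lexx 0)) powR0 ?mulr0//.
  by rewrite mulf_neq0// pnatr_eq0 -lt0n.
- by move=> x /= /negP; rewrite -leNgt.
Qed.

Lemma ae_exists_small (R : realType) n (P : 'rV[R]_n -> Prop) (e : R) :
  (0 < n)%N -> 0 < e ->
  {ae lebesgue_rV n, forall x, P x} -> exists2 x, P x & dotp x x < e.
Proof.
move=> n0 e0 [N [mN N0 PN]]; apply: contrapT => /forall2NP h.
have sub : [set x : 'rV[R]_n | dotp x x <= e / 2] `<=` N.
  move=> x /= xe; apply: PN => /= Px; have [//|] := h x; apply.
  by rewrite (le_lt_trans xe)// gtr_pMr// invf_lt1// ltr1n.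
have e20 : 0 <= e / 2 by rewrite divr_ge0// ltW.
have : (lebesgue_rV n [set x : 'rV[R]_n | (dotp x x <= e / 2)%R] <= lebesgue_rV n N)%E.
  by apply: le_measure; rewrite ?inE//; exact: measurable_dotp_le.
rewrite N0 [X in (X <= _)%E](lebesgue_rV_ball n0 e20) lee_fin.
by rewrite leNgt mulr_gt0// ?unit_volume_gt0// powR_gt0// divr_gt0.
Qed.

Lemma ae_col_perm (R : realType) n (s : {perm 'I_n}) (P : 'rV[R]_n -> Prop) :
  {ae lebesgue_rV n, forall x, P x} -> {ae lebesgue_rV n, forall x, P (col_perm s x)}.
Proof.
move=> [N [mN N0 PN]]; exists (col_perm s @^-1` N); split.
- by rewrite -[X in measurable X]setTI; apply: rV_perm_measurable.
- exact: etrans (lebesgue_rV_perm s mN) N0.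
- by move=> x /= Px; apply: PN.
Qed.

(** The primitive [F y] along the line through [y] gives a
    continuous function [zf y] of [s], for [s] larger than the squared distance
    [dotp y y] of the line to the origin. It agrees almost everywhere with the
    radial form [g1] of [u], hence the functions [zf y] of two lines agree where
    both make sense. Lines [Y k] closer and closer to the origin give [z]. *)
Lemma radial_profile (R : realType) n (r p : R) u G : (0 < n)%N -> 0 < r -> 1 < p ->
  W1p0 (@eball R n.+1 r) p u G -> radial (eball r) u ->
  exists z : R -> R,
    [/\ forall s, 0 < s -> {for s, continuous z},
        forall s, r ^+ 2 <= s -> z s = 0,
        forall s, s <= 0 -> z s = 0 &
        {ae lebesgue_rV n.+1, forall x, (u \_ (eball r)) x = z (dotp x x)}].
Proof.
move=> n0 r0 p1 W [g0 ug0].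
pose U := u \_ (@eball R n.+1 r).
pose g := (fun x => G x ord0 ord0) \_ (@eball R n.+1 r).
(* u extended by 0, as a function of the squared radius *)
pose g1 s := if s < r ^+ 2 then g0 (Num.sqrt s) else 0.
have Ug1 : {ae lebesgue_rV n.+1, forall x, U x = g1 (dotp x x)}.
  apply: filterS ug0 => x hx; rewrite /U /g1 patchE.
  have E : (x \in (eball r : set 'rV[R]_n.+1)) = (dotp x x < r ^+ 2).
    by apply/idP/idP; rewrite inE eballE.
  by rewrite E; case: ifPn => // h; apply: hx; rewrite eballE.
pose F (y : 'rV[R]_n) (t : R) := \int[lebesgue_measure]_(s in `]-oo, t]) g (cons_rV (s, y)).
pose good (y : 'rV[R]_n) := [/\ continuous (F y),
  {ae lebesgue_measure, forall t : measurableTypeR R, U (cons_rV (t, y)) = F y t} &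
  {ae lebesgue_measure, forall t : measurableTypeR R, U (cons_rV (t, y)) = g1 ((t : R) ^+ 2 + dotp y y)}].
have aegood : {ae lebesgue_rV n, forall y, good y}.
  have := W1p0_slice ord0 r0 p1 W; rewrite tperm1.
  have := ae_slice Ug1; apply: filterS2 => y h1 [h2 h3]; split.
  - apply: continuous_indefinite_integral.
    by move: h2; under eq_fun do rewrite col_perm1.
  - apply: filterS h3 => t; rewrite col_perm1 /U => ->.
    by apply: eq_Rintegral => s _; rewrite col_perm1.
  - by apply: filterS h1 => t; rewrite dotp_cons_rV.
pose zf y s := F y (Num.sqrt (s - dotp y y)).
have zf_g1 y : good y -> exists N : set (measurableTypeR R), [/\ measurable N, lebesgue_measure N = 0%E &
    forall s, dotp y y < s -> ~ N s -> zf y s = g1 s].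
  move=> [_ h1 h2].
  have [T [mT T0 hT]] : {ae lebesgue_measure, forall t : measurableTypeR R, F y t = g1 ((t : R) ^+ 2 + dotp y y)}.
    by apply: filterS2 h1 h2 => t -> ->.
  exists [set s : measurableTypeR R | dotp y y < (s : R) /\ T (Num.sqrt ((s : R) - dotp y y))]; split.
  - exact: measurable_sqrt_subr.
  - exact: sqrt_subr_null.
  - move=> s ys /= /not_andP[//|nT].
    have : F y (Num.sqrt (s - dotp y y)) = g1 ((Num.sqrt (s - dotp y y)) ^+ 2 + dotp y y).
      by apply: contrapT => hh; apply: nT; apply: hT.
    by rewrite sqr_sqrtr ?subr_ge0 ?(ltW ys)// subrK.
have zf_cont y s : good y -> {for s, continuous (zf y)}.
  move=> [cF _ _]; apply: (@continuous_comp _ _ _ (fun s => Num.sqrt (s - dotp y y)) (F y)); last exact: cF.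
  apply: (@continuous_comp _ _ _ (fun s => s - dotp y y) (@Num.sqrt R)); last exact: sqrt_continuous.
  by apply: cvgB; [exact: cvg_id|exact: cvg_cst].
have zf_eq y y' s : good y -> good y' -> dotp y y < s -> dotp y' y' < s -> zf y s = zf y' s.
  move=> gy gy' ys y's.
  have [N [mN N0 hN]] := zf_g1 y gy.
  have [N' [mN' N'0 hN']] := zf_g1 y' gy'.
  apply: (@continuous_ae_eq_right _ _ _ (N `|` N')).
  - exact: measurableU.
  - by apply: null_set_setU.
  - exact: zf_cont.
  - exact: zf_cont.
  - move=> x sx /not_orP[Nx N'x]; rewrite hN ?hN'//; exact: lt_trans sx.
have /choice[Y hY] : forall k : nat, exists y, good y /\ dotp y y < k.+1%:R^-1.
  move=> k; have [|y gy yk] := @ae_exists_small R n good k.+1%:R^-1 n0 _ aegood.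
    by rewrite invr_gt0.
  by exists y.
pose K (s : R) := Num.trunc (s^-1).
have KY s : 0 < s -> dotp (Y (K s)) (Y (K s)) < s.
  move=> s0; have [_ h] := hY (K s); apply: lt_trans h _.
  by rewrite invf_plt ?posrE//; exact: truncnS_gt.
pose z s := if 0 < s then zf (Y (K s)) s else 0.
have zE y s : good y -> dotp y y < s -> z s = zf y s.
  move=> gy ys; have s0 : 0 < s by rewrite (le_lt_trans (dotp_ge0 y)).
  by rewrite /z s0; apply: zf_eq => //; [have [] := hY (K s)|exact: KY].
exists z; split.
- move=> s s0; have [gY _] := hY (K s); have Ys := KY s s0.
  apply: (@near_eq_continuous_at _ (zf (Y (K s)))); last exact: zf_cont.
  near=> x; apply/esym/zE => //.
  by near: x; exact: lt_nbhsr.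
- move=> s rs; have s0 : 0 < s by rewrite (lt_le_trans _ rs)// exprn_gt0.
  have [gY _] := hY (K s); have Ys := KY s s0.
  rewrite (zE _ _ gY Ys); have [N [mN N0 hN]] := zf_g1 _ gY.
  apply: (@continuous_ae_eq_right _ _ (cst 0) N s mN N0); first exact: zf_cont.
    exact: cst_continuous.
  move=> x sx Nx; rewrite hN ?(lt_trans Ys)// /g1 ifN// -leNgt.
  exact/ltW/(le_lt_trans rs).
- by move=> s s0; rewrite /z ltNge s0.
- have /choice[N hN] : forall k, exists N : set (measurableTypeR R), [/\ measurable N, lebesgue_measure N = 0%E &
    forall s, dotp (Y k) (Y k) < s -> ~ N s -> zf (Y k) s = g1 s].
    by move=> k; apply: zf_g1; have [] := hY k.
  have h1 : {ae lebesgue_measure, forall s : measurableTypeR R, forall k, ~ N k s}.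
    apply: ae_foralln => k; exists (N k); have [? ? _] := hN k; split => //.
    by move=> x /= /contrapT.
  have h2 : {ae lebesgue_rV n.+1, forall x : 'rV[R]_n.+1, 0 < dotp x x -> forall k, ~ N k (dotp x x)}.
    apply: (@ae_dotp R n.+1 (fun s => forall k, ~ N k s)) => //.
    by apply: filterS h1 => s hs _.
  have h3 := @ae_dotp_gt0 R n.+1 isT.
  apply: filterS3 Ug1 h2 h3 => x; rewrite /U => -> hx x0.
  have [_ _ E] := hN (K (dotp x x)).
  by rewrite /z x0 E//; [exact: KY|exact: hx].
Unshelve. all: by end_near. Qed.

(** The upper limit of difference quotients is defined
    everywhere, is measurable when [z] is ([measurable_seq_derivative]), and is
    the derivative wherever there is one ([seq_derivativeE]). Thus the radial
    derivative has a measurable expression before any regularity is known. *)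
Definition seq_derivative (R : realType) (z : R -> R) (s : R) : R :=
  fine (limn_esup (fun k : nat => ((k.+1)%:R * (z (s + k.+1%:R^-1) - z s))%:E)).

Lemma seq_derivativeE (R : realType) (z : R -> R) (s d : R) :
  is_derive s 1 z d -> seq_derivative z s = d.
Proof.
move=> dz; rewrite /seq_derivative.
have cv : h^-1 *: (z (h *: (1 : R) + s) - z s) @[h --> 0^'] --> d.
  have := @ex_derive _ _ _ _ _ _ _ dz; rewrite /derivable => /cvg_ex[l hl].
  have dl : d = l by rewrite -(@derive_val _ _ _ _ _ _ _ dz); exact: cvg_lim hl.
  by rewrite dl.
have cs : (k.+1%:R^-1 : R) @[k --> \oo] --> (0:R)^'.
  move=> A hA.
  have h : \forall k \near \oo, harmonic k != 0 :> R -> A (harmonic k) := @cvg_harmonic R _ hA.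
  change (\forall k \near \oo, A (k.+1%:R^-1)); apply: filterS h => k; apply.
  by rewrite /harmonic/= invr_neq0// pnatr_eq0.
have cu := cvg_comp _ _ cs cv.
have cE : ((k.+1)%:R * (z (s + k.+1%:R^-1) - z s))%:E @[k --> \oo] --> d%:E.
  apply: cvg_EFin; first by near=> k.
  rewrite (_ : _ \o _ = (fun h => h^-1 *: (z (h *: (1 : R) + s) - z s)) \o (fun k : nat => k.+1%:R^-1)); first exact: cu.
  by apply/funext => k /=; rewrite invrK /GRing.scale/= mulr1 [s + _]addrC.
by rewrite (cvg_limn_einf_sup cE).2.
Unshelve. all: by end_near. Qed.

Lemma measurable_seq_derivative (R : realType) (z : R -> R) :
  measurable_fun [set: measurableTypeR R] z ->
  measurable_fun [set: measurableTypeR R] (seq_derivative z).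
Proof.
move=> mz; apply: measurableT_comp; first exact: fine_measurable.
apply: measurable_fun_limn_esup => k; apply/measurable_EFinP.
apply: measurable_funM => //; apply: measurable_funB => //.
apply: (measurableT_comp mz); exact: measurable_funD.
Qed.

(** The chain rule for the inverse
    [s |-> sg t * sqrt (s - a)] of [t |-> t ^+ 2 + a] near [t]: the
    differentiability of the slice [F] is transferred to [z]. *)
Lemma derivative_of_slice (R : realType) (z F : R -> R) (a t d : R) : 0 <= a -> t != 0 ->
  (forall t : R, t != 0 -> F t = z (t ^+ 2 + a)) ->
  is_derive t 1 F d -> is_derive (t ^+ 2 + a) 1 z (d / (2 * t)).
Proof.
move=> a0 t0 Fz dF.
have t20 : 0 < t ^+ 2 by rewrite exprn_even_gt0.
pose psi (s : R) := Num.sg t * Num.sqrt (s - a).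
have psit : psi (t ^+ 2 + a) = t by rewrite /psi addrK sqrtr_sqr -numEsg.
have dpsi : is_derive (t ^+ 2 + a) 1 psi (1 / (2 * t)).
  have t0' : 0 < t ^+ 2 + a - a by rewrite addrK.
  have h1 := is_derive1_sqrt t0'.
  have h2 : is_derive (t ^+ 2 + a) 1 (fun s : R => s - a) (1 - 0).
    by apply: is_deriveB.
  have h3 := is_deriveZ (Num.sg t) (@is_derive1_comp R Num.sqrt (fun s : R => s - a) (t ^+ 2 + a) _ _ h1 h2).
  have -> : 1 / (2 * t) = Num.sg t *: ((2 * Num.sqrt (t ^+ 2 + a - a))^-1 * (1 - 0)).
    rewrite addrK sqrtr_sqr subr0 mulr1 div1r /GRing.scale/=.
    move: (t0); rewrite neq_lt => /orP[tn|tp]; last by rewrite gtr0_sg ?gtr0_norm// mul1r.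
    by rewrite ltr0_sg ?ltr0_norm// mulN1r mulrN invrN opprK.
  exact: h3.
have dFp : is_derive (t ^+ 2 + a) 1 (F \o psi) (d * (1 / (2 * t))).
  by apply: is_derive1_comp; rewrite psit.
rewrite -[d]mulr1 -mulrA.
apply: near_eq_is_derive dFp.
near=> s => /=.
have sa : a < s by near: s; apply: lt_nbhsr; rewrite ltrDr.
rewrite Fz; last first.
  by rewrite /psi mulf_neq0 ?sgr_eq0// gt_eqF// sqrtr_gt0 subr_gt0.
rewrite /psi exprMn sqr_sg t0 mul1r sqr_sqrtr ?subr_ge0 ?(ltW sa)//.
by rewrite subrK.
Unshelve. all: by end_near. Qed.

Lemma open_continuous_extend_measurable (R : realType) (z : R -> R) :
  (forall s, 0 < s -> {for s, continuous z}) -> (forall s, s <= 0 -> z s = 0) ->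
  measurable_fun [set: measurableTypeR R] z.
Proof.
move=> cz z0.
have -> : z = z \_ `]0, +oo[%classic.
  apply/funext => s; rewrite patchE; case: ifPn => //.
  by rewrite notin_setE/= in_itv/= andbT => /negP; rewrite -leNgt => /z0.
have mI : measurable (`]0, +oo[%classic : set (measurableTypeR R)) by [].
apply/(measurable_restrictT (z : measurableTypeR R -> R) mI).
apply: open_continuous_measurable_fun; first exact: interval_open.
by move=> s; rewrite inE/= in_itv/= andbT; exact: cz.
Qed.

Lemma measurable_eq_set d (T : measurableType d) (R : realType) (f g : T -> R) :
  measurable_fun setT f -> measurable_fun setT g -> measurable [set x | f x = g x].
Proof.
move=> mf mg; rewrite (_ : [set _ | _] = (fun x => f x - g x) @^-1` [set 0]).
  by rewrite -[X in measurable X]setTI; apply: measurable_funB.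
apply/seteqP; split => x /=; first by move=> ->; rewrite subrr.
by move=> /eqP; rewrite subr_eq0 => /eqP.
Qed.

(** On almost every line the slice of [u] is the
    primitive of the partial derivative, hence differentiable at almost every
    point (Lebesgue), and [derivative_of_slice] gives the derivative of [z]
    there. The second part keeps the integral form of the same fact, from which
    the regularity of [z] will be read once its derivative is known to agree
    almost everywhere with a continuous function. *)
Lemma radial_gradient (R : realType) n (r p : R) u G (z : R -> R) : (0 < n)%N -> 0 < r -> 1 < p ->
  W1p0 (@eball R n.+1 r) p u G ->
  (forall s, 0 < s -> {for s, continuous z}) -> (forall s, s <= 0 -> z s = 0) ->
  {ae lebesgue_rV n.+1, forall x, (u \_ (eball r)) x = z (dotp x x)} ->
  (forall i, {ae lebesgue_rV n.+1, forall x,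
    ((fun x => G x ord0 i) \_ (eball r)) x = 2 * x ord0 i * seq_derivative z (dotp x x)}) /\
  {ae lebesgue_rV n, forall y, forall t1 t2 : R, 0 < t1 <= t2 ->
     z (t2 ^+ 2 + dotp y y) - z (t1 ^+ 2 + dotp y y) =
      \int[lebesgue_measure]_(s in `]t1, t2]) ((fun x => G x ord0 ord0) \_ (eball r)) (cons_rV (s, y))}.
Proof.
move=> n0 r0 p1 W cz z0 Uz.
pose U := u \_ (@eball R n.+1 r).
pose g i := (fun x => G x ord0 i) \_ (@eball R n.+1 r).
pose P (i : 'I_n.+1) := @col_perm R 1 n.+1 (tperm ord0 i).
have mz := open_continuous_extend_measurable cz z0.
have mw := measurable_seq_derivative mz.
have slices i : {ae lebesgue_rV n, forall y,
   (@lebesgue_measure R).-integrable setT (fun t => (g i (P i (cons_rV (t, y))))%:E) /\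
   forall t : R, t != 0 ->
     \int[lebesgue_measure]_(s in `]-oo, t]) g i (P i (cons_rV (s, y))) = z (t ^+ 2 + dotp y y)}.
  have h1 := W1p0_slice i r0 p1 W.
  have h2 := ae_slice (ae_col_perm (tperm ord0 i) Uz).
  apply: filterS2 h1 h2 => y [intg h1] h2; split => //.
  have [N [mN N0 hN]] : {ae lebesgue_measure, forall t : measurableTypeR R,
     \int[lebesgue_measure]_(s in `]-oo, t : R]) g i (P i (cons_rV (s, y))) = z ((t : R) ^+ 2 + dotp y y)}.
    by apply: filterS2 h1 h2 => t <- ->; rewrite dotp_col_perm dotp_cons_rV.
  move=> t t0.
  have cF := continuous_indefinite_integral intg.
  apply: (@continuous_ae_eq_right R (fun t => \int[lebesgue_measure]_(s in `]-oo, t : R]) g i (P i (cons_rV (s, y))))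
    (fun t => z (t ^+ 2 + dotp y y)) N t mN N0).
  - exact: cF.
  - apply: (@continuous_comp R R R (fun t : R => t ^+ 2 + dotp y y) z).
      by apply: cvgD; [exact: exprn_continuous|exact: cvg_cst].
    by apply: cz; rewrite ltr_wpDr ?dotp_ge0// exprn_even_gt0.
  - by move=> s _ Ns; apply: contrapT => h; apply: Ns; apply: hN.
split.
  move=> i.
  have mg : measurable_fun setT (g i).
    have [[_ LG _] _] := W.
    by have := LG i; rewrite /Lp inE/= => /andP[]; rewrite inE.
  have PK x : P i (P i x) = x by exact: col_permK_tperm.
  suff : {ae lebesgue_rV n.+1, forall x, g i (P i x) = 2 * (P i x) ord0 i * seq_derivative z (dotp x x)}.
    move=> /(ae_col_perm (tperm ord0 i)); apply: filterS => x.
    by rewrite -/(P i) PK dotp_col_perm.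
  apply: ae_of_slice.
    apply: measurable_eq_set.
      by apply: measurableT_comp => //; exact: rV_perm_measurable.
    apply: measurable_funM.
      apply: measurable_funM => //.
      by apply: (measurableT_comp (measurable_coord i)); exact: rV_perm_measurable.
    by apply: (measurableT_comp mw); exact: dotp_measurableR.
  apply: filterS (slices i) => y [intg Fz].
  have FTC := @FTC1Ny R (fun t => g i (P i (cons_rV (t, y)))) _ _.
  have h0 : {ae lebesgue_measure, forall t : measurableTypeR R, (t : R) != 0}.
    exists [set 0 : R]; split => //; first exact: lebesgue_measure_set1.
    by move=> t /= /negP; rewrite negbK => /eqP.
  apply: filterS2 h0 (FTC _ _).
  - move=> t t0 [dF vF].
    have dF' : is_derive t 1 (fun t => \int[lebesgue_measure]_(s in `]-oo, t]) g i (P i (cons_rV (s, y)))) (g i (P i (cons_rV (t, y)))).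
      by apply: DeriveDef; [exact: dF|rewrite -derive1E; exact: vF].
    have := seq_derivativeE (derivative_of_slice (dotp_ge0 y) t0 Fz dF').
    rewrite dotp_cons_rV => ->.
    rewrite [X in 2 * X]col_permE tpermR cons_rV0.
    by rewrite mulrC divfK// mulf_neq0// pnatr_eq0.
  - by move=> t; apply: integrableS intg.
  - apply: open_integrable_locally => //; exact: openT.
have := slices ord0; rewrite /P tperm1; apply: filterS => y [intg Fz] t1 t2 /andP[t10 t12].
rewrite -!Fz; last 2 first.
- by rewrite gt_eqF.
- by rewrite gt_eqF// (lt_le_trans t10).
rewrite Rintegral_itvB//; last by apply: integrableS intg.
by apply: eq_Rintegral => s _; rewrite col_perm1.
Qed.

(** * Smooth functions *)

(** A sequence of successive derivatives is required, rather than
    a property of iterated derivatives, so that derivatives and primitives of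
    smooth functions are smooth by a shift of the sequence. *)
Definition smooth1 (R : realType) (f : R -> R) :=
  exists2 d : nat -> R -> R, d 0%N = f & forall k (x : R), is_derive x 1 (d k) (d k.+1 x).

Lemma smooth1_primitive (R : realType) (F f : R -> R) :
  smooth1 f -> (forall x : R, is_derive x 1 F (f x)) -> smooth1 F.
Proof.
move=> [d d0 dd] dF; exists (fun k => if k is k'.+1 then d k' else F) => // -[|k] x /=.
  by rewrite d0.
exact: dd.
Qed.

Lemma smooth1_deriv (R : realType) (f : R -> R) : smooth1 f ->
  exists2 g, smooth1 g & forall x : R, is_derive x 1 f (g x).
Proof.
move=> [d <- dd]; exists (d 1%N); last by move=> x; exact: dd.
by exists (fun k => d k.+1).
Qed.

(** [flat 0] is the classical flat function [exp (- 1 / t)], zero for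
    [t <= 0]; the powers of [1 / t] are those that its derivatives produce. *)
Definition flat (R : realType) (k : nat) (t : R) : R :=
  if 0 < t then t^-1 ^+ k * expR (- t^-1) else 0.

Lemma flat_ge0 (R : realType) k (t : R) : 0 <= flat k t.
Proof. by rewrite /flat; case: ltP => // t0; rewrite mulr_ge0 ?expR_ge0// exprn_ge0// invr_ge0 ltW. Qed.

(** [exp (1 / t)] dominates each term of its power series; the
    bound gives the derivative at 0. *)
Lemma flat_le (R : realType) k (t : R) : flat k t <= k.+1`!%:R * `|t|.
Proof.
rewrite /flat; case: ltP => [t0|_]; last by rewrite mulr_ge0.
rewrite gtr0_norm// expRN ler_pdivrMr ?expR_gt0//.
have F0 : 0 < k.+1`!%:R :> R by rewrite ltr0n fact_gt0.
have h : t^-1 ^+ k.+1 / k.+1`!%:R <= expR t^-1.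
  by apply: le_trans (expR_ge1Dxn k _); rewrite ?lerDr// invr_ge0 ltW.
rewrite -mulrA; apply: (@le_trans _ _ (k.+1`!%:R * (t * (t^-1 ^+ k.+1 / k.+1`!%:R)))).
  by rewrite mulrCA [_ * (_ / _)]mulrCA divff ?gt_eqF// mulr1 exprS mulrA divff ?gt_eqF// mul1r.
by rewrite ler_pM2l// ler_pM2l.
Qed.

Lemma is_derive_flat (R : realType) k (t : R) :
  is_derive t 1 (@flat R k) (- k%:R * flat k.+1 t + flat k.+2 t).
Proof.
have [t0|t0|->] := ltgtP t 0.
- have -> : - k%:R * flat k.+1 t + flat k.+2 t = 0.
    by rewrite /flat ltNge (ltW t0)/= mulr0 addr0.
  apply: near_eq_is_derive (is_derive_cst (0 : R) t 1).
  near=> s; rewrite /flat ltNge ifN//; apply/negPn/ltW; near: s; exact: lt_nbhsl.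
- have h1 : is_derive t 1 (fun s : R => s^-1) (- t ^- 2 *: 1).
    by apply: is_deriveV; rewrite gt_eqF.
  have h2 : is_derive t 1 (fun s : R => s^-1 ^+ k) ((k%:R * t^-1 ^+ k.-1) *: (- t ^- 2 *: 1)).
    by have := is_deriveX k h1; rewrite exprfctE.
  have h3 : is_derive t 1 (fun s : R => expR (- s^-1)) (expR (- t^-1) * (- (- t ^- 2 *: 1))).
    exact: (@is_derive1_comp R expR (fun s : R => - s^-1) t _ _ (is_derive_expR _) (is_deriveN h1)).
  have h4 := is_deriveM h2 h3.
  have -> : - k%:R * flat k.+1 t + flat k.+2 t =
     t^-1 ^+ k *: (expR (- t^-1) * (- (- t ^- 2 *: 1))) + expR (- t^-1) *: ((k%:R * t^-1 ^+ k.-1) *: (- t ^- 2 *: 1)).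
    rewrite /flat t0 /GRing.scale/= !mulr1 -!exprVn.
    case: k {h2 h4} => [|k] /=; rewrite ?exprS; ring.
  apply: near_eq_is_derive h4.
  by near=> s; rewrite /flat ifT//; near: s; exact: lt_nbhsr.
- have -> : - k%:R * flat k.+1 0 + flat k.+2 0 = 0 :> R.
    by rewrite /flat ltxx mulr0 addr0.
  have cv : h^-1 *: (flat k (h *: (1:R) + (0 : R)) - flat k 0) @[h --> (0:R)^'] --> (0:R).
    apply/cvgrPdist_lt => e e0.
    have F0 : 0 < k.+2`!%:R :> R by rewrite ltr0n fact_gt0.
    near=> h.
    have h0 : h != 0 by near: h; exact: nbhs_dnbhs_neq.
    rewrite {2}/flat ltxx subr0 addr0 sub0r normrN /GRing.scale/= mulr1.
    have -> : h^-1 * flat k h = flat k.+1 h.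
      by rewrite /flat; case: ifP => _; rewrite ?mulr0// mulrA exprS.
    rewrite ger0_norm ?flat_ge0// (le_lt_trans (flat_le _ _))//.
    rewrite mulrC -ltr_pdivlMr//.
    near: h; apply: dnbhs0_lt; rewrite divr_gt0//.
  apply: DeriveDef; first by apply/cvg_ex; exists 0.
  exact: cvg_lim cv.
Unshelve. all: by end_near. Qed.

(** A syntactic class closed under differentiation, so that
    smoothness of its members needs no computation of higher derivatives. *)
Inductive elementary (R : realType) : (R -> R) -> Prop :=
| elementary_cst c : elementary (fun=> c)
| elementary_id : elementary id
| elementary_add f g : elementary f -> elementary g -> elementary (fun x => f x + g x)
| elementary_mul f g : elementary f -> elementary g -> elementary (fun x => f x * g x)
| elementary_flat k f : elementary f -> elementary (fun x => flat k (f x)).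

Lemma elementary_deriv (R : realType) (f : R -> R) : elementary f ->
  exists2 g, elementary g & forall x : R, is_derive x 1 f (g x).
Proof.
elim => {f} [c| |f g _ [f' ef' df] _ [g' eg' dg]|f g ef [f' ef' df] eg [g' eg' dg]|k f ef [f' ef' df]].
- exists (fun=> 0); first exact: elementary_cst.
  by move=> x; exact: is_derive_cst.
- exists (fun=> 1); first exact: elementary_cst.
  by move=> x; exact: is_derive_id.
- exists (fun x => f' x + g' x); first exact: elementary_add.
  by move=> x; have := is_deriveD (df x) (dg x).
- exists (fun x => f x * g' x + g x * f' x).
    by apply: elementary_add; apply: elementary_mul.
  by move=> x; have := is_deriveM (df x) (dg x).
- exists (fun x => (- k%:R * flat k.+1 (f x) + flat k.+2 (f x)) * f' x).
    apply: elementary_mul => //; apply: elementary_add; last exact: elementary_flat.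
    by apply: elementary_mul; [exact: elementary_cst|exact: elementary_flat].
  by move=> x; exact: (is_derive1_comp (is_derive_flat k (f x)) (df x)).
Qed.

Lemma elementary_smooth1 (R : realType) (f : R -> R) : elementary f -> smooth1 f.
Proof.
move=> ef.
pose T := {f : R -> R | elementary f}.
have /choice[D hD] : forall f : T, exists g : T, forall x : R, is_derive x 1 (sval f) (sval g x).
  by move=> [g eg]; have [g' eg' dg] := elementary_deriv eg; exists (exist _ g' eg').
exists (fun k => sval (iter k D (exist _ f ef))) => // k x /=; exact: hD.
Qed.

(** The analogue of [elementary] in several variables, for
    [partial] instead of the derivative. *)
Inductive smooth_expr (R : realType) n : ('rV[R]_n -> R) -> Prop :=
| smooth_expr_cst c : smooth_expr (fun=> c)
| smooth_expr_coord i : smooth_expr (fun x => x ord0 i)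
| smooth_expr_add f g : smooth_expr f -> smooth_expr g -> smooth_expr (fun x => f x + g x)
| smooth_expr_mul f g : smooth_expr f -> smooth_expr g -> smooth_expr (fun x => f x * g x)
| smooth_expr_comp h f : smooth1 h -> smooth_expr f -> smooth_expr (fun x => h (f x)).

Lemma is_derive_differentiable (R : realType) (f : R -> R) (x d : R) :
  is_derive x 1 f d -> differentiable f x.
Proof. by move=> h; apply/derivable1_diffP; exact: ex_derive. Qed.

Lemma partial_comp (R : realType) n (h : R -> R) (f : 'rV[R]_n -> R) x i d :
  is_derive (f x) 1 h d -> differentiable f x ->
  partial i (h \o f) x = d * partial i f x.
Proof.
move=> dh df; have dh' := is_derive_differentiable dh.
rewrite /partial deriveE; last exact: differentiable_comp.
rewrite diff_comp//= deriveE// diff1E//= derive1E derive_val /GRing.scale/= mulrC.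
by [].
Qed.

Lemma partial_coord (R : realType) n (i j : 'I_n) (x : 'rV[R]_n) :
  partial i (fun x : 'rV[R]_n => x ord0 j) x = (j == i)%:R.
Proof.
rewrite /partial /derive; apply: cvg_lim => //.
apply: cvg_near_cst; near=> h.
have h0 : h != 0 by near: h; exact: nbhs_dnbhs_neq.
by rewrite /= !mxE eqxx/= addrK /GRing.scale/= mulrA mulVf// mul1r.
Unshelve. all: by end_near. Qed.

Lemma smooth_expr_partial (R : realType) n (f : 'rV[R]_n -> R) : smooth_expr f ->
  (forall x, differentiable f x) /\ forall i, smooth_expr (partial i f).
Proof.
elim => {f} [c|j|f g _ [df ef] _ [dg eg]|f g sf [df ef] sg [dg eg]|h f sh sf [df ef]].
- split; first by move=> x; exact: differentiable_cst.
  move=> i; rewrite (_ : partial i _ = fun=> 0); first exact: smooth_expr_cst.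
  by apply/funext => x; rewrite /partial derive_cst.
- split; first by move=> x; exact: differentiable_coord.
  move=> i; rewrite (_ : partial i _ = fun=> (j == i)%:R); first exact: smooth_expr_cst.
  by apply/funext => x; rewrite partial_coord.
- split; first by move=> x; exact: differentiableD.
  move=> i; rewrite (_ : partial i _ = fun x => partial i f x + partial i g x).
    exact: smooth_expr_add.
  by apply/funext => x; rewrite /partial [LHS]deriveD//; exact: diff_derivable.
- split; first by move=> x; exact: differentiableM.
  move=> i; rewrite (_ : partial i _ = fun x => f x * partial i g x + g x * partial i f x).
    by apply: smooth_expr_add; exact: smooth_expr_mul.
  by apply/funext => x; rewrite /partial [LHS]deriveM//; exact: diff_derivable.
- have [h' sh' dh] := smooth1_deriv sh; split.
    move=> x; apply: differentiable_comp => //; exact: is_derive_differentiable (dh _).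
  move=> i; rewrite (_ : partial i _ = fun x => h' (f x) * partial i f x).
    by apply: smooth_expr_mul => //; exact: smooth_expr_comp.
  by apply/funext => x; rewrite (partial_comp i (dh _)).
Qed.

Lemma smooth_expr_smooth (R : realType) n (f : 'rV[R]_n -> R) : smooth_expr f -> smooth f.
Proof.
move=> ef s x; suff : smooth_expr (foldr partial f s) by move=> /smooth_expr_partial[].
by elim: s => //= i s ih; have [_] := smooth_expr_partial ih.
Qed.

Lemma smooth_expr_dotp (R : realType) n : smooth_expr (fun x : 'rV[R]_n => dotp x x).
Proof.
have h (m : nat) (hm : (m <= n)%N) : smooth_expr (fun x : 'rV[R]_n => \sum_(i < m) x ord0 (widen_ord hm i) * x ord0 (widen_ord hm i)).
  elim: m hm => [|m ih] hm.
    rewrite (_ : (fun _ => _) = fun=> 0); first exact: smooth_expr_cst.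
    by apply/funext => x; rewrite big_ord0.
  rewrite (_ : (fun _ => _) = fun x : 'rV[R]_n => \sum_(i < m) x ord0 (widen_ord (ltnW hm) i) * x ord0 (widen_ord (ltnW hm) i) + x ord0 (widen_ord hm ord_max) * x ord0 (widen_ord hm ord_max)).
    apply: smooth_expr_add => //; apply: smooth_expr_mul; exact: smooth_expr_coord.
  apply/funext => x; rewrite big_ord_recr/=; congr (_ + _).
  by apply: eq_bigr => i _; congr (x _ _ * x _ _); exact: val_inj.
rewrite (_ : (fun _ => _) = fun x : 'rV[R]_n => \sum_(i < n) x ord0 (widen_ord (leqnn n) i) * x ord0 (widen_ord (leqnn n) i)) //.
by apply/funext => x; apply: eq_bigr => i _; congr (x _ _ * x _ _); exact: val_inj.
Qed.

Lemma partial_dotp (R : realType) n (i : 'I_n) x : partial i (fun x : 'rV[R]_n => dotp x x) x = 2 * x ord0 i.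
Proof.
rewrite (_ : (fun x : 'rV[R]_n => dotp x x) = \sum_(j < n) (fun x : 'rV[R]_n => x ord0 j * x ord0 j)); last first.
  by apply/funext => y; rewrite fct_sumE.
have dc (j : 'I_n) : derivable (fun x : 'rV[R]_n => x ord0 j) x (delta_mx ord0 i).
  by apply: diff_derivable; exact: differentiable_coord.
rewrite /partial derive_sum; last first.
  by move=> j; apply: (@derivableM _ _ (fun x : 'rV[R]_n => x ord0 j) (fun x => x ord0 j)).
rewrite (eq_bigr (fun j => x ord0 j * (j == i)%:R + x ord0 j * (j == i)%:R)); last first.
  move=> j _; rewrite (@deriveM _ _ (fun x : 'rV[R]_n => x ord0 j) (fun x => x ord0 j))//.
  by rewrite -/(partial i (fun x : 'rV[R]_n => x ord0 j) x) partial_coord.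
rewrite (bigD1 i)//= eqxx big1 ?addr0; last by move=> j /negbTE ->; rewrite mulr0 addr0.
by rewrite mulr1 mulr_natl mulr2n.
Qed.

(** * Radial test functions *)

(** The constant sequence approximates the function; what
    has to be checked is that its classical gradient is a weak gradient and
    that everything is in L^p. *)
Lemma test_fun_W1p0 (R : realType) n (r p : R) (h : 'rV[R]_n.+1 -> R) :
  0 < r -> 1 < p -> test_fun (eball r) h ->
  W1p0 (eball r) p h (fun x => \row_i partial i h x).
Proof.
move=> r0 p1 th; have Ch := test_fun_C1c th; have [dh ch _] := Ch.
have [_ _ hD] := th.
have off x : ~ eball r x -> h x = 0 /\ forall i, partial i h x = 0.
  move=> Dx; have Kx : ~ closure [set x | h x != 0] x by move=> /hD.
  split; last by move=> i; exact: partial_notin_support.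
  by apply/eqP/negPn/negP => fy; apply: Kx; exact: subset_closure.
have p0 : 0 < p by exact: lt_trans p1.
have LpC (f : 'rV[R]_n.+1 -> R) : continuous f -> (exists M, forall x, M <= `|x| -> f x = 0) ->
    (forall x, ~ eball r x -> f x = 0) -> Lp (eball r) p f.
  move=> cf [M fM] fD; rewrite /Lp.
  have -> : f \_ (eball r) = f.
    by apply/funext => x; rewrite patchE; case: ifPn => //; rewrite notin_setE => /fD.
  rewrite inE; apply/andP; split; rewrite inE; first exact: rV_continuous_measurable.
  rewrite /= /finite_norm unlock poweR_lty//.
  have : (lebesgue_rV n.+1).-integrable setT (EFin \o (fun x => `|f x| `^ p)).
    apply: bounded_support_integrable.
      move=> x; apply: (@continuous_comp _ _ _ f (fun y : R => `|y| `^ p)); first exact: cf.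
      exact/powabs_continuous/ltW.
    by exists M => x /fM ->; rewrite normr0 powR0// gt_eqF.
  move=> /integrableP[_]; apply: le_lt_trans; rewrite le_eqVlt; apply/orP; left; apply/eqP.
  apply: eq_integral => x _; rewrite /comp [RHS]gee0_abs ?lee_fin ?powR_ge0//.
have cvg0 (f g : 'rV[R]_n.+1 -> R) : f = g -> Lp_cvg (eball r) p (fun=> f) g.
  move=> ->; rewrite /Lp_cvg.
  rewrite (_ : (fun _ => _) = cst 0%E); first exact: cvg_cst.
  apply/funext => k; rewrite -(@Lnorm0 _ _ _ (lebesgue_rV n.+1) p%:E); last by rewrite eqe gt_eqF.
  by apply: eq_Lnorm => x /=; rewrite patchE; case: ifP => // _; rewrite /= subrr.
have rowE i : (fun x => (\row_j partial j h x) ord0 i) = partial i h.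
  by apply/funext => x; rewrite mxE.
have [M hM] := C1c_bounded Ch.
split; first split.
- apply: LpC; first by move=> x; exact: differentiable_continuous.
    by exists M => x /hM[].
  by move=> x /off[].
- move=> i; rewrite rowE; apply: LpC => //.
    by exists M => x /hM[].
  by move=> x /off[].
- exact: C1c_weak_gradient.
- exists (fun=> h); split => //; first exact: cvg0.
  by move=> i; apply: cvg0; rewrite rowE.
Qed.

(** The support of [rho] may contain 0 and negative
    numbers, but must stay below [r ^+ 2], so that the composition is supported
    in a smaller closed ball. *)
Lemma radial_test_fun (R : realType) n (r lo hi : R) (rho : R -> R) :
  0 < r -> hi < r ^+ 2 -> smooth1 rho ->
  (forall s, ~~ (lo <= s <= hi) -> rho s = 0) ->
  test_fun (@eball R n r) (fun x => rho (dotp x x)).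
Proof.
move=> r0 hir srho rho0.
have sdot := smooth_expr_dotp R n.
have cdot : continuous (fun x : 'rV[R]_n => dotp x x).
  by move=> x; apply: differentiable_continuous; have [+ _] := smooth_expr_partial sdot; exact.
have clA : closed [set x : 'rV[R]_n | dotp x x <= hi].
  rewrite (_ : [set _ | _] = (fun x : 'rV[R]_n => dotp x x) @^-1` [set s | s <= hi])//.
  by apply: closed_comp => [x _|]; [exact: cdot|exact: closed_le].
have sub : closure [set x : 'rV[R]_n | rho (dotp x x) != 0] `<=` [set x : 'rV[R]_n | dotp x x <= hi].
  rewrite {1}(closure_id [set x : 'rV[R]_n | dotp x x <= hi]).1//; apply: closure_subset => x /=.
  by apply: contraNT => h; apply/eqP/rho0; rewrite negb_and h orbT.
split.
- by apply: smooth_expr_smooth; apply: smooth_expr_comp.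
- apply: (@subclosed_compact _ _ [set x : 'rV[R]_n | forall i, `[- r, r]%classic (x ord0 i)]).
  + exact: closed_closure.
  + by apply: (@rV_compact _ _ (fun=> `[- r, r]%classic)) => _; exact: segment_compact.
  + move=> x /sub /= xhi i; rewrite in_itv/= -ler_norml -(@ler_pXn2r _ 2)// ?nnegrE// ?(ltW r0)//.
    rewrite real_normK ?num_real// (le_trans (dotp_coord_le _ _))// (le_trans xhi)//.
    exact: ltW.
- by move=> x /sub /= xhi; rewrite eballE//= (le_lt_trans xhi).
Qed.

Lemma partial_radial (R : realType) n (rho : R -> R) (d : R) i (x : 'rV[R]_n) :
  is_derive (dotp x x) 1 rho d ->
  partial i (fun x => rho (dotp x x)) x = d * (2 * x ord0 i).
Proof.
move=> dr.
rewrite (@partial_comp R n rho (fun x : 'rV[R]_n => dotp x x) x i d dr); first by rewrite partial_dotp.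
by have [+ _] := smooth_expr_partial (smooth_expr_dotp R n); exact.
Qed.

(** Supported in [`[a, b]] and increasing to the indicator function of
    [`]a, b[] when [m] tends to infinity ([bump_cvg]). *)
Definition bump (R : realType) (m : nat) (a b s : R) : R :=
  flat 0 (m.+1%:R * (s - a)) * flat 0 (m.+1%:R * (b - s)).

Lemma elementary_bump (R : realType) m (a b : R) : elementary (bump m a b).
Proof.
have lin (c d : R) : elementary (fun s => c * s + d).
  apply: elementary_add; last exact: elementary_cst.
  by apply: elementary_mul; [exact: elementary_cst|exact: elementary_id].
rewrite (_ : bump m a b = fun s => flat 0 (m.+1%:R * s + - m.+1%:R * a) * flat 0 (- m.+1%:R * s + m.+1%:R * b)).
  by apply: elementary_mul; apply: elementary_flat.
by apply/funext => s; rewrite /bump; congr (flat _ _ * flat _ _); ring.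
Qed.

Lemma flat0_le1 (R : realType) (t : R) : flat 0 t <= 1.
Proof.
rewrite /flat expr0 mul1r; case: ltP => // t0.
by rewrite -[leRHS]expR0 ler_expR oppr_le0 invr_ge0 ltW.
Qed.

Lemma flat0_gt0 (R : realType) (t : R) : 0 < t -> 0 < flat 0 t.
Proof. by rewrite /flat expr0 mul1r => ->; exact: expR_gt0. Qed.

Lemma bump_ge0 (R : realType) m (a b s : R) : 0 <= bump m a b s.
Proof. by rewrite mulr_ge0 ?flat_ge0. Qed.

Lemma bump_le1 (R : realType) m (a b s : R) : bump m a b s <= 1.
Proof. by rewrite -[leRHS]mulr1 ler_pM ?flat_ge0 ?flat0_le1. Qed.

Lemma bump_gt0 (R : realType) m (a b s : R) : a < s < b -> 0 < bump m a b s.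
Proof. by move=> /andP[as_ sb]; rewrite mulr_gt0// flat0_gt0// mulr_gt0// subr_gt0. Qed.

Lemma bump_out (R : realType) m (a b s : R) : ~~ (a < s < b) -> bump m a b s = 0.
Proof.
rewrite negb_and -!leNgt /bump /flat => /orP[h|h].
  by rewrite ltNge mulr_ge0_le0 ?subr_le0// mul0r.
by rewrite [X in _ * X]ifN ?mulr0// -leNgt mulr_ge0_le0 ?subr_le0.
Qed.

Lemma flat0_cvg (R : realType) (t : R) : 0 < t ->
  flat 0 (m.+1%:R * t) @[m --> \oo] --> (1 : R).
Proof.
move=> t0.
rewrite (_ : (fun _ => _) = fun m => expR (- (t^-1 * m.+1%:R^-1))).
  have c0 : (- (t^-1 * m.+1%:R^-1)) @[m --> \oo] --> (0 : R); last first.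
    have := continuous_cvg _ (@continuous_expR R 0) c0; rewrite expR0; exact.
  rewrite -oppr0; apply: cvgN; rewrite -(mulr0 t^-1); apply: cvgMr; exact: cvg_harmonic.
by apply/funext => m; rewrite /flat expr0 mul1r mulr_gt0// invfM mulrC.
Qed.

Lemma bump_cvg (R : realType) (a b s : R) : a < s < b ->
  bump m a b s @[m --> \oo] --> (1 : R).
Proof.
move=> /andP[as_ sb]; rewrite -[X in _ --> X]mulr1.
by apply: cvgM; apply: flat0_cvg; rewrite subr_gt0.
Qed.

Lemma bump_continuous (R : realType) m (a b : R) : continuous (bump m a b).
Proof.
move=> s; have [g _ dg] := elementary_deriv (elementary_bump m a b).
by apply: differentiable_continuous; apply: is_derive_differentiable (dg s).
Qed.

Lemma bump_integrable (R : realType) m (a b : R) :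
  (@lebesgue_measure R).-integrable setT (EFin \o bump m a b).
Proof.
have -> : EFin \o bump m a b = (EFin \o bump m a b) \_ `[a, b].
  apply/funext => t; rewrite patchE; case: ifPn => //.
  rewrite notin_setE/= in_itv/= => /negP h; rewrite /= bump_out//.
  by apply: contra h => /andP[/ltW -> /ltW].
rewrite -integrable_mkcond//; apply: continuous_compact_integrable => //.
  exact: segment_compact.
apply: continuous_subspaceT; exact: bump_continuous.
Qed.

Lemma bump_integral_gt0 (R : realType) m (a b : R) : a < b ->
  0 < \int[lebesgue_measure]_s bump m a b s.
Proof.
move=> ab; apply: fine_gt0; apply/andP; split; last first.
  have := integrable_fin_num (@measurableT _ (measurableTypeR R)) (bump_integrable m a b).
  by rewrite ge0_fin_numE// integral_ge0// => s _; rewrite lee_fin bump_ge0.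
rewrite lt_neqAle integral_ge0 ?andbT; last by move=> s _; rewrite lee_fin bump_ge0.
apply/negP => /eqP/esym.
have mb : measurable_fun [set: measurableTypeR R] (EFin \o bump m a b).
  exact: measurable_int (bump_integrable m a b).
move=> /(ge0_integral_eq0_ae _ mb) => h.
have [N [mN N0 hN]] := h (fun x => bump_ge0 _ _ _ _).
have [|s [as_ sb Ns]] := null_dense_right a mN N0 (_ : 0 < b - a); first by rewrite subr_gt0.
apply: Ns; apply: hN => /= -[]; apply/eqP; rewrite gt_eqF// bump_gt0// as_/=.
by rewrite (lt_le_trans sb)// addrC subrK.
Qed.

Lemma is_derive_indefinite_integral (R : realType) (f : R -> R) (s : R) :
  (@lebesgue_measure R).-integrable setT (EFin \o f) -> {for s, continuous f} ->
  is_derive s 1 (fun s => \int[lebesgue_measure]_(t in `]-oo, s]) f t) (f s).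
Proof.
move=> intf cf; set F := (X in is_derive _ _ X _).
have [dr vr] : derivable F s 1 /\ F^`()%classic s = f s.
  apply: (@continuous_FTC1 R f -oo%O s (s + 1)) => //; first by rewrite ltrDl.
    by apply: integrableS intf.
  by rewrite ltNyr.
by apply: DeriveDef; [exact: dr|rewrite -derive1E; exact: vr].
Qed.

(** A difference of two bumps, balanced so as to
    have integral zero, is the derivative of a smooth function of compact
    support: these are the test functions of the du Bois-Reymond lemma. *)
Lemma bump_difference_primitive (R : realType) (m : nat) (lo hi a b a' b' : R) :
  lo <= a -> b <= hi -> lo <= a' -> b' <= hi -> a' < b' ->
  let k := \int[lebesgue_measure]_s bump m a b s / \int[lebesgue_measure]_s bump 0 a' b' s in
  exists rho : R -> R, [/\ smooth1 rho,
    forall s : R, is_derive s 1 rho (bump m a b s - k * bump 0 a' b' s) &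
    forall s, ~~ (lo <= s <= hi) -> rho s = 0].
Proof.
move=> loa bhi loa' b'hi a'b' k.
pose f s := bump m a b s - k * bump 0 a' b' s.
have ef : elementary f.
  rewrite (_ : f = fun s => bump m a b s + (- k) * bump 0 a' b' s).
    apply: elementary_add; first exact: elementary_bump.
    by apply: elementary_mul; [exact: elementary_cst|exact: elementary_bump].
  by apply/funext => s; rewrite /f mulNr.
have intf : (@lebesgue_measure R).-integrable setT (EFin \o f).
  rewrite (_ : EFin \o f = ((EFin \o bump m a b) \- (fun s => k%:E * (bump 0 a' b' s)%:E))%E).
    apply: integrableB => //; first exact: bump_integrable.
    by apply: integrableZl => //; exact: bump_integrable.
  by apply/funext => s /=; rewrite EFinB EFinM.
have cf : continuous f.
  move=> s; have [g _ dg] := elementary_deriv ef.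
  by apply: differentiable_continuous; apply: is_derive_differentiable (dg s).
have f0 s : ~~ (lo <= s <= hi) -> f s = 0.
  move=> h; rewrite /f !bump_out ?mulr0 ?subrr//.
    apply: contra h => /andP[h1 h2]; rewrite (le_trans loa' (ltW h1))/=.
    exact: le_trans (ltW h2) b'hi.
  apply: contra h => /andP[h1 h2]; rewrite (le_trans loa (ltW h1))/=.
  exact: le_trans (ltW h2) bhi.
have If : \int[lebesgue_measure]_s f s = 0.
  rewrite /f RintegralB//; last 2 first.
  - exact: bump_integrable.
  - rewrite (_ : EFin \o _ = fun s => k%:E * (bump 0 a' b' s)%:E)%E.
      by apply: integrableZl => //; exact: bump_integrable.
    by apply/funext => s /=; rewrite EFinM.
  rewrite RintegralZl//; last exact: bump_integrable.
  by rewrite /k divfK ?subrr// gt_eqF// bump_integral_gt0.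
pose rho s := \int[lebesgue_measure]_(t in `]-oo, s]) f t.
have drho (s : R) : is_derive s 1 rho (f s).
  exact: (is_derive_indefinite_integral intf (cf s)).
exists rho; split => //.
  by apply: smooth1_primitive drho; exact: elementary_smooth1.
move=> s; rewrite negb_and -!ltNge => /orP[slo|his].
  rewrite /rho /Rintegral integral0_eq// => t; rewrite /= in_itv/= => ts.
  by rewrite f0// negb_and -ltNge (le_lt_trans ts slo).
rewrite -If /rho [LHS]Rintegral_mkcond [RHS]Rintegral_mkcond.
apply: eq_Rintegral => t _; rewrite !patchE in_setT; case: ifPn => //.
rewrite notin_setE /= in_itv/= => /negP; rewrite -ltNge => ht.
by rewrite f0// negb_and -[X in _ || X]ltNge (lt_trans his ht) orbT.
Qed.

(** * The weak equation in the squared radius *)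

(** The nonlinearity [|x|^(e-2) x] of the equation, that is, the
    derivative of [|x|^e / e]. *)
Definition sgpow (R : realType) (e x : R) : R := `|x| `^ (e - 2) * x.

Lemma measurable_sgpow (R : realType) (e : R) :
  measurable_fun [set: measurableTypeR R] (@sgpow R e).
Proof.
apply: measurable_funM => //; apply: (measurableT_comp (measurable_powR _)).
exact: normr_measurable.
Qed.

(** The density of the law of the squared radius, see
    [ge0_integral_radial]. *)
Definition radial_density (R : realType) (n : nat) (s : R) : R :=
  unit_volume R n * (n%:R / 2) * s `^ (n%:R / 2 - 1).

Lemma radial_density_ge0 (R : realType) n (s : R) : 0 <= radial_density n s.
Proof. by rewrite mulr_ge0 ?powR_ge0// mulr_ge0// ltW// unit_volume_gt0. Qed.

Lemma measurable_radial_density (R : realType) n :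
  measurable_fun [set: measurableTypeR R] (@radial_density R n).
Proof. by apply: measurable_funM => //; exact: measurable_powR. Qed.

Lemma Rintegral_radial (R : realType) (n : nat) (f : measurableTypeR R -> R) :
  (1 < n)%N -> measurable_fun setT f ->
  \int[lebesgue_rV n]_x f (dotp x x) =
  \int[lebesgue_measure]_(s in `]0, +oo[) (f s * radial_density n s).
Proof.
move=> n1 mf; rewrite /Rintegral; congr fine.
have mI : measurable (`]0, +oo[%classic : set (measurableTypeR R)) by [].
rewrite integralE [RHS]integralE; congr (_ - _)%E.
- transitivity (\int[lebesgue_rV n]_x ((EFin \o f)^\+)%E (dotp x x))%E.
    by apply: eq_integral => x _; rewrite !funeposE.
  rewrite (@ge0_integral_radial _ _ (EFin \o f)^\+%E)//; last first.
    by apply: measurable_funepos; exact/measurable_EFinP.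
  apply: eq_integral => s _.
  rewrite !funeposE EFinM maxe_pMl ?mul0e// lee_fin; exact: radial_density_ge0.
- transitivity (\int[lebesgue_rV n]_x ((EFin \o f)^\-)%E (dotp x x))%E.
    by apply: eq_integral => x _; rewrite !funenegE.
  rewrite (@ge0_integral_radial _ _ (EFin \o f)^\-%E)//; last first.
    by apply: measurable_funeneg; exact/measurable_EFinP.
  apply: eq_integral => s _.
  rewrite !funenegE /comp -EFinN -[in RHS]EFinN -mulNr [in RHS]EFinM maxe_pMl ?mul0e// lee_fin; exact: radial_density_ge0.
Qed.

Lemma ae_eq_Rintegral d (T : measurableType d) (R : realType)
    (mu : {measure set T -> \bar R}) (f g : T -> R) :
  measurable_fun setT f -> measurable_fun setT g ->
  {ae mu, forall x, f x = g x} -> \int[mu]_x f x = \int[mu]_x g x.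
Proof.
move=> mf mg fg; rewrite /Rintegral; congr fine.
apply: ae_eq_integral => //; try exact/measurable_EFinP.
by apply: filterS fg => x fgx _ /=; rewrite fgx.
Qed.

Section radial_weak_equation.
Context (R : realType) (n : nat) (p r mu : R).
Context (u : 'rV[R]_n.+1 -> R) (G : 'rV[R]_n.+1 -> 'rV[R]_n.+1) (z w : R -> R).
Hypotheses (n0 : (0 < n)%N) (p1 : 1 < p) (r0 : 0 < r).
Hypothesis (usol : weak_solution (eball r) p mu u G).
Hypothesis mz : measurable_fun [set: measurableTypeR R] z.
Hypothesis mw : measurable_fun [set: measurableTypeR R] w.
Hypothesis uz : {ae lebesgue_rV n.+1, forall x, (u \_ (eball r)) x = z (dotp x x)}.
Hypothesis Gw : forall i, {ae lebesgue_rV n.+1, forall x,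
    ((fun x => G x ord0 i) \_ (eball r)) x = 2 * x ord0 i * w (dotp x x)}.

(** If [w] is the derivative of [z], this is the derivative of
    [t |-> z (t ^+ 2)] at [t = sqrt s], that is, the radial derivative. *)
Definition slope (w : R -> R) (s : R) : R := 2 * Num.sqrt s * w s.

Lemma measurable_slope : measurable_fun [set: measurableTypeR R] (slope w).
Proof.
apply: measurable_funM => //; apply: measurable_funM => //.
by apply: continuous_measurable_fun; exact: sqrt_continuous.
Qed.

Lemma ae_gradient : {ae lebesgue_rV n.+1, forall x i,
    ((fun x => G x ord0 i) \_ (eball r)) x = 2 * x ord0 i * w (dotp x x)}.
Proof.
have H : {ae lebesgue_rV n.+1, forall x, forall k, (fun k x => forall i : 'I_n.+1, (i : nat) = k ->
   ((fun x => G x ord0 i) \_ (eball r)) x = 2 * x ord0 i * w (dotp x x)) k x}.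
  apply: ae_foralln => k.
  have [kn|nk] := ltnP k n.+1; last first.
    by apply: aeW => x i ik; move: (ltn_ord i); rewrite ik ltnNge nk.
  apply: filterS (Gw (Ordinal kn)) => x hx i ik.
  by rewrite (_ : i = Ordinal kn)//; exact: val_inj.
by apply: filterS H => x hx i; exact: (hx i i).
Qed.

Lemma enorm_radial (x : 'rV[R]_n.+1) (y : 'rV[R]_n.+1) :
  (forall i, y ord0 i = 2 * x ord0 i * w (dotp x x)) ->
  enorm y = `|slope w (dotp x x)|.
Proof.
move=> h; rewrite /enorm.
have -> : dotp y y = slope w (dotp x x) ^+ 2.
  rewrite /slope !exprMn sqr_sqrtr ?dotp_ge0// {1 3}/dotp mulr_sumr mulr_suml.
  by apply: eq_bigr => i _; rewrite h; ring.
by rewrite sqrtr_sqr.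
Qed.

(** Both gradients are multiples of [x], so that
    their scalar product is again a function of [dotp x x], and
    [Rintegral_radial] applies to the two sides. *)
Lemma radial_weak_equation (lo hi : R) (rho rho' : R -> R) :
  hi < r ^+ 2 -> smooth1 rho -> (forall s : R, is_derive s 1 rho (rho' s)) ->
  continuous rho' ->
  (forall s, ~~ (lo <= s <= hi) -> rho s = 0 /\ rho' s = 0) ->
  \int[lebesgue_measure]_(s in `]0, +oo[)
     (2 * Num.sqrt s * sgpow p (slope w s) * rho' s * radial_density n.+1 s) =
  mu * \int[lebesgue_measure]_(s in `]0, +oo[)
     (sgpow (critical_exponent (n := n.+1) p) (z s) * rho s * radial_density n.+1 s).
Proof.
move=> hir srho drho crho' rho0.
have crho : continuous rho.
  by move=> s; apply: differentiable_continuous; apply: is_derive_differentiable (drho s).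
have mrho : measurable_fun [set: measurableTypeR R] rho by exact: continuous_measurable_fun.
have mrho' : measurable_fun [set: measurableTypeR R] rho' by exact: continuous_measurable_fun.
have th := @radial_test_fun _ n.+1 _ _ _ _ r0 hir srho (fun s hs => (rho0 s hs).1).
have [[[Lu LG _] _] eqn] := usol.
have {eqn} := eqn _ _ (test_fun_W1p0 r0 p1 th).
have mD := @measurable_eball R n.+1 r r0.
have mU : measurable_fun setT (u \_ (eball r)).
  by move: Lu; rewrite /Lp inE/= => /andP[]; rewrite inE.
have mG i : measurable_fun setT ((fun x => G x ord0 i) \_ (eball r)).
  by have := LG i; rewrite /Lp inE/= => /andP[]; rewrite inE.
pose GD x : 'rV[R]_n.+1 := \row_i ((fun x => G x ord0 i) \_ (eball r)) x.
pose H x : 'rV[R]_n.+1 := \row_i partial i (fun x => rho (dotp x x)) x.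
have HE x i : H x ord0 i = rho' (dotp x x) * (2 * x ord0 i).
  by rewrite mxE (partial_radial i (drho _)).
have mdot (F1 F2 : 'rV[R]_n.+1 -> 'rV[R]_n.+1) : (forall i, measurable_fun setT (fun x => F1 x ord0 i)) ->
   (forall i, measurable_fun setT (fun x => F2 x ord0 i)) ->
   measurable_fun setT (fun x => dotp (F1 x) (F2 x)).
  by move=> m1 m2; apply: measurable_sum => i; exact: measurable_funM.
have mGD i : measurable_fun setT (fun x => GD x ord0 i).
  by rewrite (_ : (fun _ => _) = (fun x => G x ord0 i) \_ (eball r))//; apply/funext => x; rewrite mxE.
have mH i : measurable_fun setT (fun x => H x ord0 i).
  under eq_fun do rewrite HE.
  apply: measurable_funM; first by apply: (measurableT_comp mrho'); exact: dotp_measurableR.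
  by apply: measurable_funM => //; exact: measurable_coord.
have out x : ~ eball r x -> rho (dotp x x) = 0 /\ rho' (dotp x x) = 0.
  rewrite eballE// => /negP; rewrite -leNgt => h; apply: rho0.
  by rewrite negb_and -[X in _ || X]ltNge (lt_le_trans hir h) orbT.
set q := critical_exponent p.
move=> eqn; rewrite Rintegral_mkcond in eqn.
rewrite [in RHS]Rintegral_mkcond in eqn; move: eqn.
rewrite [X in X = _](@ae_eq_Rintegral _ _ _ _ _
   (fun x => 2 * Num.sqrt (dotp x x) * sgpow p (slope w (dotp x x)) * rho' (dotp x x))); last 3 first.
- rewrite (_ : _ \_ _ = fun x => Num.sqrt (dotp (GD x) (GD x)) `^ (p - 2) * dotp (GD x) (H x)).
    apply: measurable_funM; last exact: mdot.
    apply: (measurableT_comp (measurable_powR _)).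
    have ms : measurable_fun [set: measurableTypeR R] (@Num.sqrt R : measurableTypeR R -> measurableTypeR R).
      by apply: continuous_measurable_fun; exact: sqrt_continuous.
    by apply: (measurableT_comp ms); exact: mdot.
  apply/funext => x; rewrite patchE; case: ifPn => [xD|].
    rewrite (_ : GD x = G x)//; apply/rowP => i; rewrite mxE patchE xD//.
  rewrite notin_setE => /out[_ r'0]; rewrite [X in _ * X]big1 ?mulr0// => i _.
  by rewrite HE r'0 mul0r mulr0.
- apply: (measurableT_comp (f := fun s : measurableTypeR R => 2 * Num.sqrt (s : R) * sgpow p (slope w s) * rho' s)); last exact: dotp_measurableR.
  apply: measurable_funM => //; apply: measurable_funM.
    apply: measurable_funM => //; apply: continuous_measurable_fun; exact: sqrt_continuous.
  apply: (measurableT_comp (measurable_sgpow p)); exact: measurable_slope.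
- apply: filterS ae_gradient => x hx; rewrite patchE; case: ifPn => [xD|]; last first.
    by rewrite notin_setE => /out[_ ->]; rewrite mulr0.
  have hG i : G x ord0 i = 2 * x ord0 i * w (dotp x x) by have := hx i; rewrite patchE xD.
  rewrite (enorm_radial hG) /sgpow.
  have -> : dotp (G x) (H x) = 4 * dotp x x * w (dotp x x) * rho' (dotp x x).
    rewrite {1 2}/dotp mulr_sumr !mulr_suml; apply: eq_bigr => i _; rewrite HE hG; ring.
  set c := _ `^ _; rewrite -[in LHS]mulrA -[X in c * (4 * X * _)](sqr_sqrtr (dotp_ge0 x)) /slope; ring.
rewrite [X in _ = mu * X](@ae_eq_Rintegral _ _ _ _ _
   (fun x => sgpow q (z (dotp x x)) * rho (dotp x x))); last 3 first.
- rewrite (_ : _ \_ _ = fun x => sgpow q ((u \_ (eball r)) x) * rho (dotp x x)).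
    apply: measurable_funM; first by apply: (measurableT_comp (measurable_sgpow q)).
    by apply: (measurableT_comp mrho); exact: dotp_measurableR.
  apply/funext => x; rewrite !patchE; case: ifPn => // h.
  by rewrite /sgpow mulr0 mul0r.
- apply: measurable_funM; last by apply: (measurableT_comp mrho); exact: dotp_measurableR.
  apply: (measurableT_comp (measurable_sgpow q)); apply: (measurableT_comp mz).
  exact: dotp_measurableR.
- apply: filterS uz => x hx; rewrite patchE; case: ifPn => [xD|]; last first.
    by rewrite notin_setE => /out[-> _]; rewrite mulr0.
  by rewrite -hx patchE xD.
rewrite (@Rintegral_radial _ _ (fun s => 2 * Num.sqrt s * sgpow p (slope w s) * rho' s))//; last first.
  apply: measurable_funM => //; apply: measurable_funM.
    apply: measurable_funM => //; apply: continuous_measurable_fun; exact: sqrt_continuous.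
  apply: (measurableT_comp (measurable_sgpow p)); exact: measurable_slope.
rewrite (@Rintegral_radial _ _ (fun s => sgpow q (z s) * rho s))//.
apply: measurable_funM => //; exact: (measurableT_comp (measurable_sgpow q)).
Qed.

End radial_weak_equation.

(** * Weak derivatives on an interval *)

Lemma integral_mul_bump_cvg (R : realType) (D : R -> R) (a b : R) :
  (@lebesgue_measure R).-integrable setT (EFin \o D) ->
  \int[lebesgue_measure]_s (D s * bump m a b s) @[m --> \oo] -->
    \int[lebesgue_measure]_(s in `]a, b[) D s.
Proof.
move=> iD.
have mD : measurable_fun [set: measurableTypeR R] D.
  by apply/measurable_EFinP; exact: (measurable_int _ iD).
have DC := @dominated_convergence _ (measurableTypeR R) R lebesgue_measure setT measurableT
  (fun m s => (D s * bump m a b s)%:E) (EFin \o (D \_ `]a, b[)) (fun s => `|D s|%:E).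
have h2 : (\int[lebesgue_measure]_s (EFin \o (D \_ `]a, b[)) s)%E \is a fin_num.
  apply: integrable_fin_num => //.
  rewrite -restrict_EFin; apply/(integrable_mkcond _ _).1 => //.
  exact: integrableS iD.
rewrite [X in _ --> X](_ : _ = fine (\int[lebesgue_measure]_s (EFin \o (D \_ `]a, b[)) s)%E); last first.
  by rewrite Rintegral_mkcond.
apply: fine_cvg; rewrite fineK//; case: DC => [|||||_ _ //].
- move=> m; apply/measurable_EFinP; apply: measurable_funM => //.
  by apply: continuous_measurable_fun; exact: bump_continuous.
- apply/measurable_EFinP; apply/(measurable_restrictT _ _).1 => //; exact: measurable_funTS.
- apply: aeW => s _ /=; apply/fine_cvgP; split; first by apply: nearW.
  rewrite patchE; case: ifPn => [|].
    rewrite inE/= in_itv/= => sab; rewrite -[X in _ --> X]mulr1.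
    by apply: cvgMr; exact: bump_cvg.
  rewrite notin_setE/= in_itv/= => /negP sab.
  rewrite (_ : _ \o _ = fun=> 0); first exact: cvg_cst.
  by apply/funext => m/=; rewrite bump_out ?mulr0.
- exact: integrable_norm iD.
- apply: aeW => s m _; rewrite /= lee_fin normrM -[leRHS]mulr1 ler_wpM2l//.
  by rewrite ger0_norm ?bump_ge0 ?bump_le1.
Qed.

(** The primitive of [f] is constant on [`]lo, hi[], and
    its derivative is [f] at every Lebesgue point. *)
Lemma integral_itv_eq0_ae (R : realType) (f : R -> R) (lo hi : R) :
  (@lebesgue_measure R).-integrable setT (EFin \o f) ->
  (forall a b, lo < a -> a < b -> b < hi -> \int[lebesgue_measure]_(s in `]a, b[) f s = 0) ->
  {ae lebesgue_measure, forall s : measurableTypeR R, lo < (s : R) < hi -> f s = 0}.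
Proof.
move=> iF h.
have iI (I : interval R) : (@lebesgue_measure R).-integrable [set` I] (EFin \o f).
  by apply: integrableS iF.
apply: (@filterS _ _ (ae_filter_ringOfSetsType (@lebesgue_measure R)) _ _ _
  (lebesgue_differentiation (open_integrable_locally openT iF))) => s Ls /andP[ls sh].
have [ds vs] : derivable (fun y : R => \int[lebesgue_measure]_(t in `]-oo, y]) f t) s 1 /\
    (fun y : R => \int[lebesgue_measure]_(t in `]-oo, y]) f t)^`()%classic s = f s.
  apply: (@FTC1_lebesgue_pt R f -oo%O s (s + 1)) => //; first by rewrite ltrDl.
  by rewrite ltNyr.
rewrite -vs derive1E.
have key : forall a b, lo < a -> a <= b -> b < hi ->
   \int[lebesgue_measure]_(t in `]-oo, a]) f t = \int[lebesgue_measure]_(t in `]-oo, b]) f t.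
  move=> a b la; rewrite le_eqVlt => /orP[/eqP ->//|ab] bh.
  apply/eqP; rewrite eq_sym -subr_eq0 Rintegral_itvB//; last exact: ltW.
  by rewrite -Rintegral_itv_bndo_bndc// h.
rewrite (@near_eq_derive _ _ _ _ (cst (\int[lebesgue_measure]_(t in `]-oo, s]) f t))) ?derive_cst ?oner_eq0//.
near=> y.
have yl : lo < y by near: y; exact: lt_nbhsr.
have yh : y < hi by near: y; exact: lt_nbhsl.
rewrite /cst; have [ys|sy] := leP y s; first exact: key.
by apply/esym/key => //; exact: ltW.
Unshelve. all: by end_near. Qed.

(** Fix a bump of reference and let [C] be the mean of [D]
    against it. The hypothesis says that [D - C] is orthogonal to every bump;
    when the bumps increase to indicator functions, the integrals of [D - C] on
    all intervals vanish. *)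
Lemma du_bois_reymond (R : realType) (D : R -> R) (lo hi : R) : lo < hi ->
  (@lebesgue_measure R).-integrable setT (EFin \o D) ->
  (forall m a b a' b', lo < a -> a < b -> b < hi -> lo < a' -> a' < b' -> b' < hi ->
    \int[lebesgue_measure]_s (D s * (bump m a b s -
     \int[lebesgue_measure]_s bump m a b s / \int[lebesgue_measure]_s bump 0 a' b' s * bump 0 a' b' s)) = 0) ->
  exists C, {ae lebesgue_measure, forall s : measurableTypeR R, lo < (s : R) < hi -> D s = C}.
Proof.
move=> lohi iD H.
have mD : measurable_fun [set: measurableTypeR R] D.
  by apply/measurable_EFinP; exact: (measurable_int _ iD).
(* any bump supported in the open interval can serve as reference *)
pose a' := (2 * lo + hi) / 3; pose b' := (lo + 2 * hi) / 3.
have la' : lo < a' by rewrite /a'; lra.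
have a'b' : a' < b' by rewrite /a' /b'; lra.
have b'h : b' < hi by rewrite /b'; lra.
have iDb m a b : (@lebesgue_measure R).-integrable setT (EFin \o (fun s => D s * bump m a b s)).
  apply: le_integrable iD => //.
    apply/measurable_EFinP; apply: measurable_funM => //.
    by apply: continuous_measurable_fun; exact: bump_continuous.
  move=> s _; rewrite /= lee_fin normrM -[leRHS]mulr1 ler_wpM2l//.
  by rewrite ger0_norm ?bump_ge0 ?bump_le1.
have J0 := bump_integral_gt0 0 a'b'.
set J := \int[lebesgue_measure]_s bump 0 a' b' s in J0.
pose C := \int[lebesgue_measure]_s (D s * bump 0 a' b' s) / J.
have iKD : (@lebesgue_measure R).-integrable setT (EFin \o (D \_ `[lo, hi])).
  rewrite -restrict_EFin; apply/(integrable_mkcond _ _).1 => //.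
  exact: integrableS iD.
have iKC : (@lebesgue_measure R).-integrable setT (EFin \o (cst C \_ `[lo, hi])).
  rewrite -restrict_EFin; apply/(integrable_mkcond _ _).1 => //.
  apply: continuous_compact_integrable; first exact: segment_compact.
  by move=> x; exact: cvg_cst.
have zero a b : lo < a -> a < b -> b < hi ->
   \int[lebesgue_measure]_(s in `]a, b[) (D s - cst C s) = 0.
  move=> la ab bh.
  have iab : (@lebesgue_measure R).-integrable `]a, b[ (EFin \o (cst C)).
    apply: (@integrableS _ _ _ _ (`[a, b]%classic : set (measurableTypeR R))) => //; first exact: subset_itv_oo_cc.
    apply: continuous_compact_integrable; first exact: segment_compact.
    by move=> x; exact: cvg_cst.
  rewrite RintegralB//; last by apply: integrableS iD.
  apply/eqP; rewrite subr_eq0; apply/eqP.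
  have c1 := integral_mul_bump_cvg (a := a) (b := b) iD.
  have c2 := integral_mul_bump_cvg (a := a) (b := b) iKC.
  have -> : \int[lebesgue_measure]_(s in `]a, b[) cst C s = \int[lebesgue_measure]_(s in `]a, b[) (cst C \_ `[lo, hi]) s.
    apply: eq_Rintegral => s; rewrite inE/= in_itv/= => /andP[sa sb].
    by rewrite patchE mem_set//= in_itv/= !ltW// ?(lt_trans la)// (lt_trans sb).
  apply: (cvg_unique _ c1) => //.
  rewrite (_ : (fun m => _) = (fun m => \int[lebesgue_measure]_s ((cst C \_ `[lo, hi]) s * bump m a b s)))//.
  apply/funext => m.
  have -> : \int[lebesgue_measure]_s ((cst C \_ `[lo, hi]) s * bump m a b s) = C * \int[lebesgue_measure]_s bump m a b s.
    rewrite -RintegralZl//; last exact: bump_integrable.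
    apply: eq_Rintegral => s _; rewrite patchE; case: ifPn => // hs.
    rewrite bump_out ?mulr0 ?mul0r//; move: hs; rewrite notin_setE/= in_itv/= => /negP; apply: contra.
    move=> /andP[sa sb]; rewrite !ltW// ?(lt_trans la)// (lt_trans sb)//.
  have := H m _ _ _ _ la ab bh la' a'b' b'h; rewrite -/J.
  set k := _ / J.
  rewrite (_ : (fun s => _) = (fun s => D s * bump m a b s - k * (D s * bump 0 a' b' s))); last first.
    by apply/funext => s; ring.
  rewrite RintegralB//; last first.
    rewrite (_ : EFin \o _ = fun s => k%:E * (D s * bump 0 a' b' s)%:E)%E.
      by apply: integrableZl => //; exact: iDb.
    by apply/funext => s /=; rewrite EFinM.
  have E := RintegralZl k measurableT (iDb 0%N a' b').
  rewrite [X in _ - X = _]E.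
  by move/eqP; rewrite subr_eq0 => /eqP ->; rewrite /k /C; ring.
exists C.
have iB : (@lebesgue_measure R).-integrable setT (EFin \o ((D \_ `[lo, hi]) \- (cst C \_ `[lo, hi]))).
  rewrite (_ : EFin \o _ = ((EFin \o (D \_ `[lo, hi])) \- (EFin \o (cst C \_ `[lo, hi])))%E).
    exact: integrableB.
  by apply/funext => s /=; rewrite EFinB.
have := integral_itv_eq0_ae (lo := lo) (hi := hi) iB.
have h a b : lo < a -> a < b -> b < hi ->
   \int[lebesgue_measure]_(s in `]a, b[) ((D \_ `[lo, hi]) \- (cst C \_ `[lo, hi])) s = 0.
  move=> la ab bh; rewrite -[RHS](zero _ _ la ab bh).
  apply: eq_Rintegral => s; rewrite inE/= in_itv/= => /andP[sa sb].
  by rewrite !patchE mem_set//= in_itv/= !ltW// ?(lt_trans la)// (lt_trans sb).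
move=> /(_ h); apply: filterS => s + /andP[sl sh]; rewrite sl sh => /(_ isT) /=.
have sI : s \in (`[lo, hi]%classic : set R) by rewrite inE/= in_itv/= !ltW.
by rewrite !patchE sI => /eqP; rewrite subr_eq0 => /eqP.
Qed.

Lemma is_derive_restricted_primitive (R : realType) (f : R -> R) (lo hi s : R) :
  (forall s, lo <= s <= hi -> {for s, continuous f}) -> lo < s < hi ->
  is_derive s 1 (fun s => \int[lebesgue_measure]_(t in `]-oo, s]) (f \_ `[lo, hi]) t) (f s).
Proof.
move=> cf /andP[ls sh].
have wf : {within `[lo, hi], continuous f}.
  by apply: continuous_in_subspaceT => t; rewrite inE/= in_itv/=; exact: cf.
have iF : (@lebesgue_measure R).-integrable setT (EFin \o (f \_ `[lo, hi])).
  rewrite -restrict_EFin; apply/(integrable_mkcond _ _).1 => //.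
  by apply: continuous_compact_integrable => //; exact: segment_compact.
have nf : \near s, f s = (f \_ `[lo, hi]) s.
  near=> t; rewrite patchE mem_set//= in_itv/=.
  by apply/andP; split; apply: ltW; near: t; [exact: lt_nbhsr|exact: lt_nbhsl].
rewrite [X in is_derive _ _ _ X](nbhs_singleton nf).
apply: (is_derive_indefinite_integral iF); apply: near_eq_continuous_at nf _.
by apply: cf; rewrite !ltW.
Unshelve. all: by end_near. Qed.

(** The hypothesis says that [- B] is the derivative of
    [A] in the sense of distributions. Integrating [B] by parts, the sum of [A]
    and of a primitive of [B] is orthogonal to all derivatives of test
    functions. *)
Lemma weak_derivative_ae (R : realType) (A B : R -> R) (lo hi : R) : lo < hi ->
  (@lebesgue_measure R).-integrable `[lo, hi] (EFin \o A) ->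
  (forall s, lo <= s <= hi -> {for s, continuous B}) ->
  (forall rho rho' lo' hi', lo < lo' -> hi' < hi -> smooth1 rho ->
    (forall s : R, is_derive s 1 rho (rho' s)) -> continuous rho' ->
    (forall s, ~~ (lo' <= s <= hi') -> rho s = 0 /\ rho' s = 0) ->
    \int[lebesgue_measure]_(s in `[lo, hi]) (A s * rho' s) =
    \int[lebesgue_measure]_(s in `[lo, hi]) (B s * rho s)) ->
  exists C, {ae lebesgue_measure, forall s : measurableTypeR R, lo < (s : R) < hi ->
    A s + \int[lebesgue_measure]_(t in `]-oo, (s : R)]) (B \_ `[lo, hi]) t = C}.
Proof.
move=> lohi iA cB H.
have mI : measurable (`[lo, hi]%classic : set (measurableTypeR R)) by [].
have wB : {within `[lo, hi], continuous B}.
  by apply: continuous_in_subspaceT => s; rewrite inE/= in_itv/=; exact: cB.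
have iB : (@lebesgue_measure R).-integrable setT (EFin \o (B \_ `[lo, hi])).
  rewrite -restrict_EFin; apply/(integrable_mkcond _ _).1 => //.
  by apply: continuous_compact_integrable => //; exact: segment_compact.
pose Bp (s : R) := \int[lebesgue_measure]_(t in `]-oo, s]) (B \_ `[lo, hi]) t.
have cBp : continuous Bp by exact: continuous_indefinite_integral.
have dBp (s : R) : lo < s < hi -> is_derive s 1 Bp (B s).
  exact: is_derive_restricted_primitive.
have iBp : (@lebesgue_measure R).-integrable `[lo, hi] (EFin \o Bp).
  apply: continuous_compact_integrable; first exact: segment_compact.
  by apply: continuous_subspaceT.
have iD : (@lebesgue_measure R).-integrable setT (EFin \o ((fun s => A s + Bp s) \_ `[lo, hi])).
  rewrite -restrict_EFin; apply/(integrable_mkcond _ _).1 => //.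
  rewrite (_ : EFin \o _ = ((EFin \o A) \+ (EFin \o Bp))%E); first exact: integrableD.
  by apply/funext => s /=; rewrite EFinD.
have [|C CE] := du_bois_reymond lohi iD; last first.
  exists C; apply: filterS CE => s h /[dup] /h <- /andP[sl sh].
  by rewrite patchE mem_set//= in_itv/= !ltW.
move=> m a b a' b' la ab bh la' a'b' b'h.
set k := _ / _.
pose lo' := Num.min a a'; pose hi' := Num.max b b'.
have [||||rho [srho drho rho0]] := @bump_difference_primitive R m lo' hi' a b a' b' _ _ _ _ a'b'.
- by rewrite ge_min lexx.
- by rewrite le_max lexx.
- by rewrite ge_min lexx orbT.
- by rewrite le_max lexx orbT.
rewrite -/k in drho.
pose rho' s := bump m a b s - k * bump 0 a' b' s.
have cb' : continuous rho'.
  move=> s; apply: cvgB; first exact: bump_continuous.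
  by apply: cvgM; [exact: cvg_cst|exact: bump_continuous].
have llo' : lo < lo' by rewrite lt_min la la'.
have hhi' : hi' < hi by rewrite gt_max bh b'h.
have crho : continuous rho.
  by move=> s; apply: differentiable_continuous; apply: is_derive_differentiable (drho s).
have rho'0 s : ~~ (lo' <= s <= hi') -> rho' s = 0.
  move=> h; rewrite /rho' !bump_out ?mulr0 ?subrr//; apply: contra h => /andP[h1 h2].
    by rewrite /lo' /hi' ge_min le_max (ltW h1) (ltW h2) !orbT.
  by rewrite /lo' /hi' ge_min le_max (ltW h1) (ltW h2).
have := H rho rho' lo' hi' llo' hhi' srho drho cb' (fun s h => conj (rho0 s h) (rho'0 s h)).
have parts := @Rintegration_by_parts R Bp rho B rho' lo hi lohi wB.
have {parts} -> : \int[lebesgue_measure]_(s in `[lo, hi]) (B s * rho s) =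
     - \int[lebesgue_measure]_(s in `[lo, hi]) (Bp s * rho' s).
  rewrite parts.
  - rewrite [rho lo]rho0 ?[rho hi]rho0; first by ring.
      by rewrite negb_and -!ltNge hhi' orbT.
    by rewrite negb_and -!ltNge llo'.
  - split.
    + by move=> s; rewrite in_itv/= => /dBp h; exact: ex_derive.
    + by apply: cvg_at_right_filter; exact: cBp.
    + by apply: cvg_at_left_filter; exact: cBp.
  - by move=> s; rewrite in_itv/= => /dBp h; rewrite derive1E derive_val.
  - exact: continuous_subspaceT.
  - split.
    + by move=> s _; exact: (@ex_derive _ _ _ _ _ _ _ (drho s)).
    + by apply: cvg_at_right_filter; exact: crho.
    + by apply: cvg_at_left_filter; exact: crho.
  - by move=> s _; rewrite derive1E; have h := drho s; rewrite derive_val.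
move=> /eqP; rewrite -addr_eq0 => /eqP E.
have [K K1] : exists K : R, forall s, `|rho' s| <= K.
  exists (1 + `|k|) => s; apply: le_trans (ler_normB _ _) _; apply: lerD; last rewrite normrM.
    by rewrite ger0_norm ?bump_ge0 ?bump_le1.
  by rewrite -[leRHS]mulr1 ler_wpM2l// ger0_norm ?bump_ge0 ?bump_le1.
have imul f : (@lebesgue_measure R).-integrable `[lo, hi] (EFin \o f) ->
   (@lebesgue_measure R).-integrable `[lo, hi] (EFin \o (fun s => f s * rho' s)).
  move=> jf; apply: le_integrable (integrableZl mI K jf) => //.
  - apply/measurable_EFinP; apply: measurable_funM; last first.
      by apply: measurable_funTS; exact: continuous_measurable_fun.
    by apply/measurable_EFinP; exact: measurable_int jf.
  - move=> s _; rewrite /= lee_fin !normrM mulrC ler_wpM2r//.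
    exact: le_trans (ler_norm K).
transitivity (\int[lebesgue_measure]_(s in `[lo, hi]) (A s * rho' s + Bp s * rho' s)).
  rewrite [RHS]Rintegral_mkcond; apply: eq_Rintegral => s _; rewrite !patchE.
  by case: ifPn => _; rewrite ?mul0r// mulrDl.
rewrite RintegralD// ?E//; exact: imul.
Qed.

(** * The energy of the profile *)

(** By comparison with the largest coordinate. *)
Lemma enorm_powR_le (R : realType) n (p : R) (y : 'rV[R]_n.+1) : 0 <= p ->
  enorm y `^ p <= n.+1%:R `^ p * \sum_i `|y ord0 i| `^ p.
Proof.
move=> p0; pose j := [arg max_(i > ord0) `|y ord0 i|]%O.
have jP i : `|y ord0 i| <= `|y ord0 j|.
  by rewrite /j; case: arg_maxP => // k _ h; exact: h.
have h : enorm y <= n.+1%:R * `|y ord0 j|.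
  rewrite /enorm -[leRHS]ger0_norm ?mulr_ge0// -sqrtr_sqr ler_wsqrtr// exprMn.
  apply: (@le_trans _ _ (\sum_(i < n.+1) `|y ord0 j| ^+ 2)).
    apply: ler_sum => i _; rewrite -expr2 -real_normK ?num_real//.
    by rewrite lerXn2r// ?nnegrE.
  rewrite sumr_const card_ord -[leLHS]mulr_natl ler_wpM2r ?exprn_ge0//.
  by rewrite -natrX ler_nat -[leqLHS]expn1 leq_pexp2l.
apply: (@le_trans _ _ ((n.+1%:R * `|y ord0 j|) `^ p)).
  by rewrite ge0_ler_powR// nnegrE ?sqrtr_ge0 ?mulr_ge0.
rewrite powRM// ler_wpM2l ?powR_ge0// (bigD1 j)//= lerDl sumr_ge0//.
Qed.

Section energy.
Context (R : realType) (n : nat) (p r : R).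
Context (G : 'rV[R]_n.+1 -> 'rV[R]_n.+1) (w : R -> R).
Hypotheses (n0 : (0 < n)%N) (p1 : 1 < p).
Hypothesis LG : forall i, Lp (eball r) p (fun x => G x ord0 i).
Hypothesis mw : measurable_fun [set: measurableTypeR R] w.
Hypothesis Gw : forall i, {ae lebesgue_rV n.+1, forall x,
    ((fun x => G x ord0 i) \_ (eball r)) x = 2 * x ord0 i * w (dotp x x)}.

(** The energy of [u] in polar coordinates; its
    finiteness is the only information on the solution near the origin. *)
Lemma energy_integrable :
  (@lebesgue_measure R).-integrable `]0, +oo[ (fun s => (`|slope w s| `^ p * radial_density n.+1 s)%:E).
Proof.
have mslope : measurable_fun [set: measurableTypeR R] (fun s => `|slope w s| `^ p).
  apply: (measurableT_comp (measurable_powR _)).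
  apply: (measurableT_comp (@normr_measurable _ _)); exact: measurable_slope.
have mI : measurable (`]0, +oo[%classic : set (measurableTypeR R)) by [].
apply/integrableP; split.
  apply/measurable_EFinP; apply: measurable_funTS; apply: measurable_funM => //.
  exact: measurable_radial_density.
pose GD x : 'rV[R]_n.+1 := \row_i ((fun x => G x ord0 i) \_ (eball r)) x.
have -> : (\int[lebesgue_measure]_(s in `]0%R, +oo[) `|(`|slope w s| `^ p * radial_density n.+1 s)%:E| =
   \int[lebesgue_rV n.+1]_x (`|slope w (dotp x x)| `^ p)%:E)%E.
  rewrite (@ge0_integral_radial _ _ (fun s => (`|slope w s| `^ p)%:E))//; last by apply/measurable_EFinP.
  apply: eq_integral => s _; rewrite -EFinM /= ger0_norm//.
  by rewrite mulr_ge0 ?powR_ge0 ?radial_density_ge0.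
have iG i : (lebesgue_rV n.+1).-integrable setT (fun x => (`|GD x ord0 i| `^ p)%:E).
  rewrite (_ : (fun _ => _) = fun x => (`|((fun x => G x ord0 i) \_ (eball r)) x| `^ p)%:E); last first.
    by apply/funext => x; rewrite mxE.
  by apply: Lfun_integrable; [exact: ltW|exact: LG].
have iS : (lebesgue_rV n.+1).-integrable setT (fun x => ((n.+1%:R `^ p)%:E * \sum_i (`|GD x ord0 i| `^ p)%:E)%E).
  by apply: integrableZl => //; apply: integrable_sum.
have /integrableP[_] := iS; apply: le_lt_trans.
apply: ae_ge0_le_integral => //.
- apply/measurable_EFinP; apply: (measurableT_comp mslope); exact: dotp_measurableR.
- apply: measurableT_comp => //; exact: measurable_int iS.
apply: filterS (ae_gradient Gw) => x hx _.
have hG i : GD x ord0 i = 2 * x ord0 i * w (dotp x x) by rewrite mxE hx.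
rewrite -(enorm_radial hG) sumEFin -EFinM /= lee_fin.
apply: le_trans (ler_norm _); apply: enorm_powR_le; exact: ltW (lt_trans ltr01 p1).
Qed.

End energy.

Lemma norm_sgpow (R : realType) (e x : R) : 1 < e -> `|sgpow e x| = `|x| `^ (e - 1).
Proof.
move=> e1; rewrite /sgpow normrM ger0_norm ?powR_ge0//.
have [->|x0] := eqVneq x 0.
  by rewrite normr0 mulr0 powR0// subr_eq0 gt_eqF.
rewrite -[X in _ * X]powRr1// -powRD; last by rewrite normr_eq0 x0 implybT.
by congr (_ `^ _); lra.
Qed.

(** For [p' = p / (p - 1)], the functions [sgpow p] and
    [sgpow p'] are inverse to each other, since [(p - 1) * (p' - 1) = 1]. *)
Lemma sgpow_conjK (R : realType) (p x : R) : 1 < p -> sgpow (p / (p - 1)) (sgpow p x) = x.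
Proof.
move=> p1; rewrite {1}/sgpow norm_sgpow//.
have [->|x0] := eqVneq x 0; first by rewrite /sgpow !mulr0.
rewrite -powRrM /sgpow mulrA -powRD; last by rewrite normr_eq0 x0 implybT.
rewrite (_ : _ + _ = 0) ?powRr0 ?mul1r//.
by field; lra.
Qed.

Lemma sgpow_continuous (R : realType) (e : R) : 1 < e -> continuous (@sgpow R e).
Proof.
move=> e1 x; have [->|x0] := eqVneq x 0.
  rewrite /continuous_at {2}/sgpow mulr0; apply/norm_cvg0P.
  rewrite (_ : (fun _ => _) = (fun x : R => `|x| `^ (e - 1))); last first.
    by apply/funext => y; rewrite norm_sgpow.
  have e0 : 0 <= e - 1 by lra.
  have := @powabs_continuous R _ e0 0; rewrite /continuous_at normr0 powR0//.
  by rewrite subr_eq0 gt_eqF.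
apply: cvgM; last exact: cvg_id.
have x00 : 0 < `|x| by rewrite normr_gt0.
have h : {for `|x|, continuous (fun t : R => t `^ (e - 2))}.
  apply: differentiable_continuous; apply/derivable1_diffP.
  by apply: derivable_powR; rewrite in_itv/= x00.
by apply: (@continuous_comp R R R (fun t : R => `|t|) (fun t : R => t `^ (e - 2))) => //; exact: norm_continuous.
Qed.

(** * Interior regularity of the profile *)

Lemma is_derive1D (R : realType) (f g : R -> R) (x df dg : R) :
  is_derive x 1 f df -> is_derive x 1 g dg ->
  is_derive x 1 (fun t => f t + g t) (df + dg).
Proof. by move=> hf hg; exact: is_deriveD. Qed.

Lemma is_derive1M (R : realType) (f g : R -> R) (x df dg : R) :
  is_derive x 1 f df -> is_derive x 1 g dg ->
  is_derive x 1 (fun t => f t * g t) (df * g x + f x * dg).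
Proof.
move=> hf hg; apply: is_derive_eq (is_deriveM hf hg) _.
by rewrite /GRing.scale/= addrC [g x * _]mulrC.
Qed.

Lemma is_derive1Z (R : realType) (f : R -> R) (k x df : R) :
  is_derive x 1 f df -> is_derive x 1 (fun t => k * f t) (k * df).
Proof.
move=> hf; apply: is_derive_eq (is_derive1M (is_derive_cst k x 1) hf) _.
by rewrite mul0r add0r.
Qed.

Lemma is_derive1C (R : realType) (k x : R) : is_derive x 1 (fun _ : R => k) 0.
Proof. exact: is_derive_cst. Qed.

Lemma is_derive1N (R : realType) (f : R -> R) (x df : R) :
  is_derive x 1 f df -> is_derive x 1 (fun t => - f t) (- df).
Proof. by move=> hf; exact: is_deriveN. Qed.

Lemma is_derive1_sqr (R : realType) (x : R) : is_derive x 1 (fun t : R => t ^+ 2) (2 * x).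
Proof.
apply: (is_derive_eq (is_derive1M (is_derive_id x 1) (is_derive_id x 1))).
by rewrite mul1r mulr1 mulr_natl mulr2n.
Qed.

Lemma is_derive_sqrD (R : realType) (f : R -> R) (a t d : R) :
  is_derive (t ^+ 2 + a) 1 f d ->
  is_derive t 1 (fun t : R => f (t ^+ 2 + a)) (d * (2 * t)).
Proof.
move=> h; apply: (@is_derive1_comp R f (fun t : R => t ^+ 2 + a) t _ _ h).
by apply: is_derive_eq (is_derive1D (is_derive1_sqr t) (is_derive1C a t)) _; rewrite addr0.
Qed.

(** On a line at squared distance [a < lo] from the
    origin, the increments of [t |-> z (t ^+ 2 + a)] are the integrals of
    [2 t w (t ^+ 2 + a)], that is, the increments of a primitive [W] of [w] at
    [t ^+ 2 + a]. *)
Lemma is_derive_of_slices (R : realType) n (z w : R -> R) (g : 'rV[R]_n.+1 -> R) (lo hi : R) :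
  (0 < n)%N -> 0 < lo -> measurable_fun setT g ->
  (forall s, lo <= s <= hi -> {for s, continuous w}) ->
  {ae lebesgue_rV n, forall y, forall t1 t2 : R, 0 < t1 <= t2 ->
     z (t2 ^+ 2 + dotp y y) - z (t1 ^+ 2 + dotp y y) =
      \int[lebesgue_measure]_(s in `]t1, t2]) g (cons_rV (s, y))} ->
  {ae lebesgue_rV n.+1, forall x, lo < dotp x x < hi -> g x = 2 * x ord0 ord0 * w (dotp x x)} ->
  forall s, lo < s < hi -> is_derive s 1 z (w s).
Proof.
move=> n0 lo0 mg cw slices gw.
have gw' := ae_slice gw.
have [|y [Fz gy] ya] := @ae_exists_small R n (fun y =>
    (forall t1 t2 : R, 0 < t1 <= t2 ->
     z (t2 ^+ 2 + dotp y y) - z (t1 ^+ 2 + dotp y y) =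
      \int[lebesgue_measure]_(s in `]t1, t2]) g (cons_rV (s, y))) /\
    {ae lebesgue_measure, forall t : measurableTypeR R, lo < dotp (cons_rV (t, y)) (cons_rV (t, y)) < hi ->
      g (cons_rV (t, y)) = 2 * cons_rV (t, y) ord0 ord0 * w (dotp (cons_rV (t, y)) (cons_rV (t, y)))}) lo n0 lo0.
  by apply: filterS2 slices gw' => y h1 h2; split.
set a := dotp y y in Fz ya.
have a0 : 0 <= a by exact: dotp_ge0.
pose W s := \int[lebesgue_measure]_(t in `]-oo, s]) (w \_ `[lo, hi]) t.
have dW s : lo < s < hi -> is_derive s 1 W (w s).
  by move=> h; exact: is_derive_restricted_primitive.
have incr s1 s2 : lo < s1 -> s1 < s2 -> s2 < hi -> z s2 - z s1 = W s2 - W s1.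
  move=> l1 s12 h2.
  have a1 : 0 < s1 - a by rewrite subr_gt0; exact: lt_trans ya l1.
  have a2 : 0 < s2 - a by rewrite subr_gt0; exact: lt_trans ya (lt_trans l1 s12).
  have t1 : Num.sqrt (s1 - a) ^+ 2 + a = s1 by rewrite sqr_sqrtr ?subrK// ltW.
  have t2 : Num.sqrt (s2 - a) ^+ 2 + a = s2 by rewrite sqr_sqrtr ?subrK// ltW.
  set T1 := Num.sqrt (s1 - a) in t1; set T2 := Num.sqrt (s2 - a) in t2.
  have T10 : 0 < T1 by rewrite sqrtr_gt0.
  have T12 : T1 < T2 by rewrite ltr_sqrt// ltrD2r.
  have := Fz T1 T2; rewrite T10 (ltW T12) => /(_ isT); rewrite t1 t2 => ->.
  have inI t : T1 <= t <= T2 -> lo < t ^+ 2 + a < hi.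
    move=> /andP[h1 h3]; apply/andP; split.
      apply: lt_le_trans l1 _; rewrite -t1 lerD2r lerXn2r// nnegrE ltW//.
      exact: lt_le_trans h1.
    apply: le_lt_trans h2; rewrite -[leRHS]t2 lerD2r lerXn2r// nnegrE ltW//.
      exact: lt_le_trans h1.
    exact: lt_trans T12.
  have mslice : measurable_fun [set: measurableTypeR R] (fun t : measurableTypeR R => g (cons_rV (t, y))).
    exact: measurable_slice.
  have dF (t : R) : T1 <= t <= T2 -> is_derive t 1 (fun t => W (t ^+ 2 + a)) (w (t ^+ 2 + a) * (2 * t)).
    by move=> /inI /dW h; exact: is_derive_sqrD.
  have cF (t : R) : T1 <= t <= T2 -> {for t, continuous (fun t : R => W (t ^+ 2 + a))}.
    by move=> /dF h; apply: differentiable_continuous; exact: is_derive_differentiable h.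
  have cf (t : R) : T1 <= t <= T2 -> {for t, continuous (fun t : R => w (t ^+ 2 + a) * (2 * t))}.
    move=> h; apply: cvgM; last by apply: cvgM; [exact: cvg_cst|exact: cvg_id].
    apply: (@continuous_comp R R R (fun t : R => t ^+ 2 + a) w); last first.
      by apply: cw; have /andP[h1 h3] := inI _ h; rewrite !ltW.
    by apply: cvgD; [exact: exprn_continuous|exact: cvg_cst].
  have wcf : {within `[T1, T2], continuous (fun t : R => w (t ^+ 2 + a) * (2 * t))}.
    by apply: continuous_in_subspaceT => t; rewrite inE/= in_itv/=; exact: cf.
  transitivity (\int[lebesgue_measure]_(t in `]T1, T2]) (w (t ^+ 2 + a) * (2 * t))).
    rewrite /Rintegral; congr fine; apply: ae_eq_integral => //.
    - by apply/measurable_EFinP; exact: measurable_funTS.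
    - apply/measurable_EFinP; apply: (@measurable_funS _ _ _ _ (`[T1, T2]%classic : set (measurableTypeR R))) => //.
        exact: subset_itv_oc_cc.
      by apply: subspace_continuous_measurable_fun.
    apply: filterS gy => t; rewrite dotp_cons_rV cons_rV0 => h; rewrite /= in_itv/= => /andP[h1 h3].
    by rewrite h ?inI ?(ltW h1)// mulrC.
  rewrite Rintegral_itv_obnd_cbnd; last first.
    apply: (@integrableS _ _ _ _ (`[T1, T2]%classic : set (measurableTypeR R))) => //.
      exact: subset_itv_oc_cc.
    by apply: continuous_compact_integrable => //; exact: segment_compact.
  rewrite /Rintegral (@continuous_FTC2 R _ (fun t : R => W (t ^+ 2 + a)) _ _ T12 wcf)/= ?t1 ?t2//.
  - split.
    + by move=> t; rewrite in_itv/= => /andP[h1 h3]; have := dF t; rewrite !ltW// => /(_ isT) h; exact: (@ex_derive _ _ _ _ _ _ _ h).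
    + by apply: cvg_at_right_filter; apply: cF; rewrite lexx ltW.
    + by apply: cvg_at_left_filter; apply: cF; rewrite lexx ltW.
  - move=> t; rewrite in_itv/= => /andP[h1 h3]; rewrite derive1E.
    by have := dF t; rewrite !ltW// => /(_ isT) h; rewrite derive_val.
move=> s /andP[ls sh].
apply: (near_eq_is_derive (f := fun t => W t + (z s - W s))); last first.
  apply: is_derive_eq (is_derive1D (dW s _) (is_derive1C _ s)) _; last by rewrite addr0.
  by rewrite ls.
near=> t.
have lt : lo < t by near: t; exact: lt_nbhsr.
have th : t < hi by near: t; exact: lt_nbhsl.
have [ts|st|->] := ltgtP t s.
- by have := incr _ _ lt ts sh; lra.
- by have := incr _ _ ls st th; lra.
- by ring.
Unshelve. all: by end_near. Qed.

Lemma conjugate_gt1 (R : realType) (p : R) : 1 < p -> 1 < p / (p - 1).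
Proof. by move=> p1; rewrite ltr_pdivlMr; lra. Qed.

Lemma sgpow_conjKr (R : realType) (p x : R) : 1 < p -> sgpow p (sgpow (p / (p - 1)) x) = x.
Proof.
move=> p1; rewrite -[RHS](sgpow_conjK x (conjugate_gt1 p1)); congr sgpow.
by field; lra.
Qed.

Lemma norm_sgpow_le (R : realType) (e x : R) : 1 < e -> `|sgpow e x| <= 1 + `|x| `^ e.
Proof.
move=> e1; rewrite norm_sgpow//; have [x1|x1] := leP `|x| 1.
  apply: (@le_trans _ _ 1); last by rewrite lerDl powR_ge0.
  rewrite -[leRHS](congr1 (@^~ (e - 1)) (@powR1 R)); apply: ge0_ler_powR; rewrite ?nnegrE//; lra.
apply: (@le_trans _ _ (`|x| `^ e)); last by rewrite lerDr.
by apply: ler_powR; [exact: ltW|lra].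
Qed.

(** The quantity whose derivative appears in the equation: the
    gradient part of [radial_weak_equation] is the integral of [flux * rho']. *)
Definition flux (R : realType) (n : nat) (p : R) (w : R -> R) (s : R) : R :=
  2 * Num.sqrt s * sgpow p (slope w s) * radial_density n s.

Lemma radial_density_continuous (R : realType) n (s : R) : 0 < s ->
  {for s, continuous (@radial_density R n)}.
Proof.
move=> s0; apply: cvgM; first exact: cvg_cst.
have d := is_derive1_powR (n%:R / 2 - 1) s0.
exact: (differentiable_continuous (is_derive_differentiable d)).
Qed.

Lemma radial_density_gt0 (R : realType) n (s : R) : (0 < n)%N -> 0 < s ->
  0 < radial_density n s.
Proof.
move=> n0 s0; rewrite mulr_gt0 ?powR_gt0// mulr_gt0 ?unit_volume_gt0//.
by rewrite divr_gt0// ltr0n.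
Qed.

Section interior_regularity.
Context (R : realType) (n : nat) (p r mu : R).
Context (u : 'rV[R]_n.+1 -> R) (G : 'rV[R]_n.+1 -> 'rV[R]_n.+1) (z : R -> R).
Hypotheses (n0 : (0 < n)%N) (p1 : 1 < p) (pN : p < n.+1%:R) (r0 : 0 < r).
Hypothesis (usol : weak_solution (eball r) p mu u G).
Hypothesis cz : forall s, 0 < s -> {for s, continuous z}.
Hypothesis z0 : forall s, s <= 0 -> z s = 0.
Hypothesis uz : {ae lebesgue_rV n.+1, forall x, (u \_ (eball r)) x = z (dotp x x)}.
Let w := seq_derivative z.
Let q : R := critical_exponent (n := n.+1) p.
Let B s := mu * sgpow q (z s) * radial_density n.+1 s.

Lemma critical_exponent_gt : p < q.
Proof.
rewrite /q /critical_exponent ltr_pdivlMr ?subr_gt0//.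
have p0 : 0 < p by exact: lt_trans ltr01 p1.
by rewrite mulrC ltr_pM2r// ltrBlDr ltrDl.
Qed.

Let mz : measurable_fun [set: measurableTypeR R] z.
Proof. exact: open_continuous_extend_measurable. Qed.

Let mw : measurable_fun [set: measurableTypeR R] w.
Proof. exact: measurable_seq_derivative. Qed.

Let W1 : W1p0 (eball r) p u G. Proof. by case: usol. Qed.

Let Gw := (radial_gradient n0 r0 p1 W1 cz z0 uz).1.
Let slices := (radial_gradient n0 r0 p1 W1 cz z0 uz).2.

Let cB s : 0 < s -> {for s, continuous B}.
Proof.
move=> s0; apply: cvgM; last exact: radial_density_continuous.
apply: cvgM; first exact: cvg_cst.
apply: (@continuous_comp R R R z (sgpow q)); first exact: cz.
by apply: sgpow_continuous; apply: lt_trans p1 critical_exponent_gt.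
Qed.

Lemma radial_energy_integrable :
  (@lebesgue_measure R).-integrable `]0, +oo[ (fun s => (`|slope w s| `^ p * radial_density n.+1 s)%:E).
Proof. by case: W1 => -[_ LG _] _; exact: (energy_integrable n0 p1 LG mw Gw). Qed.

(** [|sgpow p x| <= 1 + |x|^p], and the energy is
    integrable. *)
Lemma flux_integrable (lo hi : R) : 0 < lo ->
  (@lebesgue_measure R).-integrable `[lo, hi] (EFin \o flux n.+1 p w).
Proof.
move=> lo0.
have mI : measurable (`[lo, hi]%classic : set (measurableTypeR R)) by [].
have iE : (@lebesgue_measure R).-integrable `[lo, hi]
    (EFin \o (fun s => `|slope w s| `^ p * radial_density n.+1 s)).
  apply: integrableS radial_energy_integrable => // s /=; rewrite !in_itv/= => /andP[h _].
  by rewrite (lt_le_trans lo0 h).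
have iden : (@lebesgue_measure R).-integrable `[lo, hi] (EFin \o radial_density n.+1).
  apply: continuous_compact_integrable; first exact: segment_compact.
  apply: continuous_in_subspaceT => s; rewrite inE/= in_itv/= => /andP[h _].
  by apply: radial_density_continuous; exact: lt_le_trans h.
apply: le_integrable (integrableZl mI (2 * Num.sqrt hi) (integrableD mI iden iE)) => //.
  apply/measurable_EFinP; apply: measurable_funTS; apply: measurable_funM; last exact: measurable_radial_density.
  apply: measurable_funM.
    by apply: measurable_funM => //; apply: continuous_measurable_fun; exact: sqrt_continuous.
  by apply: (measurableT_comp (measurable_sgpow p)); exact: measurable_slope.
move=> s; rewrite /= in_itv/= => /andP[ls sh].
have s0 : 0 < s by exact: lt_le_trans ls.
have d0 := radial_density_ge0 n.+1 s.
rewrite lee_fin /flux; move: (radial_density n.+1 s) d0 => d d0.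
have := norm_sgpow_le (slope w s) p1.
move: (sgpow p (slope w s)) (`|slope w s| `^ p) => f g fg.
have g0 : 0 <= 1 + g by exact: le_trans fg.
rewrite -{2}[d]mul1r -mulrDl !normrM (ger0_norm d0) (ger0_norm g0) !(ger0_norm (sqrtr_ge0 _)).
by rewrite -!mulrA ler_wpM2l// ler_pM ?mulr_ge0// ?ler_wsqrtr// ler_wpM2r.
Qed.

Lemma interior_weak_equation (lo hi lo' hi' : R) (rho rho' : R -> R) :
  0 < lo -> hi < r ^+ 2 -> lo < lo' -> hi' < hi -> smooth1 rho ->
  (forall s : R, is_derive s 1 rho (rho' s)) -> continuous rho' ->
  (forall s, ~~ (lo' <= s <= hi') -> rho s = 0 /\ rho' s = 0) ->
  \int[lebesgue_measure]_(s in `[lo, hi]) (flux n.+1 p w s * rho' s) =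
  \int[lebesgue_measure]_(s in `[lo, hi]) (B s * rho s).
Proof.
move=> lo0 hir llo' hhi' srho drho crho' out.
have := radial_weak_equation n0 p1 r0 usol mz mw uz Gw (lt_trans hhi' hir) srho drho crho' out.
have restr (f g : R -> R) : (forall s, g s = 0 -> f s = 0) ->
   (forall s, ~~ (lo' <= s <= hi') -> g s = 0) ->
   \int[lebesgue_measure]_(s in `]0, +oo[) f s = \int[lebesgue_measure]_(s in `[lo, hi]) f s.
  move=> fg gout; rewrite Rintegral_mkcond [RHS]Rintegral_mkcond; congr Rintegral.
  apply/funext => s; rewrite !patchE.
  have [h|/gout/fg ->] := boolP (lo' <= s <= hi'); last by rewrite !if_same.
  have /andP[h1 h2] := h.
  rewrite !mem_set//= in_itv/=.
    by rewrite (ltW (lt_le_trans llo' h1)) (ltW (le_lt_trans h2 hhi')).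
  by rewrite (lt_le_trans (lt_trans lo0 llo') h1).
rewrite (restr _ rho'); last 2 first.
- by move=> s ->; rewrite mulr0 mul0r.
- by move=> s /out[].
rewrite (restr _ rho); last 2 first.
- by move=> s ->; rewrite mulr0 mul0r.
- by move=> s /out[].
move=> E; transitivity (\int[lebesgue_measure]_(s in `[lo, hi])
   (2 * Num.sqrt s * sgpow p (slope w s) * rho' s * radial_density n.+1 s)).
  by apply: eq_Rintegral => s _; rewrite /flux; ring.
rewrite E -RintegralZl//.
  by apply: eq_Rintegral => s _; rewrite /B; ring.
apply: continuous_compact_integrable; first exact: segment_compact.
apply: continuous_in_subspaceT => s; rewrite inE/= in_itv/= => /andP[h _].
have s0 := lt_le_trans lo0 h.
apply: cvgM; last exact: radial_density_continuous.
apply: cvgM; last first.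
  by apply: differentiable_continuous; exact: is_derive_differentiable (drho s).
apply: (@continuous_comp R R R z (sgpow q)); first exact: cz.
by apply: sgpow_continuous; apply: lt_trans p1 critical_exponent_gt.
Qed.

(** Near [s] the flux is almost everywhere the
    continuous function [C - Bp], where [Bp] is a primitive of [B]. Solving for
    the derivative of [z] by [sgpow_conjK] gives a continuous function [wt] which
    agrees almost everywhere with [w], so that [z] is C^1 with derivative [wt] by
    [is_derive_of_slices]. Then [w] equals [wt] everywhere, and the flux equals
    [C - Bp] everywhere, which can be differentiated. *)
Lemma interior_regularity (s : R) : 0 < s < r ^+ 2 ->
  is_derive s 1 z (w s) /\ is_derive s 1 (flux n.+1 p w) (- B s).
Proof.
move=> /andP[s0 sr]; pose lo := s / 2; pose hi := (s + r ^+ 2) / 2.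
have lo0 : 0 < lo by rewrite /lo; lra.
have los : lo < s by rewrite /lo; lra.
have shi : s < hi by rewrite /hi; lra.
have hir : hi < r ^+ 2 by rewrite /hi; lra.
have cBI t : lo <= t <= hi -> {for t, continuous B}.
  by move=> /andP[h _]; apply: cB; exact: lt_le_trans h.
have [C CE] := weak_derivative_ae (lt_trans los shi) (flux_integrable hi lo0) cBI
  (fun rho rho' lo' hi' h1 h2 => interior_weak_equation lo0 hir h1 h2).
pose Bp (s : R) := \int[lebesgue_measure]_(t in `]-oo, s]) (B \_ `[lo, hi]) t.
have dBp t : lo < t < hi -> is_derive t 1 Bp (B t).
  by move=> h; exact: is_derive_restricted_primitive.
have cBp : continuous Bp.
  apply: continuous_indefinite_integral.
  rewrite -restrict_EFin; apply/(integrable_mkcond _ _).1 => //.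
  apply: continuous_compact_integrable; first exact: segment_compact.
  by apply: continuous_in_subspaceT => t; rewrite inE/= in_itv/=; exact: cBI.
have p'1 : 1 < p / (p - 1) by exact: conjugate_gt1.
pose wt (t : R) := sgpow (p / (p - 1))
  ((C - Bp t) / (2 * Num.sqrt t * radial_density n.+1 t)) / (2 * Num.sqrt t).
have cwt t : 0 < t -> {for t, continuous wt}.
  move=> t0.
  have cs : {for t, continuous (fun t : R => 2 * Num.sqrt t)}.
    by apply: cvgM; [exact: cvg_cst|exact: sqrt_continuous].
  have s20 : 2 * Num.sqrt t != 0 by rewrite gt_eqF// mulr_gt0// sqrtr_gt0.
  apply: cvgM; last exact: cvgV.
  apply: (@continuous_comp R R R (fun x : R => (C - Bp x) / (2 * Num.sqrt x * radial_density n.+1 x)) (sgpow (p / (p - 1)))); last exact: sgpow_continuous.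
  apply: cvgM; first by apply: cvgB; [exact: cvg_cst|exact: cBp].
  apply: cvgV; first by rewrite mulf_neq0// gt_eqF// radial_density_gt0.
  by apply: cvgM => //; exact: radial_density_continuous.
have wE t : 0 < t -> flux n.+1 p w t + Bp t = C -> w t = wt t.
  move=> t0 h.
  have s0' : 0 < Num.sqrt t by rewrite sqrtr_gt0.
  have d0 : 0 < radial_density n.+1 t by exact: radial_density_gt0.
  rewrite /wt -h /flux addrK.
  rewrite (_ : _ / (_ * radial_density n.+1 t) = sgpow p (slope w t)).
    by rewrite sgpow_conjK// /slope mulrAC divff ?mul1r// mulf_neq0// gt_eqF.
  by field; rewrite !gt_eqF.
have dz t : lo < t < hi -> is_derive t 1 z (wt t).
  have mG : measurable_fun setT ((fun x => G x ord0 ord0) \_ (eball r)).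
    by case: W1 => -[_ LG _] _; have := LG ord0; rewrite /Lp inE/= => /andP[]; rewrite inE.
  apply: (is_derive_of_slices n0 lo0 mG _ slices).
    by move=> t' /andP[h _]; apply: cwt; exact: lt_le_trans h.
  have wwt : {ae lebesgue_measure, forall t : measurableTypeR R, 0 < (t : R) -> lo < (t : R) < hi -> w t = wt t}.
    by apply: filterS CE => t' h t'0 t'I; apply: wE => //; exact: h.
  have := @ae_dotp R n.+1 (fun t => lo < t < hi -> w t = wt t) n0 wwt.
  apply: filterS2 (Gw ord0) => x -> hx /[dup] xI /andP[xl _].
  by rewrite -/w hx// (lt_trans lo0).
have wwt t : lo < t < hi -> w t = wt t.
  by move=> h; apply: seq_derivativeE; exact: dz.
have sI : lo < s < hi by rewrite los.
split; first by rewrite wwt//; exact: dz.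
apply: (near_eq_is_derive (f := fun t => C - Bp t)); last first.
  apply: is_derive_eq (is_derive1D (is_derive1C C s) (is_derive1N (dBp s sI))) _.
  by rewrite add0r.
near=> t.
have tI : lo < t < hi.
  by apply/andP; split; near: t; [exact: lt_nbhsr|exact: lt_nbhsl].
have t0 : 0 < t by apply: lt_trans lo0 _; case/andP: tI.
have s0' : 0 < Num.sqrt t by rewrite sqrtr_gt0.
have d0 : 0 < radial_density n.+1 t by exact: radial_density_gt0.
rewrite /flux /slope wwt// /wt.
set c := 2 * Num.sqrt t.
have c0 : c != 0 by rewrite gt_eqF// mulr_gt0.
rewrite [c * (_ / c)]mulrC divfK//.
by rewrite sgpow_conjKr//; field; rewrite c0 gt_eqF.
Unshelve. all: by end_near. Qed.

End interior_regularity.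

(** * Pohozaev identity for the radial equation *)

Lemma is_derive1_powRV (R : realType) (a t : R) : 0 < t ->
  is_derive t 1 (fun t => t `^ a) (a * (t `^ a / t)).
Proof.
move=> t0; apply: is_derive_eq (is_derive1_powR a t0) _.
by rewrite powRD ?powR_inv1 ?ltW// (gt_eqF t0) implybT.
Qed.

Lemma powR_subr1 (R : realType) (a t : R) : 0 < t -> t `^ (a - 1) = t `^ a / t.
Proof. by move=> t0; rewrite powRD ?powR_inv1 ?ltW// (gt_eqF t0) implybT. Qed.

Lemma sgpowM (R : realType) (e x : R) : 1 < e -> sgpow e x * x = `|x| `^ e.
Proof.
move=> e1; have [->|x0] := eqVneq x 0.
  by rewrite mulr0 normr0 powR0//; lra.
rewrite /sgpow -mulrA -expr2 -real_normK ?num_real// -powR_mulrn//.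
by rewrite -powRD ?subrK// normr_eq0 x0 implybT.
Qed.

Lemma norm_sgpow_conj (R : realType) (p x : R) : 1 < p ->
  `|sgpow (p / (p - 1)) x| `^ p = `|x| `^ (p / (p - 1)).
Proof.
move=> p1; rewrite norm_sgpow ?conjugate_gt1// -powRrM; congr powR; field; lra.
Qed.

Lemma is_derive_powabs_comp (R : realType) (e : R) (f : R -> R) (t df : R) :
  1 < e -> is_derive t 1 f df ->
  is_derive t 1 (fun t => `|f t| `^ e) (e * (sgpow e (f t) * df)).
Proof.
move=> e1 hf; rewrite mulrA.
exact: (is_derive1_comp (is_derive_powabs (f t) e1) hf).
Qed.

Lemma ge0_derive_le (R : realType) (r : R) (f df : R -> R) :
  (forall t : R, 0 < t < r -> is_derive t 1 f (df t)) ->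
  (forall t, 0 < t < r -> 0 <= df t) ->
  forall s t, 0 < s -> s <= t -> t < r -> f s <= f t.
Proof.
move=> h h0 s t s0 st tr.
have inI x : x \in `[s, t] -> 0 < x < r.
  by rewrite in_itv/= => /andP[h1 h2]; rewrite (lt_le_trans s0 h1) (le_lt_trans h2).
have [||c /inI cI E] := @MVT_segment _ f df s t st.
- move=> x xI; apply: h; apply: inI; exact: (subset_itv_oo_cc xI).
- apply: continuous_in_subspaceT => x; rewrite inE/= => /inI /h d.
  by apply: differentiable_continuous; exact: is_derive_differentiable d.
- by rewrite -subr_ge0 E mulr_ge0 ?h0// subr_ge0.
Qed.

Section emden_fowler.
Context (R : realType) (p N mu r : R) (v y : R -> R).
Hypotheses (p1 : 1 < p) (pN : p < N) (mu0 : 0 < mu) (r0 : 0 < r).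
Let pc := p / (p - 1).
Let q := N * p / (N - p).
Hypothesis dv : forall t : R, 0 < t < r -> is_derive t 1 v (sgpow pc (y t)).
Hypothesis dy : forall t : R, 0 < t < r ->
  is_derive t 1 y (- (mu * sgpow q (v t)) - (N - 1) / t * y t).

Let pc1 : 1 < pc. Proof. exact: conjugate_gt1. Qed.
Let p0 : p != 0. Proof. by rewrite gt_eqF//; move: p1; lra. Qed.
Let N0 : N != 0. Proof. by rewrite gt_eqF//; move: p1 pN; lra. Qed.
Let p10 : p - 1 != 0. Proof. by rewrite gt_eqF//; move: p1; lra. Qed.
Let Np0 : N - p != 0. Proof. by rewrite gt_eqF//; move: pN; lra. Qed.
Let q1 : 1 < q.
Proof. by move: p1 pN => h1 h2; rewrite /q ltr_pdivlMr; nra. Qed.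
Let pc0 : pc != 0. Proof. by rewrite gt_eqF// (lt_trans ltr01). Qed.
Let q0 : q != 0. Proof. by rewrite gt_eqF// (lt_trans ltr01). Qed.

(** The mechanical energy of a particle at [v], with
    [|y|^p' = |v'|^p]. *)
Definition radial_energy (t : R) : R := `|y t| `^ pc / pc + mu * (`|v t| `^ q / q).

(** Energy is dissipated by the friction term
    [(N - 1) / t * y] only. *)
Lemma is_derive_radial_energy (t : R) : 0 < t < r ->
  is_derive t 1 radial_energy (- ((N - 1) / t * `|y t| `^ pc)).
Proof.
move=> tI; have /andP[t0 _] := tI.
apply: is_derive_eq (is_derive1D
  (is_derive1M (is_derive_powabs_comp pc1 (dy tI)) (is_derive1C pc^-1 t))
  (is_derive1Z mu (is_derive1M (is_derive_powabs_comp q1 (dv tI)) (is_derive1C q^-1 t)))) _.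
rewrite -sgpowM//; set a := sgpow pc _; set b := sgpow q _.
by rewrite !mulr0 !addr0; field; rewrite pc0 q0 gt_eqF.
Qed.

Definition pohozaev (t : R) : R :=
  t `^ N * radial_energy t + (N - p) / p * (t `^ (N - 1) * (y t * v t)).

(** The terms in [|y|^p'] cancel for the factor
    [(N - p) / p], and those in [|v|^q] because [N / q = (N - p) / p], which
    characterizes the critical exponent. *)
Lemma is_derive_pohozaev (t : R) : 0 < t < r -> is_derive t 1 pohozaev 0.
Proof.
move=> tI; have /andP[t0 _] := tI.
apply: is_derive_eq (is_derive1D
  (is_derive1M (is_derive1_powRV N t0) (is_derive_radial_energy tI))
  (is_derive1Z ((N - p) / p) (is_derive1M (is_derive1_powRV (N - 1) t0) (is_derive1M (dy tI) (dv tI))))) _.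
rewrite /radial_energy powR_subr1// -!sgpowM//.
set a := sgpow pc _; set b := sgpow q _.
rewrite /pc /q; field.
by rewrite p0 p10 N0 Np0 gt_eqF.
Qed.

Lemma pohozaev_cst (s t : R) : 0 < s < r -> 0 < t < r -> pohozaev s = pohozaev t.
Proof.
wlog st : s t / s <= t => [h|] sI tI.
  have [st|ts] := leP s t; first exact: h.
  by apply/esym/h => //; exact: ltW.
have /andP[s0 _] := sI; have /andP[_ tr] := tI.
apply/eqP; rewrite eq_le; apply/andP; split.
  by apply: (ge0_derive_le is_derive_pohozaev).
rewrite -lerN2; apply: (@ge0_derive_le _ r (fun t => - pohozaev t) (fun=> 0)) => //.
by move=> x /is_derive_pohozaev h; apply: is_derive_eq (is_derive1N h) _; rewrite oppr0.
Qed.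

(** [gradient_mass] and [hardy_mass] are the densities with
    respect to [dt / t] of the two sides of Hardy's inequality. Both
    commute with the scaling of the critical equation. *)
Definition gradient_mass (t : R) : R := t `^ N * `|y t| `^ pc.
Definition hardy_mass (t : R) : R := t `^ (N - p) * `|v t| `^ p.

Let A := gradient_mass.
Let Z := hardy_mass.

Let A_ge0 t : 0 <= A t. Proof. by rewrite mulr_ge0 ?powR_ge0. Qed.
Let Z_ge0 t : 0 <= Z t. Proof. by rewrite mulr_ge0 ?powR_ge0. Qed.
Let pc_gt0 : 0 < pc. Proof. exact: lt_trans pc1. Qed.
Let p_gt0 : 0 < p. Proof. exact: lt_trans p1. Qed.
Let q_gt0 : 0 < q. Proof. exact: lt_trans q1. Qed.
Let pcV : pc^-1 + p^-1 = 1. Proof. by rewrite /pc; field; rewrite p0 p10. Qed.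

Let le_mass_sum t : A t / pc + Z t / p <= A t + Z t.
Proof.
have h (a b : R) : 0 <= a -> 1 < b -> a / b <= a.
  by move=> a0 b1; rewrite ler_pdivrMr ?(lt_trans ltr01)// ler_peMr// ltW.
by rewrite lerD ?h.
Qed.

(** Young's inequality for [t^(N/p') |y|] and
    [t^((N-p)/p) |v|], the exponents being those for which the powers are
    [A] and [Z]. *)
Lemma cross_term_le (t : R) : 0 < t -> t `^ (N - 1) * `|y t * v t| <= A t + Z t.
Proof.
move=> t0; apply: le_trans (le_mass_sum t).
have := @conjugate_powR R (t `^ (N / pc) * `|y t|) (t `^ ((N - p) / p) * `|v t|) pc p.
rewrite !mulr_ge0 ?powR_ge0// => /(_ isT isT pc_gt0 p_gt0 pcV).
rewrite !powRM ?powR_ge0// -!powRrM !divfK//; apply: le_trans.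
rewrite mulrACA -powRD; last by rewrite (gt_eqF t0) implybT.
by rewrite normrM (_ : N / pc + _ = N - 1)//; rewrite /pc; field; rewrite p0 p10.
Qed.

Lemma powRN_hardy (t : R) : 0 < t -> t `^ N * `|v t| `^ q = Z t `^ (q / p).
Proof.
move=> t0; rewrite /Z /hardy_mass powRM ?powR_ge0// -!powRrM.
by congr (_ `^ _ * _ `^ _); rewrite /q; field; rewrite ?p0 Np0.
Qed.

Lemma norm_pohozaev_le (t : R) : 0 < t ->
  `|pohozaev t| <= (1 + mu + (N - p) / p) * (A t + Z t + (A t + Z t) `^ (q / p)).
Proof.
move=> t0.
have K0 : 0 <= (N - p) / p by rewrite divr_ge0// ?subr_ge0 ltW.
have S0 : 0 <= A t + Z t by rewrite addr_ge0.
have Sq0 : 0 <= (A t + Z t) `^ (q / p) by rewrite powR_ge0.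
have e1 : `|t `^ N * radial_energy t| <= A t + Z t + mu * (A t + Z t) `^ (q / p).
  rewrite ger0_norm; last first.
    by rewrite !(mulr_ge0, addr_ge0)// ?invr_ge0 ?powR_ge0// ltW.
  rewrite /radial_energy mulrDr; apply: lerD.
    rewrite mulrA; apply: le_trans (le_mass_sum t).
    by rewrite lerDl divr_ge0// ltW.
  rewrite mulrCA ler_wpM2l ?(ltW mu0)// mulrA powRN_hardy//.
  apply: (@le_trans _ _ (Z t `^ (q / p))).
    by rewrite ler_pdivrMr// ler_peMr ?powR_ge0// ltW.
  have ZS : Z t <= A t + Z t by rewrite lerDr.
  have qp : 0 <= q / p := divr_ge0 (ltW q_gt0) (ltW p_gt0).
  by apply: ge0_ler_powR; rewrite ?nnegrE.
have e2 := cross_term_le t0.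
apply: le_trans (ler_normD _ _) _.
rewrite [X in _ + X <= _]normrM (ger0_norm K0) [X in _ + _ * X <= _]normrM (ger0_norm (powR_ge0 _ _)).
apply: le_trans (lerD e1 (ler_wpM2l K0 e2)) _.
move: mu0 => m0.
set S := A t + Z t in S0 Sq0 *; set T := _ `^ (q / p) in Sq0 *; set K := (N - p) / p in K0 *.
have h1 := mulr_ge0 (ltW m0) S0; have h2 := mulr_ge0 K0 Sq0.
rewrite -subr_ge0 (_ : _ - _ = mu * S + (T + K * T)); last by ring.
by rewrite !addr_ge0.
Qed.

(** [norm_pohozaev_le] prevents [A + Z] from being small
    where [|pohozaev|] is not, as [q / p > 1]. *)
Lemma mass_lower_bound (c : R) : c != 0 ->
  (forall t, 0 < t < r -> pohozaev t = c) ->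
  exists2 m, 0 < m & forall t, 0 < t < r -> m <= A t + Z t.
Proof.
move=> c0 Pc; set K := 1 + mu + (N - p) / p.
have K0 : 0 < K by rewrite !addr_gt0// divr_gt0// subr_gt0.
exists (Num.min 1 (`|c| / (2 * K))).
  by rewrite lt_min ltr01 divr_gt0 ?normr_gt0// mulr_gt0.
move=> t tI; have /andP[t0 _] := tI.
rewrite leNgt; apply/negP; rewrite lt_min => /andP[S1 S2].
have := norm_pohozaev_le t0; rewrite Pc// -/K.
have S0 : 0 <= A t + Z t by rewrite addr_ge0.
have Sq : (A t + Z t) `^ (q / p) <= A t + Z t.
  move: S0; rewrite le_eqVlt => /predU1P[<-|S0].
    by rewrite powR0// gt_eqF// divr_gt0.
  rewrite -[leRHS]powRr1 ?(ltW S0)//; apply: ger_powR; first by rewrite S0 ltW.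
  move: p1 pN => h1 h2.
  by rewrite /q ler_pdivlMr// mul1r ler_pdivlMr; nra.
move: S2; rewrite ltr_pdivlMr ?mulr_gt0// => S2.
by rewrite leNgt => /negP; apply; nra.
Qed.

Lemma is_derive_hardy_mass (t : R) : 0 < t < r -> is_derive t 1 Z
  ((N - p) * (t `^ (N - p) / t) * `|v t| `^ p +
   t `^ (N - p) * (p * (sgpow p (v t) * sgpow pc (y t)))).
Proof.
move=> tI; have /andP[t0 _] := tI.
exact: is_derive1M (is_derive1_powRV _ t0) (is_derive_powabs_comp p1 (dv tI)).
Qed.

(** The right hand side is [t Z']. Its first term is
    [(N - p) Z]; Young's inequality bounds the second one by [(N - p) / 2 * Z]
    plus a multiple of [A]. *)
Lemma hardy_mass_growth : exists2 C : R, 0 <= C & forall t, 0 < t < r ->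
  (N - p) / 2 * Z t - C * A t <= t *
  ((N - p) * (t `^ (N - p) / t) * `|v t| `^ p +
   t `^ (N - p) * (p * (sgpow p (v t) * sgpow pc (y t)))).
Proof.
pose k := (N - p) / 2.
have k0 : 0 < k by rewrite divr_gt0// subr_gt0.
(* this weight makes the first term of Young's inequality equal to k * Z t *)
pose l := (k * pc) `^ pc^-1.
have l0 : 0 < l by rewrite powR_gt0// mulr_gt0.
exists ((p / l) `^ p / p); first by rewrite divr_ge0 ?powR_ge0// ltW.
move=> t /andP[t0 _].
pose x := t `^ ((N - p) / pc) * `|v t| `^ (p - 1).
pose z := t `^ (N / p) * `|y t| `^ (pc - 1).
have x0 : 0 <= x by rewrite mulr_ge0 ?powR_ge0.
have z0 : 0 <= z by rewrite mulr_ge0 ?powR_ge0.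
have lx0 : 0 <= l * x by rewrite mulr_ge0// ltW.
have lz0 : 0 <= p / l * z by rewrite mulr_ge0// divr_ge0// ltW.
have xZ : x `^ pc = Z t.
  rewrite /x powRM ?powR_ge0// -!powRrM divfK//.
  by congr (_ * _ `^ _); rewrite /pc; field.
have zA : z `^ p = A t.
  rewrite /z powRM ?powR_ge0// -!powRrM divfK//.
  by congr (_ * _ `^ _); rewrite /pc; field.
have lk : l `^ pc = k * pc by rewrite /l -powRrM mulVf// powRr1// mulr_ge0// ltW.
have := conjugate_powR lx0 lz0 pc_gt0 p_gt0 pcV.
rewrite (powRM _ (ltW l0) x0) (@powRM _ (p / l) z)// ?divr_ge0 ?(ltW p_gt0) ?(ltW l0)// xZ zA lk.
rewrite (_ : l * x * _ = p * (x * z)); last by field; rewrite gt_eqF.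
rewrite (_ : x * z = t * t `^ (N - p) * `|sgpow p (v t) * sgpow pc (y t)|); last first.
  rewrite normrM !norm_sgpow// /x /z mulrACA -powRD; last by rewrite (gt_eqF t0) implybT.
  rewrite -[X in X * t `^ _]powRr1 ?ltW// -powRD; last by rewrite (gt_eqF t0) implybT.
  by congr (_ `^ _ * _); rewrite /pc; field; rewrite p0 p10.
move=> young.
set g := sgpow p _ * _ in young *.
have := ler_norm (- g); rewrite normrN => gn.
rewrite mulrDr (_ : t * ((N - p) * _ * _) = (N - p) * Z t); last first.
  by rewrite /Z /hardy_mass; field; rewrite gt_eqF.
rewrite -/k -lerBlDl -lerN2.
apply: (@le_trans _ _ (p * (t * t `^ (N - p) * `|g|))).
  rewrite (_ : - (t * _) = p * (t * t `^ (N - p) * - g)); last by ring.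
  by rewrite ler_wpM2l ?(ltW p_gt0)// ler_wpM2l// mulr_ge0 ?powR_ge0 ?ltW.
apply: le_trans young _.
rewrite (_ : k * pc * Z t / pc = k * Z t); last by field.
rewrite (_ : - (k * Z t - _ - _) = k * Z t + (p / l) `^ p / p * A t + (N - p - 2 * k) * Z t); last by ring.
rewrite (_ : N - p - 2 * k = 0) ?mul0r ?addr0; last by rewrite /k; field.
by rewrite [X in _ + X]mulrAC.
Qed.

(** If not, [H = Z - (C + k) I - k m ln t] is nondecreasing,
    because [t H' >= k (Z + A) - k m >= 0]. Since [I] is bounded and [Z >= 0], an
    upper bound on [H] near 0 bounds [ln t] from below. *)
Lemma pohozaev_eq0 (I : R -> R) (M : R) :
  (forall t : R, 0 < t < r -> is_derive t 1 I (- (A t / t))) ->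
  (forall t : R, 0 < t < r -> `|I t| <= M) ->
  forall t, 0 < t < r -> pohozaev t = 0.
Proof.
move=> dI IM t tI; apply/eqP/negPn/negP => c0.
have [m m0 mS] := mass_lower_bound c0 (fun s sI => pohozaev_cst sI tI).
have [C C0 growth] := hardy_mass_growth.
set k := (N - p) / 2 in growth.
have k0 : 0 < k by rewrite divr_gt0// subr_gt0.
pose H s := Z s + (- (C + k) * I s + - (k * m) * ln s).
have dH s : 0 < s < r -> is_derive s 1 H _ :=
  fun sI => is_derive1D (is_derive_hardy_mass sI)
    (is_derive1D (is_derive1Z (- (C + k)) (dI s sI)) (is_derive1Z (- (k * m)) (is_derive1_ln (proj1 (andP sI))))).
have incr := ge0_derive_le dH _.
have {}incr : forall s t, 0 < s -> s <= t -> t < r -> H s <= H t.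
  apply: incr => s sI; have /andP[s0 _] := sI.
  have h1 := growth _ sI; have h2 := mS _ sI.
  rewrite -(pmulr_rge0 _ s0).
  set d := (X in s * (X + _)); rewrite -/d in h1.
  rewrite (_ : s * _ = s * d + (C + k) * A s - k * m); last by field; rewrite gt_eqF.
  have : k * m <= k * (A s + Z s) by rewrite ler_wpM2l// ltW.
  lra.
have /andP[t0 tr] := tI.
pose L := - ((H t + (C + k) * M) / (k * m)).
have km0 : 0 < k * m by rewrite mulr_gt0.
have bound s : 0 < s -> s <= t -> L <= ln s.
  move=> s0 st; have sI : 0 < s < r by rewrite s0 (le_lt_trans st).
  have := incr _ _ s0 st tr; rewrite /H => h1.
  have := IM _ sI; rewrite ler_norml => /andP[_ h2].
  have h3 : (C + k) * I s <= (C + k) * M by rewrite ler_wpM2l// addr_ge0// ltW.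
  have h4 := Z_ge0 s.
  rewrite /L lerNl ler_pdivlMr//; rewrite /H; lra.
have s0 : 0 < Num.min t (expR (L - 1)) by rewrite lt_min t0 expR_gt0.
have st : Num.min t (expR (L - 1)) <= t by rewrite ge_min lexx.
have := bound _ s0 st; have : ln (Num.min t (expR (L - 1))) <= ln (expR (L - 1)).
  by rewrite ler_ln ?posrE ?expR_gt0// ge_min lexx orbT.
by rewrite expRK => h1 h2; have := le_trans h2 h1; lra.
Qed.

(** Here [P = 0] reads [t E = - (N - p) / p * y v]. As the
    left hand side contains [t |y|^p' / p'] with [p' > 1], smallness of [v] forces
    [|y| <= 1] and then [E] is at most a multiple of [|v|]: [E] tends to 0 at [r].
    With [k = (N - 1) p'], the function [t^k E] is nondecreasing. *)
Lemma emden_fowler_eq0 (I : R -> R) (M : R) :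
  (forall t : R, 0 < t < r -> is_derive t 1 I (- (A t / t))) ->
  (forall t : R, 0 < t < r -> `|I t| <= M) ->
  (forall e : R, 0 < e -> exists2 d : R, d < r & forall t : R, d < t < r -> `|v t| < e) ->
  forall t : R, 0 < t < r -> v t = 0.
Proof.
move=> dI IM v0.
have P0 := pohozaev_eq0 dI IM.
pose K2 := (N - p) / p.
have K20 : 0 < K2 by rewrite divr_gt0// subr_gt0.
have E_ge0 t : 0 <= radial_energy t.
  by rewrite !(mulr_ge0, addr_ge0)// ?invr_ge0 ?powR_ge0// ltW.
have PE t : 0 < t < r -> t * radial_energy t <= K2 * (`|y t| * `|v t|).
  move=> tI; have /andP[t0 _] := tI.
  have T0 : 0 < t `^ N by rewrite powR_gt0.
  have := P0 _ tI; rewrite /pohozaev powR_subr1// => h.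
  have -> : t * radial_energy t = K2 * - (y t * v t).
    have TE : t `^ N != 0 by rewrite gt_eqF.
    apply: (mulfI TE); rewrite mulrCA (_ : t `^ N * radial_energy t = - (K2 * (t `^ N / t * (y t * v t)))).
      by field; rewrite gt_eqF.
    by apply/eqP; rewrite -addr_eq0; apply/eqP.
  by rewrite ler_wpM2l ?(ltW K20)// -normrM -normrN ler_norm.
have Esmall t : r / 2 < t < r -> K2 * pc * `|v t| < r / 2 -> radial_energy t <= 2 * K2 / r * `|v t|.
  move=> /andP[rt tr] vt.
  have t0 : 0 < t by apply: lt_trans rt; rewrite divr_gt0.
  have := PE t; rewrite t0 tr => /(_ isT) h.
  have y1 : `|y t| <= 1.
    rewrite leNgt; apply/negP => y1.
    have yp : `|y t| <= `|y t| `^ pc.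
      by rewrite -[leLHS]powRr1//; apply: ler_powR; exact: ltW.
    have : t * (`|y t| `^ pc / pc) <= K2 * (`|y t| * `|v t|).
      apply: le_trans h; rewrite ler_wpM2l ?(ltW t0)// lerDl.
      by rewrite !(mulr_ge0)// ?invr_ge0 ?powR_ge0// ltW.
    rewrite mulrA ler_pdivrMr// leNgt => /negP; apply.
    apply: (@lt_le_trans _ _ (t * `|y t|)); last by rewrite ler_wpM2l// ltW.
    rewrite (_ : K2 * _ * _ = (K2 * pc * `|v t|) * `|y t|); last by ring.
    by rewrite ltr_pM2r ?(lt_trans vt)// (lt_trans ltr01).
  have h2 : r / 2 * radial_energy t <= K2 * `|v t|.
    apply: (@le_trans _ _ (t * radial_energy t)); first by rewrite ler_wpM2r// ltW.
    apply: le_trans h _; rewrite ler_wpM2l ?(ltW K20)// -[leRHS]mul1r.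
    by rewrite ler_wpM2r.
  rewrite mulrAC ler_pdivlMr//; lra.
pose k := (N - 1) * pc.
have N1 : 0 < N - 1 by move: p1 pN; lra.
have incr := @ge0_derive_le R r (fun t => t `^ k * radial_energy t) _
  (fun t tI => is_derive1M (is_derive1_powRV k (proj1 (andP tI))) (is_derive_radial_energy tI)) _.
have {}incr : forall s t, 0 < s -> s <= t -> t < r ->
    s `^ k * radial_energy s <= t `^ k * radial_energy t.
  apply: incr => t /andP[t0 _].
  rewrite (_ : _ + _ = t `^ k / t * (k * mu / q * `|v t| `^ q)).
    have k0 : 0 <= k := mulr_ge0 (ltW N1) (ltW pc_gt0).
    have kq : 0 <= k * mu / q := divr_ge0 (mulr_ge0 k0 (ltW mu0)) (ltW q_gt0).
    have tk : 0 <= t `^ k / t by rewrite divr_ge0 ?powR_ge0 ?(ltW t0).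
    exact: mulr_ge0 tk (mulr_ge0 kq (powR_ge0 _ _)).
  by rewrite /radial_energy /k; field; rewrite pc0 q0 gt_eqF.
move=> s sI; have /andP[s0 sr] := sI.
have Es : radial_energy s <= 0.
  suff : s `^ k * radial_energy s <= 0 by rewrite pmulr_rle0// powR_gt0.
  apply/ler_addgt0Pr => e e0; rewrite add0r.
  have C0 : 0 < r `^ k * (2 * K2 / r) by rewrite mulr_gt0 ?powR_gt0// divr_gt0// mulr_gt0.
  have [d1 d1r h1] := v0 (e / (r `^ k * (2 * K2 / r))) (divr_gt0 e0 C0).
  have [|d2 d2r h2] := v0 (r / 2 / (K2 * pc)); first by rewrite !divr_gt0// mulr_gt0.
  pose b := Num.max (Num.max s (r / 2)) (Num.max d1 d2).
  have br : b < r by rewrite !gt_max sr d1r d2r ltr_pdivrMr// ltr_pMr// ltrDl ltr01.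
  pose t := (b + r) / 2.
  have bt : b < t by rewrite /t; lra.
  have tr : t < r by rewrite /t; lra.
  move: (bt); rewrite /b !gt_max => /andP[/andP[st rt] /andP[dt1 dt2]].
  have t0 : 0 < t := lt_trans s0 st.
  apply: le_trans (incr _ _ s0 (ltW st) tr) _.
  apply: (@le_trans _ _ (r `^ k * (2 * K2 / r * `|v t|))).
    apply: ler_pM; rewrite ?powR_ge0//.
      have k0 : 0 <= k := mulr_ge0 (ltW N1) (ltW pc_gt0).
      by apply: ge0_ler_powR; rewrite ?nnegrE ?(ltW t0) ?(ltW tr) ?(ltW r0).
    apply: Esmall; first by rewrite rt.
    have := h2 t; rewrite dt2 tr => /(_ isT).
    by rewrite (ltr_pdivlMr _ _ (mulr_gt0 K20 pc_gt0)) mulrC.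
  have := h1 t; rewrite dt1 tr => /(_ isT).
  rewrite (ltr_pdivlMr _ _ C0) => /ltW; apply: le_trans.
  by rewrite le_eqVlt; apply/orP; left; apply/eqP; ring.
have : mu * (`|v s| `^ q / q) <= 0.
  apply: le_trans Es; rewrite lerDr mulr_ge0 ?powR_ge0// invr_ge0 ltW//.
rewrite pmulr_rle0// pmulr_lle0 ?invr_gt0// => h.
have /eqP : `|v s| `^ q = 0 by apply/eqP; rewrite eq_le h powR_ge0.
by rewrite powR_eq0 normr_eq0 => /andP[/eqP].
Qed.

End emden_fowler.

(** * The profile of a solution vanishes *)

Lemma is_derive1_sqr_comp (R : realType) (f : R -> R) (t d : R) :
  is_derive (t ^+ 2) 1 f d -> is_derive t 1 (fun t : R => f (t ^+ 2)) (d * (2 * t)).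
Proof.
by move=> h; exact: (@is_derive1_comp R f (fun t : R => t ^+ 2) t _ _ h (is_derive1_sqr t)).
Qed.

Section radial_solution.
Context (R : realType) (n : nat) (p r mu : R).
Context (u : 'rV[R]_n.+1 -> R) (G : 'rV[R]_n.+1 -> 'rV[R]_n.+1) (z : R -> R).
Hypotheses (n0 : (0 < n)%N) (p1 : 1 < p) (pN : p < n.+1%:R) (r0 : 0 < r) (mu0 : 0 < mu).
Hypothesis (usol : weak_solution (eball r) p mu u G).
Hypothesis cz : forall s, 0 < s -> {for s, continuous z}.
Hypothesis z0 : forall s, s <= 0 -> z s = 0.
Hypothesis zr : forall s, r ^+ 2 <= s -> z s = 0.
Hypothesis uz : {ae lebesgue_rV n.+1, forall x, (u \_ (eball r)) x = z (dotp x x)}.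
Let w := seq_derivative z.
Let N : R := n.+1%:R.
Let k := unit_volume R n.+1 * (N / 2).
Let v t := z (t ^+ 2).
Let y t := sgpow p (slope w (t ^+ 2)).
Let pc := p / (p - 1).

Let k0 : k != 0.
Proof. by rewrite mulf_neq0// gt_eqF ?unit_volume_gt0// divr_gt0// ltr0n. Qed.

Let sqrI t : 0 < t < r -> 0 < t ^+ 2 < r ^+ 2.
Proof.
move=> /andP[t0 tr]; rewrite exprn_gt0//=.
by rewrite ltrXn2r// ?nnegrE ?(ltW t0) ?(ltW r0).
Qed.

Let regular s (sI : 0 < s < r ^+ 2) :=
  interior_regularity n0 p1 pN r0 usol cz z0 uz sI.

Let densE t : 0 < t -> radial_density n.+1 (t ^+ 2) = k * (t `^ (N - 1) / t).
Proof.
move=> t0; rewrite /radial_density -/N -/k -powR_mulrn; last exact: ltW.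
rewrite -powRrM.
rewrite -powR_subr1//; congr (_ * _ `^ _); by field.
Qed.

Let slopeE t : 0 < t -> slope w (t ^+ 2) = w (t ^+ 2) * (2 * t).
Proof. by move=> t0; rewrite /slope sqrtr_sqr ger0_norm ?(ltW t0)//; ring. Qed.

Let sgpow_y t : sgpow pc (y t) = slope w (t ^+ 2).
Proof. exact: sgpow_conjK. Qed.

Let yE t : 0 < t -> y t = flux n.+1 p w (t ^+ 2) * ((2 * k)^-1 * t `^ (- (N - 1))).
Proof.
move=> t0; rewrite /flux densE// sqrtr_sqr ger0_norm ?(ltW t0)// powRN -/(y t).
by field; rewrite k0 !gt_eqF// powR_gt0.
Qed.

Lemma is_derive_profile (t : R) : 0 < t < r -> is_derive t 1 v (sgpow pc (y t)).
Proof.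
move=> tI; have /andP[t0 _] := tI.
rewrite sgpow_y slopeE//.
exact: is_derive1_sqr_comp (regular (sqrI tI)).1.
Qed.

(** The density of the squared radius contributes
    the factor [t^(N-1)] between [y] and the flux, hence the friction term. *)
Lemma is_derive_profile_flux (t : R) : 0 < t < r -> is_derive t 1 y
  (- (mu * sgpow (N * p / (N - p)) (v t)) - (N - 1) / t * y t).
Proof.
move=> tI; have /andP[t0 _] := tI.
have d := is_derive1_sqr_comp (regular (sqrI tI)).2.
apply: (near_eq_is_derive (f := fun t : R => flux n.+1 p w (t ^+ 2) * ((2 * k)^-1 * t `^ (- (N - 1))))).
  near=> s; rewrite yE//; near: s; exact: lt_nbhsr.
apply: is_derive_eq (is_derive1M d (is_derive1Z (2 * k)^-1 (is_derive1_powRV (- (N - 1)) t0))) _.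
rewrite [y t]yE// densE// powRN /v -[critical_exponent _]/(N * p / (N - p)).
by field; rewrite k0 !gt_eqF// powR_gt0.
Unshelve. all: by end_near. Qed.

Let e s := `|slope w s| `^ p * radial_density n.+1 s.
Let F s := \int[lebesgue_measure]_(t in `]-oo, s]) (e \_ `]0, +oo[) t.

Let ie : (@lebesgue_measure R).-integrable setT (EFin \o (e \_ `]0, +oo[)).
Proof.
rewrite -restrict_EFin; apply/(integrable_mkcond _ _).1 => //.
exact: (radial_energy_integrable n0 p1 r0 usol cz z0 uz).
Qed.

(** The continuity of the flux is transferred to the slope
    by inverting [sgpow p]. *)
Lemma slope_continuous (s : R) : 0 < s < r ^+ 2 -> {for s, continuous (slope w)}.
Proof.
move=> sI; have /andP[s0 _] := sI.
have cf : {for s, continuous (flux n.+1 p w)}.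
  by apply: differentiable_continuous; exact: is_derive_differentiable (regular sI).2.
apply: (@near_eq_continuous_at _ (fun s => sgpow pc (flux n.+1 p w s / (2 * Num.sqrt s * radial_density n.+1 s)))).
  near=> t.
  have t0 : 0 < t by near: t; exact: lt_nbhsr.
  rewrite /flux -[RHS](sgpow_conjK _ p1); congr (sgpow _ _).
  have d0 : 0 < radial_density n.+1 t by exact: radial_density_gt0.
  have s0' : 0 < Num.sqrt t by rewrite sqrtr_gt0.
  by field; rewrite !gt_eqF.
apply: (@continuous_comp R R R (fun s : R => flux n.+1 p w s / (2 * Num.sqrt s * radial_density n.+1 s)) (sgpow pc)); last first.
  by apply: sgpow_continuous; exact: conjugate_gt1.
apply: cvgM => //; apply: cvgV.
  by rewrite gt_eqF// mulr_gt0 ?radial_density_gt0// mulr_gt0// sqrtr_gt0.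
apply: cvgM; last exact: radial_density_continuous.
by apply: cvgM; [exact: cvg_cst|exact: sqrt_continuous].
Unshelve. all: by end_near. Qed.

Let dF s : 0 < s < r ^+ 2 -> is_derive s 1 F (e s).
Proof.
move=> sI; have /andP[s0 _] := sI.
have nf : \near s, e s = (e \_ `]0, +oo[) s.
  near=> t; rewrite patchE mem_set//= in_itv/= andbT.
  by near: t; exact: lt_nbhsr.
rewrite [X in is_derive _ _ _ X](nbhs_singleton nf).
apply: (is_derive_indefinite_integral ie); apply: near_eq_continuous_at nf _.
apply: cvgM; last exact: radial_density_continuous.
apply: (@continuous_comp R R R (slope w) (fun x : R => `|x| `^ p)); first exact: slope_continuous.
by apply: powabs_continuous; exact: ltW (lt_trans ltr01 p1).
Unshelve. all: by end_near. Qed.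

Let F_bounded s : `|F s| <= \int[lebesgue_measure]_t `|(e \_ `]0, +oo[) t|.
Proof.
apply: le_trans (le_normr_Rintegral _ _) _ => //; first by apply: integrableS ie.
have in_abs : (@lebesgue_measure R).-integrable setT (EFin \o (fun t => `|(e \_ `]0, +oo[) t|)).
  exact: integrable_norm ie.
rewrite /Rintegral fine_le//.
- by apply: integrable_fin_num => //; apply: integrableS in_abs.
- by apply: integrable_fin_num.
- apply: ge0_subset_integral => //.
  exact: measurable_int in_abs.
Qed.

Lemma profile_eq0 s : 0 < s < r ^+ 2 -> z s = 0.
Proof.
move=> sI; have /andP[s0 sr] := sI.
have sE : Num.sqrt s ^+ 2 = s by rewrite sqr_sqrtr// ltW.
rewrite -sE.
(* minus the energy inside the ball of radius t, up to a constant factor *)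
pose I t := - (2 * k)^-1 * F (t ^+ 2).
have [M IM] : exists M, forall t : R, 0 < t < r -> `|I t| <= M.
  exists (`|- (2 * k)^-1| * \int[lebesgue_measure]_t `|(e \_ `]0, +oo[) t|) => t _.
  by rewrite normrM ler_wpM2l.
apply: (emden_fowler_eq0 p1 pN mu0 r0 is_derive_profile is_derive_profile_flux (I := I) _ IM).
- move=> t tI; have /andP[t0 _] := tI.
  have d := is_derive1_sqr_comp (dF (sqrI tI)).
  apply: is_derive_eq (is_derive1Z (- (2 * k)^-1) d) _.
  rewrite /e densE// /gradient_mass -/pc -norm_sgpow_conj// -/pc sgpow_y powR_subr1//.
  by field; rewrite k0 gt_eqF.
- move=> d d0.
  have : {for r, continuous v}.
    apply: (@continuous_comp R R R (fun t : R => t ^+ 2) z); first exact: exprn_continuous.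
    by apply: cz; rewrite exprn_gt0.
  move=> /cvgrPdist_lt/(_ d d0); rewrite [v r]zr// => /nbhs_ballP[a a0 ha].
  exists (r - a); first by rewrite ltrBlDr ltrDl.
  move=> t /andP[h1 h2]; rewrite -normrN -[- v t]add0r; apply: ha.
  by rewrite /ball/= ger0_norm ?subr_ge0 ?(ltW h2)// ltrBlDr -ltrBlDl.
- rewrite sqrtr_gt0 s0/= -[ltRHS](ger0_norm (ltW r0)) -sqrtr_sqr.
  by rewrite ltr_sqrt ?exprn_gt0.
Qed.

End radial_solution.

Theorem proposition1p2 (R : realType) (N : nat) (p r mu : R)
    (p_gt1 : 1 < p) (p_ltN : p < N%:R) (r_gt0 : 0 < r) (mu_gt0 : 0 < mu)
    (u : 'rV[R]_N -> R) (G : 'rV[R]_N -> 'rV[R]_N)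
    (u_radial : radial (eball r) u)
    (u_sol : weak_solution (eball r) p mu u G) :
  {ae lebesgue_rV N, forall x, eball r x -> u x = 0}.
Proof.
case: N => [|n] in p_ltN u G u_radial u_sol *.
  by move: (lt_trans p_gt1 p_ltN); rewrite ltr10.
have n0 : (0 < n)%N by rewrite -ltnS -(ltr_nat R); exact: lt_trans p_gt1 p_ltN.
have [W _] := u_sol.
have [z [cz zr z0 uz]] := radial_profile n0 r_gt0 p_gt1 W u_radial.
apply: filterS (uz) => x ux xr; have xD : x \in eball r by rewrite inE.
move: ux; rewrite patchE xD => ->.
move: xr; rewrite eballE//= => xr.
have [x0|x0] := leP (dotp x x) 0; first exact: z0.
by apply: (profile_eq0 n0 p_gt1 p_ltN r_gt0 mu_gt0 u_sol cz z0 zr uz); rewrite x0.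
Qed.
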